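(* Let $b>0$ and $T>0$. For $m>0$ consider the minimization problems $$\text{(P)}\quad \min\{\mathcal E(u):\mathcal M(u)=m,\ u\in H^1_{\mathrm{loc}}\cap P_T\},$$ $$\text{(P0)}\quad \min\{\mathcal E(u):\mathcal M(u)=m,\ \mathcal P(u)=0,\ u\in H^1_{\mathrm{loc}}\cap P_T\}.$$ (i) For all $m>0$, (P) and (P0) share the same minimizers. The minimal energy is finite and negative. (ii) For all $0<m\le\frac{\pi^2}{bT}$ there exists a unique (up to phase shift $u\mapsto e^{i\theta}u$, $\theta\in\mathbb R$) minimizer of (P). It is the constant function $u_{\min}\equiv\sqrt{\frac{2m}{T}}$. (iii) For all $\frac{\pi^2}{bT}<m<\infty$ there exists a unique (up to translations $u\mapsto u(\cdot+y)$, $y\in\mathbb R$, and phase shift) minimizer of (P). It is the rescaled function $\mathrm{dn}_{\alpha,\beta,k}=\frac1\alpha\,\mathrm{dn}\left(\frac{\cdot}{\beta},k\right)$, where the parameters $\alpha>0$, $\beta>0$ and $k\in(0,1)$ are uniquely determined (by $b,T,m$). Its fundamental period is $T$. The map from $m\in(\frac{\pi^2}{bT},\infty)$ to $k\in(0,1)$ is one-to-one, onto and increasing. (iv) In particular, given $k\in(0,1)$, if $b=2$, $T=2K(k)$ and $m=\mathcal M(\mathrm{dn}(\cdot,k))=E(k)$, then the unique (up to translations and phase shift) minimizer of (P) is $\mathrm{dn}(\cdot,k)$.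
   Context: Functions are complex-valued on $\mathbb R$. $P_T=\{f\in L^2_{\mathrm{loc}}(\mathbb R): f(x+T)=f(x)\}$, and for $u\in H^1_{\mathrm{loc}}\cap P_T$, $$\mathcal M(u)=\tfrac12\int_0^T|u|^2dx,\quad \mathcal P(u)=\tfrac12\,\mathrm{Im}\int_0^T u\,\overline{u_x}\,dx,\quad \mathcal E(u)=\tfrac12\int_0^T|u_x|^2dx-\tfrac b4\int_0^T|u|^4dx.$$ Jacobi elliptic function with modulus $k\in(0,1)$: with $x=F(\phi,k)=\int_0^\phi\frac{d\theta}{\sqrt{1-k^2\sin^2\theta}}$, $\mathrm{dn}(x,k)=\sqrt{1-k^2\sin^2\phi}$. Complete elliptic integrals: $K(k)=F(\pi/2,k)$, $E(k)=\int_0^{\pi/2}\sqrt{1-k^2\sin^2\theta}\,d\theta$. *)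

(* Defs.v *)
From HB Require Import structures.
From mathcomp Require Import all_boot all_order all_algebra.
From mathcomp Require Import all_classical all_reals all_analysis.
From mathcomp Require Export complex.
Set Implicit Arguments.
Unset Strict Implicit.
Unset Printing Implicit Defensive.
Import Order.TTheory GRing.Theory Num.Theory.
Import numFieldNormedType.Exports.
Local Open Scope classical_set_scope.
Local Open Scope complex_scope.
Local Open Scope ring_scope.

(* Elements of L^2_loc are represented by measurable functions R -> R[i];      *)
(* two representatives are identified when they agree Lebesgue-a.e.            *)

Definition cmodulus (R : realType) (z : R[i]) : R := Normc.normc z.

Definition expi (R : realType) (t : R) : R[i] := cos t +i* sin t.

Definition ae_eq_fun (R : realType) (u v : R -> R[i]) : Prop :=
  {ae @lebesgue_measure R, forall x, u x = v x}.

Definition cmeasurable (R : realType) (u : R -> R[i]) : Prop :=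
  measurable_fun setT (fun x => complex.Re (u x)) /\
  measurable_fun setT (fun x => complex.Im (u x)).

Definition cintegral (R : realType) (D : set R) (u : R -> R[i]) : R[i] :=
  (\int[@lebesgue_measure R]_(x in D) complex.Re (u x)) +i*
  (\int[@lebesgue_measure R]_(x in D) complex.Im (u x)).

Definition Lploc (R : realType) (p : nat) (u : R -> R[i]) : Prop :=
  cmeasurable u /\
  forall a c : R,
    (\int[@lebesgue_measure R]_(x in `[a, c]) (cmodulus (u x) ^+ p)%:E
       < +oo)%E.

Definition test_function (R : realType) (phi : R -> R) : Prop :=
  (forall (n : nat) (x : R), derivable (derive1n n phi) x 1) /\
  (exists A : R, forall x : R, A < `|x| -> phi x = 0).

(* Real-valued test functions suffice, by linearity. *)
Definition weak_derivative (R : realType) (u v : R -> R[i]) : Prop :=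
  Lploc 1 v /\
  forall phi : R -> R, test_function phi ->
    cintegral setT (fun x => u x * (derive1 phi x)%:C) =
    - cintegral setT (fun x => v x * (phi x)%:C).

(* A representative of the weak derivative, which is unique up to a.e.         *)
(* equality; the value is irrelevant when there is none.                       *)
Definition wderiv (R : realType) (u : R -> R[i]) : R -> R[i] :=
  xget (fun=> 0) [set v | weak_derivative u v].

Definition H1loc (R : realType) (u : R -> R[i]) : Prop :=
  Lploc 2 u /\ exists2 v, weak_derivative u v & Lploc 2 v.

Definition ae_periodic (R : realType) (T : R) (u : R -> R[i]) : Prop :=
  ae_eq_fun (fun x => u (x + T)) u.

Definition mass (R : realType) (T : R) (u : R -> R[i]) : \bar R :=
  ((2^-1)%:E *
   \int[@lebesgue_measure R]_(x in `[0%R, T]) (cmodulus (u x) ^+ 2)%:E)%E.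

Definition momentum (R : realType) (T : R) (u : R -> R[i]) : R :=
  2^-1 * complex.Im (cintegral `[0, T] (fun x => u x * conjc (wderiv u x))).

Definition energy (R : realType) (b T : R) (u : R -> R[i]) : \bar R :=
  ((2^-1)%:E *
   \int[@lebesgue_measure R]_(x in `[0%R, T]) (cmodulus (wderiv u x) ^+ 2)%:E
   - (b / 4)%:E *
   \int[@lebesgue_measure R]_(x in `[0%R, T]) (cmodulus (u x) ^+ 4)%:E)%E.

Definition feasibleP (R : realType) (T m : R) : set (R -> R[i]) :=
  [set u | [/\ H1loc u, ae_periodic T u & mass T u = m%:E]].

Definition feasibleP0 (R : realType) (T m : R) : set (R -> R[i]) :=
  [set u | [/\ H1loc u, ae_periodic T u, mass T u = m%:E & momentum T u = 0]].

Definition is_minimizer (R : realType) (J : (R -> R[i]) -> \bar R)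
    (A : set (R -> R[i])) (u : R -> R[i]) : Prop :=
  A u /\ forall v, A v -> (J u <= J v)%E.

Definition minimizerP (R : realType) (b T m : R) : (R -> R[i]) -> Prop :=
  is_minimizer (energy b T) (feasibleP T m).

Definition minimizerP0 (R : realType) (b T m : R) : (R -> R[i]) -> Prop :=
  is_minimizer (energy b T) (feasibleP0 T m).

Definition eq_up_to_phase (R : realType) (u v : R -> R[i]) : Prop :=
  exists t : R, ae_eq_fun u (fun x => expi t * v x).

Definition eq_up_to_phase_translation (R : realType) (u v : R -> R[i]) : Prop :=
  exists t y : R, ae_eq_fun u (fun x => expi t * v (x + y)).

Definition fundamental_period (R : realType) (u : R -> R[i]) (T : R) : Prop :=
  [/\ 0 < T, forall x, u (x + T) = u x &
      forall S : R, 0 < S -> (forall x, u (x + S) = u x) -> T <= S].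

(* Incomplete elliptic integral of the first kind, of modulus k; for phi < 0   *)
(* the integral from 0 to phi is oriented.                                     *)
Definition ellipticF (R : realType) (phi k : R) : R :=
  let f t := (Num.sqrt (1 - k ^+ 2 * sin t ^+ 2))^-1 in
  if 0 <= phi then \int[@lebesgue_measure R]_(t in `[0, phi]) f t
  else - \int[@lebesgue_measure R]_(t in `[phi, 0]) f t.

Definition ellipticK (R : realType) (k : R) : R := ellipticF (pi / 2) k.

Definition ellipticE (R : realType) (k : R) : R :=
  \int[@lebesgue_measure R]_(t in `[0, pi / 2])
    Num.sqrt (1 - k ^+ 2 * sin t ^+ 2).

(* For 0 < k < 1, ellipticF ^~ k is a bijection of the real line, and the      *)
(* amplitude is its inverse.                                                   *)
Definition amplitude (R : realType) (x k : R) : R :=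
  xget 0 [set phi | ellipticF phi k = x].

Definition dn (R : realType) (x k : R) : R :=
  Num.sqrt (1 - k ^+ 2 * sin (amplitude x k) ^+ 2).

Definition dn_rescaled (R : realType) (alpha beta k : R) : R -> R[i] :=
  fun x => (alpha^-1 * dn (x / beta) k)%:C.

(* Main.v *)
Require Import Defs.
From mathcomp Require Import all_boot all_order all_algebra.
From mathcomp Require Import all_classical all_reals all_analysis.
From mathcomp Require Import measurable_realfun.
From mathcomp Require Import ring lra.
Import Order.TTheory GRing.Theory Num.Theory.
Import numFieldNormedType.Exports.
Local Open Scope classical_set_scope.
Local Open Scope complex_scope.
Local Open Scope ring_scope.

(* The energy depends on [u] only through its modulus [v] and the phase, and the
   phase only adds kinetic energy. If [v] ranges over [[p, q]], completing the
   square with the potential W(s) = (b/2) (s^2 - p^2) (q^2 - s^2),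

     |v'|^2 / 2 + W(v) / 2 >= |Phi(v)'|  with  Phi' = sqrt W,

   and counting that the closed curve [v] crosses [[p, q]] twice bounds the
   energy below by an explicit function of [p], [q] and the mass, in terms of
   the complete elliptic integrals of parameter [kap = 1 - (p / q)^2]. Up to
   the factor 2/b it is [gfun M T kap Q] with [Q = sqrt (b / 2) q] and
   [M = b m / 2]. Minimizing in [kap] along the curve of critical points, the
   sign of the derivative is that of 2 K E - M T; as K E increases from
   (pi / 2)^2 to infinity, the minimum is at [kap = 0] (constants) when
   b m T <= pi^2, and at the unique [kap] with 4 K E = b m T otherwise.
   Equality in the calibration forces [v] to be a translate of the dn wave and
   the phase to be constant; hence minimizers have zero momentum. *)

Set Implicit Arguments.
Unset Strict Implicit.

(** * Calculus on the line *)

(** The modulus of an H^1 function need not be differentiable at every point, and of the function k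
    that stores its kinetic energy only monotonicity is known. Everything is therefore phrased with
    increments: [h1curve v k] is the bound that Cauchy-Schwarz gives when k is a primitive of
    |v'|^2, the modulus inherits it, and local estimates on increments are integrated by a supremum
    argument. The bound degenerates when |u| has a zero, since then kap = 1 and K is infinite. At
    fixed Q, [gfun] stays a definite amount above its infimum as kap approaches 1, while calibrating
    with a slightly positive p costs an error that tends to 0; curves with zeros are thus never
    minimal. Equality is exploited by changing the weight in Young's inequality on a subinterval:
    weight 1 must be optimal there, so kinetic and potential parts agree on every subinterval.
    Reading v against the dn wave then gives a 1-Lipschitz time change that has to cover a
    half-period twice within one period, hence has speed one. *)

Lemma isd_eq (R : realType) (f : R -> R) (x a b : R) :
  is_derive x 1 f a -> a = b -> is_derive x 1 f b.
Proof. by move=> h <-. Qed.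

Lemma isd_ext (R : realType) (f g : R -> R) (x a : R) :
  f =1 g -> is_derive x 1 f a -> is_derive x 1 g a.
Proof. by move=> /funext ->. Qed.

Lemma isd_cst (R : realType) (c x : R) : is_derive x 1 (fun=> c) 0.
Proof. exact: is_derive_cst. Qed.

Lemma isd_id (R : realType) (x : R) : is_derive x 1 (fun y : R => y) 1.
Proof. exact: is_derive_id. Qed.

Lemma isdD (R : realType) (f g : R -> R) (x a b : R) :
  is_derive x 1 f a -> is_derive x 1 g b ->
  is_derive x 1 (fun y => f y + g y) (a + b).
Proof. by move=> hf hg; exact: is_deriveD. Qed.

Lemma isdB (R : realType) (f g : R -> R) (x a b : R) :
  is_derive x 1 f a -> is_derive x 1 g b ->
  is_derive x 1 (fun y => f y - g y) (a - b).
Proof. by move=> hf hg; exact: is_deriveB. Qed.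

Lemma isdN (R : realType) (f : R -> R) (x a : R) :
  is_derive x 1 f a -> is_derive x 1 (fun y => - f y) (- a).
Proof. by move=> hf; exact: is_deriveN. Qed.

Lemma isdM (R : realType) (f g : R -> R) (x a b : R) :
  is_derive x 1 f a -> is_derive x 1 g b ->
  is_derive x 1 (fun y => f y * g y) (a * g x + f x * b).
Proof.
move=> hf hg; apply: isd_eq (is_deriveM hf hg) _.
by rewrite /GRing.scale /=; ring.
Qed.

Lemma isdZ (R : realType) (f : R -> R) (c x a : R) :
  is_derive x 1 f a -> is_derive x 1 (fun y => c * f y) (c * a).
Proof. by move=> hf; apply: isd_eq (isdM (isd_cst c x) hf) _; ring. Qed.

Lemma isdX (R : realType) (f : R -> R) (n : nat) (x a : R) :
  is_derive x 1 f a ->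
  is_derive x 1 (fun y => f y ^+ n.+1) (n.+1%:R * f x ^+ n * a).
Proof.
move=> hf; have := is_deriveX n.+1 hf; rewrite /GRing.scale /=.
by apply: isd_ext => y; rewrite exprfctE.
Qed.

Lemma isd_comp (R : realType) (f g : R -> R) (x a b : R) :
  is_derive (g x) 1 f a -> is_derive x 1 g b ->
  is_derive x 1 (fun y => f (g y)) (a * b).
Proof.
by move=> hf hg; exact: is_derive1_comp.
Qed.

Lemma isd_inv (R : realType) (f : R -> R) (x a : R) :
  f x != 0 -> is_derive x 1 f a ->
  is_derive x 1 (fun y => (f y)^-1) (- (f x ^- 2) * a).
Proof. by move=> f0 hf; exact: is_deriveV. Qed.

Lemma isd_sqrt (R : realType) (f : R -> R) (x a : R) :
  0 < f x -> is_derive x 1 f a ->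
  is_derive x 1 (fun y => Num.sqrt (f y)) (a / (2 * Num.sqrt (f x))).
Proof.
move=> f0 hf; apply: isd_eq (isd_comp (is_derive1_sqrt f0) hf) _.
by rewrite mulrC.
Qed.

Lemma isd_sin (R : realType) (x : R) : is_derive x 1 (fun y : R => sin y) (cos x).
Proof. exact: is_derive_sin. Qed.

Lemma isd_cos (R : realType) (x : R) : is_derive x 1 (fun y : R => cos y) (- sin x).
Proof. exact: is_derive_cos. Qed.

Lemma isd_shift (R : realType) (f : R -> R) (c x a : R) :
  is_derive (x + c) 1 f a -> is_derive x 1 (fun y => f (y + c)) a.
Proof.
move=> h; apply: isd_eq (isd_comp (g := fun y => y + c) h
  (isdD (isd_id x) (isd_cst c x))) _; ring.
Qed.

Lemma isd_cont (R : realType) (f : R -> R) (x a : R) :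
  is_derive x 1 f a -> {for x, continuous f}.
Proof.
by move=> h; apply/differentiable_continuous/derivable1_diffP; exact: ex_derive.
Qed.

Lemma cont_eps (R : realType) (f : R -> R) (x e : R) :
  {for x, continuous f} -> 0 < e ->
  exists2 d, 0 < d & forall y, `|y - x| < d -> `|f y - f x| < e.
Proof.
move=> /cvgrPdist_lt /(_ e) cf e0; have /= := cf e0.
rewrite -nbhs_nearE => /nbhs_ballP [d /= d0 h]; exists d => // y yd.
by rewrite distrC; apply: h; rewrite /ball /= distrC.
Qed.

Lemma eps_cont (R : realType) (f : R -> R) (x : R) :
  (forall e, 0 < e -> exists2 d, 0 < d &
     forall y, `|y - x| < d -> `|f y - f x| <= e) -> {for x, continuous f}.
Proof.
move=> h; apply/cvgrPdist_le => e e0; have [d d0 hd] := h e e0.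
rewrite -nbhs_nearE; apply/nbhs_ballP; exists d => //= y.
by rewrite /ball /= => yd; rewrite distrC; apply: hd; rewrite distrC.
Qed.

Lemma isd_eps (R : realType) (f : R -> R) (x a e : R) :
  is_derive x 1 f a -> 0 < e ->
  exists2 d, 0 < d & forall y, `|y - x| < d ->
    `|f y - f x - a * (y - x)| <= e * `|y - x|.
Proof.
move=> /is_derive1_caratheodory [g [fE gc gx]] e0.
have [d d0 hd] := cont_eps gc e0.
exists d => // y yd; rewrite fE -gx -mulrBl normrM.
by apply: ler_wpM2r => //; apply/ltW/hd.
Qed.

Lemma eps_isd (R : realType) (f : R -> R) (x a : R) :
  (forall e, 0 < e -> exists2 d, 0 < d & forall y, `|y - x| < d ->
    `|f y - f x - a * (y - x)| <= e * `|y - x|) -> is_derive x 1 f a.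
Proof.
move=> h; apply/is_derive1_caratheodory.
exists (fun y => if y == x then a else (f y - f x) / (y - x)); split.
- move=> y; case: eqP => [->|/eqP yx]; first by rewrite !subrr mulr0.
  by rewrite divfK // subr_eq0.
- apply: eps_cont => e e0; have [d d0 hd] := h e e0.
  exists d => // y yd; rewrite eqxx; case: eqP => [_|/eqP yx].
    by rewrite subrr normr0 ltW.
  have yx0 : y - x != 0 by rewrite subr_eq0.
  have -> : (f y - f x) / (y - x) - a = (f y - f x - a * (y - x)) / (y - x).
    by field.
  by rewrite normrM normfV ler_pdivrMr ?normr_gt0 //; exact: hd.
- by rewrite eqxx.
Qed.

(** Real induction: the supremum of the points x with f x <= f s is such a point and cannot lie
    below t. It replaces the sign of a derivative, which the functions built from k below need not
    have. *)
Lemma locally_nonincreasing (R : realType) (f : R -> R) (s t : R) : s <= t ->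
  (forall x, s <= x <= t -> exists2 d, 0 < d & forall y, s <= y <= t ->
     `|y - x| < d -> (x <= y -> f y <= f x) /\ (y <= x -> f x <= f y)) ->
  f t <= f s.
Proof.
move=> st loc.
pose A := [set x | s <= x <= t /\ f x <= f s].
have As : A s by split; rewrite ?lexx.
have hA : has_sup A.
  by split; [exists s | exists t => x [/andP[]]].
have sA : s <= sup A by apply: ub_le_sup => //; case: hA.
have At : sup A <= t by apply: ge_sup => //; [exists s | move=> x [/andP[]]].
have [d d0 hd] := loc (sup A) ltac:(by rewrite sA At).
have [a [/andP[sa at_] fa] da] := sup_adherent d0 hA.
have aA : a <= sup A by apply: ub_le_sup; [case: hA | split => //; rewrite sa].
have fA : f (sup A) <= f s.
  apply: le_trans fa; have [_] := hd a ltac:(by rewrite sa) ltac:(by rewrite ler0_norm; lra).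
  exact.
move: At; rewrite le_eqVlt => /orP[/eqP <- //|At].
pose y := Num.min t (sup A + d / 2).
have yt : y <= t by rewrite ge_min lexx.
have Ay : sup A < y by rewrite lt_min At /=; lra.
have yd : y <= sup A + d / 2 by rewrite ge_min lexx orbT.
have [fy _] := hd y ltac:(apply/andP; split; lra) ltac:(rewrite ger0_norm; lra).
suff : y <= sup A by lra.
apply: ub_le_sup; first by case: hA.
by split; [apply/andP; split; lra | apply: le_trans (fy _) fA; lra].
Qed.

Lemma isd_const (R : realType) (f : R -> R) (x y : R) :
  (forall z : R, is_derive z 1 f 0) -> f x = f y.
Proof. exact: is_derive_0_is_cst. Qed.

Lemma isd_mean (R : realType) (f df : R -> R) (a b : R) : a < b ->
  (forall x, a <= x <= b -> {for x, continuous f}) ->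
  (forall x, a < x < b -> is_derive x 1 f (df x)) ->
  exists2 c, a < c < b & f b - f a = df c * (b - a).
Proof.
move=> ab cf h.
have h' x : x \in `]a, b[%R -> is_derive x 1 f (df x).
  by rewrite in_itv /=; exact: h.
have cf' : {within `[a, b], continuous f}.
  by apply: continuous_in_subspaceT => x; rewrite inE /= in_itv /=; exact: cf.
have [c cab e] := MVT ab h' cf'.
by exists c => //; move: cab; rewrite in_itv.
Qed.

Lemma isd_mono (R : realType) (f df : R -> R) (a b : R) : a <= b ->
  (forall x, a <= x <= b -> {for x, continuous f}) ->
  (forall x, a < x < b -> is_derive x 1 f (df x)) ->
  (forall x, a < x < b -> 0 <= df x) -> f a <= f b.
Proof.
rewrite le_eqVlt => /orP[/eqP -> //|ab] cf h p.
have [c cab e] := isd_mean ab cf h.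
by rewrite -subr_ge0 e mulr_ge0 ?p // subr_ge0 ltW.
Qed.

Lemma isd_smono (R : realType) (f df : R -> R) (a b : R) : a < b ->
  (forall x, a <= x <= b -> {for x, continuous f}) ->
  (forall x, a < x < b -> is_derive x 1 f (df x)) ->
  (forall x, a < x < b -> 0 < df x) -> f a < f b.
Proof.
move=> ab cf h p; have [c cab e] := isd_mean ab cf h.
by rewrite -subr_gt0 e mulr_gt0 ?p // subr_gt0.
Qed.

Lemma isd_anti (R : realType) (f df : R -> R) (a b : R) : a <= b ->
  (forall x, a <= x <= b -> {for x, continuous f}) ->
  (forall x, a < x < b -> is_derive x 1 f (df x)) ->
  (forall x, a < x < b -> df x <= 0) -> f b <= f a.
Proof.
rewrite le_eqVlt => /orP[/eqP -> //|ab] cf h p.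
have [c cab e] := isd_mean ab cf h.
by rewrite -subr_le0 e mulr_le0_ge0 ?p // subr_ge0 ltW.
Qed.

Lemma isd_santi (R : realType) (f df : R -> R) (a b : R) : a < b ->
  (forall x, a <= x <= b -> {for x, continuous f}) ->
  (forall x, a < x < b -> is_derive x 1 f (df x)) ->
  (forall x, a < x < b -> df x < 0) -> f b < f a.
Proof.
move=> ab cf h p; have [c cab e] := isd_mean ab cf h.
by rewrite -subr_lt0 e nmulr_rlt0 ?p // subr_gt0.
Qed.

(** * Integrals and primitives of continuous functions *)

Lemma integrable_cont (R : realType) (f : R -> R) (a b : R) :
  continuous f -> (@lebesgue_measure R).-integrable `[a, b] (EFin \o f).
Proof.
move=> cf; apply: continuous_compact_integrable; first exact: segment_compact.
exact: continuous_subspaceT.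
Qed.

Lemma FTC (R : realType) (F f : R -> R) (a b : R) : a <= b ->
  continuous f -> (forall x : R, is_derive x 1 F (f x)) ->
  \int[@lebesgue_measure R]_(x in `[a, b]) f x = F b - F a.
Proof.
rewrite le_eqVlt => /orP[/eqP -> cf dF|ab cf dF].
  by rewrite set_itv1 Rintegral_set1 subrr.
have cF x : {for x, continuous F} by exact: isd_cont (dF x).
rewrite /Rintegral (@continuous_FTC2 R f F) //.
- exact: continuous_subspaceT.
- split.
  + by move=> x _; exact: ex_derive.
  + exact: cvg_at_right_filter (cF a).
  + exact: cvg_at_left_filter (cF b).
- by move=> x _; rewrite derive1E; exact: derive_val.
Qed.

(** The orientation for x < 0 copies [ellipticF], so that [ellipticKE] and [dnE] hold by
    computation. *)
Definition prim (R : realType) (f : R -> R) (x : R) : R :=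
  if 0 <= x then \int[@lebesgue_measure R]_(t in `[0, x]) f t
  else - \int[@lebesgue_measure R]_(t in `[x, 0]) f t.


Definition locint (R : realType) (f : R -> R) : Prop :=
  forall a b : R, (@lebesgue_measure R).-integrable `[a, b] (EFin \o f).

Lemma Rintegral_split (R : realType) (f : R -> R) (a x b : R) :
  locint f -> a <= x -> x <= b ->
  \int[@lebesgue_measure R]_(t in `[a, b]) f t =
  \int[@lebesgue_measure R]_(t in `[a, x]) f t +
  \int[@lebesgue_measure R]_(t in `[x, b]) f t.
Proof.
move=> lf ax xb.
rewrite -(@Rintegral_itv_obnd_cbnd _ x (BRight b)); last first.
  by apply: integrableS (lf x b) => //; exact: subset_itv_oc_cc.
rewrite -(@Rintegral_itvB _ f (BLeft a) (BRight b) x) ?bnd_simp //.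
by rewrite addrC subrK.
Qed.

Lemma prim_diff (R : realType) (f : R -> R) (x y : R) : locint f -> x <= y ->
  prim f y - prim f x = \int[@lebesgue_measure R]_(t in `[x, y]) f t.
Proof.
move=> lf xy; rewrite /prim; case: (leP 0 x) => x0; case: (leP 0 y) => y0.
- by rewrite (@Rintegral_split _ f 0 x y) // addrC addKr.
- lra.
- by rewrite (@Rintegral_split _ f x 0 y) ?(ltW x0) // opprK addrC.
- by rewrite (@Rintegral_split _ f x y 0) ?(ltW y0) // opprK addrC addrK.
Qed.

Lemma prim0 (R : realType) (f : R -> R) : prim f 0 = 0.
Proof. by rewrite /prim lexx set_itv1 Rintegral_set1. Qed.

Lemma prim_isd (R : realType) (f : R -> R) (x : R) : continuous f ->
  is_derive x 1 (prim f) (f x).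
Proof.
move=> cf; have lf : locint f by move=> a b; exact: integrable_cont.
have x1 : x < x + 1 by lra.
have [dF F'] := @continuous_FTC1 R f (BLeft (x - 1)) x (x + 1) x1
  (lf _ _) ltac:(rewrite /= lte_fin; lra) (cf x).
apply: (@near_eq_is_derive _ _ _ (fun y => prim f (x - 1) +
    \int[@lebesgue_measure R]_(t in `[x - 1, y]) f t)); last first.
  apply: isd_eq (isdD (isd_cst (prim f (x - 1)) x) _) (add0r (f x)).
  by rewrite -F' derive1E; exact: derivableP.
near=> y; rewrite -prim_diff // ?[RHS]addrC ?subrK // 1?addrC ?subrK //.
near: y; exists 1 => //= z; rewrite /= ltr_norml => /andP[]; lra.
Unshelve. all: by end_near.
Qed.

Lemma locint_cont (R : realType) (f : R -> R) : continuous f -> locint f.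
Proof. by move=> cf a b; exact: integrable_cont. Qed.

Lemma isd_all_cont (R : realType) (f df : R -> R) :
  (forall x : R, is_derive x 1 f (df x)) -> continuous f.
Proof. by move=> h x; exact: isd_cont (h x). Qed.

Lemma prim_cont (R : realType) (f : R -> R) : continuous f -> continuous (prim f).
Proof. by move=> cf; exact: isd_all_cont (fun x => prim_isd x cf). Qed.

Lemma int_gt0 (R : realType) (f : R -> R) (a b x : R) : continuous f ->
  (forall y, 0 <= f y) -> a <= x < b -> 0 < f x ->
  0 < \int[@lebesgue_measure R]_(t in `[a, b]) f t.
Proof.
move=> cf f0 /andP[ax xb] fx.
have [d d0 hd] := cont_eps (cf x) fx.
pose y := Num.min b (x + d).
have xy : x < y by rewrite lt_min xb /=; lra.
have yb : y <= b by rewrite ge_min lexx.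
have yd : y <= x + d by rewrite ge_min lexx orbT.
rewrite -prim_diff; [|exact: locint_cont|lra].
have cp z := prim_cont cf z; have dp z := prim_isd z cf.
have mono u v : u <= v -> prim f u <= prim f v.
  by move=> uv; apply: (isd_mono uv (fun z _ => cp z) (fun z _ => dp z)).
have : prim f x < prim f y.
  apply: (isd_smono xy (fun z _ => cp z) (fun z _ => dp z)) => z /andP[xz zy].
  have := hd z ltac:(rewrite gtr0_norm; lra).
  rewrite ltr_norml => /andP[]; lra.
by have := mono a x ax; have := mono y b yb; lra.
Qed.

(** * Complete elliptic integrals as functions of the parameter k^2 *)

Lemma isd_under_int (R : realType) (f df : R -> R -> R) (u v a c d C : R) :
  u < a < v ->
  (forall x, u < x < v -> continuous (f x)) ->
  (forall x y : R, u < x < v -> is_derive x 1 (f ^~ y) (df x y)) ->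
  (forall x y, u < x < v -> `|df x y| <= C) ->
  is_derive a 1 (fun x => \int[@lebesgue_measure R]_(y in `[c, d]) f x y)
    (\int[@lebesgue_measure R]_(y in `[c, d]) df a y).
Proof.
move=> uav cf hd hC.
have C0 : 0 <= C by apply: le_trans (hC a 0 uav).
have md : measurable (`[c, d]%classic : set R) by [].
have Ia : (`]u, v[%classic : set R) a by rewrite /= in_itv.
have intf x : (`]u, v[%classic : set R) x ->
    (@lebesgue_measure R).-integrable `[c, d] (EFin \o f x).
  by rewrite /= in_itv /= => ux; apply: integrable_cont; exact: cf.
have derf x y : (`]u, v[%classic : set R) x -> (`[c, d]%classic : set R) y ->
    derivable (f ^~ y) x 1.
  by rewrite /= in_itv /= => ux _; apply: (@ex_derive _ _ _ _ _ _ (df x y)); exact: hd.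
have intG : (@lebesgue_measure R).-integrable `[c, d] (EFin \o (fun=> C)).
  by apply: integrable_cont => x; exact: cvg_cst.
have dE x y : u < x < v -> partial1of2 f x y = df x y.
  by move=> ux; rewrite partial1of2E; apply: (@derive_val _ _ _ _ _ _ (df x y)); exact: hd.
have GC x y : (`]u, v[%classic : set R) x -> (`[c, d]%classic : set R) y ->
    `|partial1of2 f x y| <= C.
  by rewrite /= in_itv /= => ux _; rewrite dE //; exact: hC.
have dF := @derivable_under_integral R _ _ (@lebesgue_measure R) f _ md a u v Ia
  intf derf (fun=> C) (fun=> C0) intG GC.
have eF := @differentiation_under_integral R _ _ (@lebesgue_measure R) f _ md a u v Ia
  intf derf (fun=> C) (fun=> C0) intG GC.
apply: isd_eq (derivableP dF) _.
rewrite -derive1E eF; apply: eq_Rintegral => y _; exact: dE.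
Qed.

(** In the elliptic functions below, [k] is the square of the modulus; the link with the modulus is
    made by [ellipticKE], [ellipticEE] and [dnE]. *)
Definition Dl (R : realType) (k t : R) : R := 1 - k * sin t ^+ 2.

Lemma sin2_01 (R : realType) (t : R) : 0 <= sin t ^+ 2 <= 1.
Proof. by rewrite sqr_ge0 /= sin2cos2 gerBl sqr_ge0. Qed.

Lemma Dl_gt0 (R : realType) (k t : R) : k < 1 -> 0 < Dl k t.
Proof.
move=> k1; rewrite /Dl; have /andP[s0 s1] := sin2_01 t.
by case: (leP 0 k) => k0; nra.
Qed.

Lemma Dl_ge (R : realType) (k v t : R) : 0 <= v -> k <= v -> 1 - v <= Dl k t.
Proof.
move=> v0 kv; rewrite /Dl; have /andP[s0 s1] := sin2_01 t; nra.
Qed.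

Lemma sqrtD_gt0 (R : realType) (k t : R) : k < 1 -> 0 < Num.sqrt (Dl k t).
Proof. by move=> k1; rewrite sqrtr_gt0 Dl_gt0. Qed.

Lemma sqr_sqrtD (R : realType) (k t : R) : k < 1 -> Num.sqrt (Dl k t) ^+ 2 = Dl k t.
Proof. by move=> k1; rewrite sqr_sqrtr // ltW // Dl_gt0. Qed.

Lemma isd_sin2 (R : realType) (t : R) :
  is_derive t 1 (fun t : R => sin t ^+ 2) (2 * sin t * cos t).
Proof. by apply: isd_eq (isdX 1 (isd_sin t)) _; rewrite expr1. Qed.

Lemma isd_Dl (R : realType) (k t : R) :
  is_derive t 1 (Dl k) (- k * (2 * sin t * cos t)).
Proof.
apply: isd_eq (isdB (isd_cst 1 t) (isdZ k (isd_sin2 t))) _; ring.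
Qed.

Lemma isd_sqrtD (R : realType) (k t : R) : k < 1 ->
  is_derive t 1 (fun t => Num.sqrt (Dl k t))
    (- k * sin t * cos t / Num.sqrt (Dl k t)).
Proof.
move=> k1; apply: isd_eq (isd_sqrt (Dl_gt0 t k1) (isd_Dl k t)) _.
have := lt0r_neq0 (sqrtD_gt0 t k1) => n0; by field.
Qed.

Lemma cont_sqrtD (R : realType) (k : R) : k < 1 ->
  continuous (fun t => Num.sqrt (Dl k t)).
Proof. by move=> k1; exact: isd_all_cont (fun t => isd_sqrtD t k1). Qed.

Lemma isd_isqrtD (R : realType) (k t : R) : k < 1 ->
  is_derive t 1 (fun t => (Num.sqrt (Dl k t))^-1)
    (k * sin t * cos t / Num.sqrt (Dl k t) ^+ 3).
Proof.
move=> k1; have n0 := lt0r_neq0 (sqrtD_gt0 t k1).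
by apply: isd_eq (@isd_inv _ (fun t => Num.sqrt (Dl k t)) _ _ n0 (isd_sqrtD t k1)) _; field.
Qed.

Lemma cont_isqrtD (R : realType) (k : R) : k < 1 ->
  continuous (fun t => (Num.sqrt (Dl k t))^-1).
Proof. by move=> k1; exact: isd_all_cont (fun t => isd_isqrtD t k1). Qed.

Definition Einc (R : realType) (k : R) : R -> R := prim (fun t => Num.sqrt (Dl k t)).
Definition Finc (R : realType) (k : R) : R -> R := prim (fun t => (Num.sqrt (Dl k t))^-1).
Definition Ec (R : realType) (k : R) : R := Einc k (pi / 2).
Definition Kc (R : realType) (k : R) : R := Finc k (pi / 2).

Lemma isd_Einc (R : realType) (k t : R) : k < 1 ->
  is_derive t 1 (Einc k) (Num.sqrt (Dl k t)).
Proof. by move=> k1; apply: prim_isd; exact: cont_sqrtD. Qed.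

Lemma isd_Finc (R : realType) (k t : R) : k < 1 ->
  is_derive t 1 (Finc k) (Num.sqrt (Dl k t))^-1.
Proof. by move=> k1; apply: prim_isd; exact: cont_isqrtD. Qed.

Lemma pihalf_ge0 (R : realType) : 0 <= pi / 2 :> R.
Proof. by rewrite divr_ge0 // pi_ge0. Qed.

Lemma prim_pihalf (R : realType) (f : R -> R) :
  prim f (pi / 2) = \int[@lebesgue_measure R]_(t in `[0, pi / 2]) f t.
Proof. by rewrite /prim pihalf_ge0. Qed.

(* [E - k sin cos / sqrt D] is a primitive of [(1 - k) D^(-3/2)]. *)
Lemma int_Dm3 (R : realType) (k : R) : k < 1 ->
  (1 - k) * \int[@lebesgue_measure R]_(t in `[0, pi / 2])
    (Num.sqrt (Dl k t) ^+ 3)^-1 = Ec k.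
Proof.
move=> k1.
have n0 t := lt0r_neq0 (sqrtD_gt0 t k1).
have n1 : 1 - k != 0 by rewrite subr_eq0 gt_eqF.
pose F t := (Einc k t - k * (sin t * cos t * (Num.sqrt (Dl k t))^-1)) / (1 - k).
have dF (t : R) : is_derive t 1 F (Num.sqrt (Dl k t) ^+ 3)^-1.
  have h := isdM (isdB (isd_Einc t k1)
    (isdZ k (isdM (isdM (isd_sin t) (isd_cos t)) (isd_isqrtD t k1))))
    (isd_cst (1 - k)^-1 t).
  apply: isd_eq h _.
  have hs := sqr_sqrtD t k1; rewrite {2}/Dl in hs.
  have r0 := n0 t; set r := Num.sqrt _ in hs r0 *.
  have hc := cos2sin2 t.
  have key : r ^+ 4 - k * ((cos t ^+ 2 - sin t ^+ 2) * r ^+ 2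
               + k * sin t ^+ 2 * cos t ^+ 2) = 1 - k.
    have -> : r ^+ 4 = (r ^+ 2) ^+ 2 by rewrite -exprM.
    rewrite hs hc. ring.
  transitivity ((r ^+ 4 - k * ((cos t ^+ 2 - sin t ^+ 2) * r ^+ 2
               + k * sin t ^+ 2 * cos t ^+ 2)) / ((1 - k) * r ^+ 3)).
    by field; rewrite r0 n1.
  by rewrite key; field; rewrite r0 n1.
have cD3 : continuous (fun t => (Num.sqrt (Dl k t) ^+ 3)^-1).
  move=> t; apply: (@isd_cont _ _ _ _
    (@isd_inv _ (fun t => Num.sqrt (Dl k t) ^+ 3) _ _ _ (isdX 2 (isd_sqrtD t k1)))).
  by rewrite expf_eq0 /= n0.
rewrite (FTC (pihalf_ge0 R) cD3 dF) /F /Ec.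
rewrite sin0 cos_pihalf /Einc prim0; field; rewrite n1 !n0 //.
Qed.

(* [3 jc] is a primitive-free form of [3 k^2 sin^2 cos^2 / sqrt D] integrated
   over a quarter period. *)
Definition jc (R : realType) (k : R) : R :=
  ((2 - k) * Ec k - 2 * (1 - k) * Kc k) / 3.

(** Along the amplitude of dn its derivative is the square of dn', and along s = q sqrt D it is
    [Phif] up to sign, factor and constant. The same function thus measures the kinetic energy of
    the wave and the oscillation of the calibration. *)
Definition jinc (R : realType) (k t : R) : R :=
  ((2 - k) * Einc k t - 2 * (1 - k) * Finc k t
   - k * (sin t * cos t * Num.sqrt (Dl k t))) / 3.

Lemma isd_jinc (R : realType) (k t : R) : k < 1 ->
  is_derive t 1 (jinc k)
    (k ^+ 2 * sin t ^+ 2 * cos t ^+ 2 / Num.sqrt (Dl k t)).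
Proof.
move=> k1.
have h := isdM (isdB (isdB (isdZ (2 - k) (isd_Einc t k1))
    (isdZ (2 * (1 - k)) (isd_Finc t k1)))
    (isdZ k (isdM (isdM (isd_sin t) (isd_cos t)) (isd_sqrtD t k1))))
    (isd_cst 3^-1 t).
apply: isd_eq h _.
have hs := sqr_sqrtD t k1; rewrite {2}/Dl in hs.
have r0 := lt0r_neq0 (sqrtD_gt0 t k1); set r := Num.sqrt _ in hs r0 *.
have hc := cos2sin2 t.
transitivity (((2 - k) * r ^+ 2 - 2 * (1 - k) - k * ((cos t ^+ 2 - sin t ^+ 2) * r ^+ 2
   - k * sin t ^+ 2 * cos t ^+ 2)) / (3 * r)); first by field.
by rewrite hs hc; field.
Qed.

Lemma jinc_pihalf (R : realType) (k : R) : jinc k (pi / 2) = jc k.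
Proof. by rewrite /jinc cos_pihalf mulr0 mul0r mulr0 subr0. Qed.

Lemma jinc0 (R : realType) (k : R) : jinc k 0 = 0.
Proof. by rewrite /jinc sin0 /Einc /Finc !prim0; ring. Qed.

(** The range reaches below 0 so that k = 0 is an interior point: monotonicity arguments on [0, 1)
    need continuity there, while the closed forms [isd_Ec'] and [isd_Kc'] divide by k. The
    dominating constant uses v midway between k and 1, which keeps D away from 0. *)
Lemma isd_Ec (R : realType) (k : R) : -1 < k < 1 ->
  is_derive k 1 (@Ec R) (\int[@lebesgue_measure R]_(t in `[0, pi / 2])
     - (sin t ^+ 2 / (2 * Num.sqrt (Dl k t)))).
Proof.
move=> /andP[km k1].
apply: (isd_ext (f := fun x => \int[@lebesgue_measure R]_(t in `[0, pi / 2])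
   Num.sqrt (Dl x t))); first by move=> x; rewrite /Ec /Einc prim_pihalf.
pose v := (k + 1) / 2; have v0 : 0 <= v by rewrite /v; lra.
have kv : k < v by rewrite /v; lra.
have v1 : v < 1 by rewrite /v; lra.
apply: (@isd_under_int _ _ (fun k t => - (sin t ^+ 2 / (2 * Num.sqrt (Dl k t))))
  (-1) v k 0 (pi / 2) ((2 * Num.sqrt (1 - v))^-1)).
- by rewrite km kv.
- by move=> x /andP[_ xv]; apply: cont_sqrtD; lra.
- move=> x y /andP[_ xv].
  have x1 : x < 1 by lra.
  have h : is_derive x 1 (fun x => Dl x y) (- sin y ^+ 2).
    apply: isd_eq (isdB (isd_cst 1 x) (isdM (isd_id x) (isd_cst (sin y ^+ 2) x))) _.
    ring.
  apply: isd_eq (@isd_sqrt _ (fun x => Dl x y) _ _ (Dl_gt0 y x1) h) _.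
  by rewrite mulNr.
- move=> x y /andP[_ xv]; have /andP[s0 s1] := sin2_01 y.
  have x1 : x < 1 by lra.
  have p := sqrtD_gt0 y x1.
  have q : 0 < Num.sqrt (1 - v) by rewrite sqrtr_gt0; lra.
  rewrite normrN ger0_norm; last by rewrite divr_ge0 // mulr_ge0 // ltW.
  rewrite -[leRHS]mul1r; apply: ler_pM => //.
  rewrite lef_pV2 ?posrE ?mulr_gt0 //; apply: ler_wpM2l => //.
  by apply: ler_wsqrtr; apply: Dl_ge => //; exact: ltW.
Qed.

Lemma isd_Kc (R : realType) (k : R) : -1 < k < 1 ->
  is_derive k 1 (@Kc R) (\int[@lebesgue_measure R]_(t in `[0, pi / 2])
     (sin t ^+ 2 / (2 * Num.sqrt (Dl k t) ^+ 3))).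
Proof.
move=> /andP[km k1].
apply: (isd_ext (f := fun x => \int[@lebesgue_measure R]_(t in `[0, pi / 2])
   (Num.sqrt (Dl x t))^-1)); first by move=> x; rewrite /Kc /Finc prim_pihalf.
pose v := (k + 1) / 2; have v0 : 0 <= v by rewrite /v; lra.
have kv : k < v by rewrite /v; lra.
have v1 : v < 1 by rewrite /v; lra.
apply: (@isd_under_int _ _ (fun k t => (sin t ^+ 2 / (2 * Num.sqrt (Dl k t) ^+ 3)))
  (-1) v k 0 (pi / 2) ((2 * Num.sqrt (1 - v) ^+ 3)^-1)).
- by rewrite km kv.
- by move=> x /andP[_ xv]; apply: cont_isqrtD; lra.
- move=> x y /andP[_ xv].
  have x1 : x < 1 by lra.
  have h : is_derive x 1 (fun x => Dl x y) (- sin y ^+ 2).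
    apply: isd_eq (isdB (isd_cst 1 x) (isdM (isd_id x) (isd_cst (sin y ^+ 2) x))) _.
    ring.
  have n0 := lt0r_neq0 (sqrtD_gt0 y x1).
  apply: isd_eq (@isd_inv _ (fun x => Num.sqrt (Dl x y)) _ _ n0
    (@isd_sqrt _ (fun x => Dl x y) _ _ (Dl_gt0 y x1) h)) _.
  by field.
- move=> x y /andP[_ xv]; have /andP[s0 s1] := sin2_01 y.
  have x1 : x < 1 by lra.
  have p := sqrtD_gt0 y x1.
  have q : 0 < Num.sqrt (1 - v) by rewrite sqrtr_gt0; lra.
  have p3 := exprn_gt0 3 p; have q3 := exprn_gt0 3 q.
  rewrite ger0_norm; last by rewrite divr_ge0 // mulr_ge0 // ltW.
  rewrite -[leRHS]mul1r; apply: ler_pM => //.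
  rewrite lef_pV2 ?posrE ?mulr_gt0 //; apply: ler_wpM2l => //.
  have qr : Num.sqrt (1 - v) <= Num.sqrt (Dl x y).
    by apply: ler_wsqrtr; apply: Dl_ge => //; exact: ltW.
  by rewrite lerXn2r ?nnegrE ?(ltW p) ?(ltW q).
Qed.

Lemma RintB (R : realType) (f g : R -> R) (a b : R) : continuous f -> continuous g ->
  \int[@lebesgue_measure R]_(t in `[a, b]) (f t - g t) =
  \int[@lebesgue_measure R]_(t in `[a, b]) f t -
  \int[@lebesgue_measure R]_(t in `[a, b]) g t.
Proof. by move=> cf cg; apply: RintegralB => //; exact: integrable_cont. Qed.

Lemma RintD (R : realType) (f g : R -> R) (a b : R) : continuous f -> continuous g ->
  \int[@lebesgue_measure R]_(t in `[a, b]) (f t + g t) =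
  \int[@lebesgue_measure R]_(t in `[a, b]) f t +
  \int[@lebesgue_measure R]_(t in `[a, b]) g t.
Proof. by move=> cf cg; apply: RintegralD => //; exact: integrable_cont. Qed.

Lemma RintZ (R : realType) (f : R -> R) (c a b : R) : continuous f ->
  \int[@lebesgue_measure R]_(t in `[a, b]) (c * f t) =
  c * \int[@lebesgue_measure R]_(t in `[a, b]) f t.
Proof. by move=> cf; apply: RintegralZl => //; exact: integrable_cont. Qed.

Lemma EcE (R : realType) (k : R) :
  Ec k = \int[@lebesgue_measure R]_(t in `[0, pi / 2]) Num.sqrt (Dl k t).
Proof. by rewrite /Ec /Einc prim_pihalf. Qed.

Lemma KcE (R : realType) (k : R) :
  Kc k = \int[@lebesgue_measure R]_(t in `[0, pi / 2]) (Num.sqrt (Dl k t))^-1.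
Proof. by rewrite /Kc /Finc prim_pihalf. Qed.

Lemma cont_Dm3 (R : realType) (k : R) : k < 1 ->
  continuous (fun t => (Num.sqrt (Dl k t) ^+ 3)^-1).
Proof.
move=> k1 t; apply: (@isd_cont _ _ _ _
  (@isd_inv _ (fun t => Num.sqrt (Dl k t) ^+ 3) _ _ _ (isdX 2 (isd_sqrtD t k1)))).
by rewrite expf_eq0 /= lt0r_neq0 // sqrtD_gt0.
Qed.

Lemma isd_Ec' (R : realType) (k : R) : 0 < k < 1 ->
  is_derive k 1 (@Ec R) (- (Kc k - Ec k) / (2 * k)).
Proof.
move=> /andP[k0 k1]; apply: isd_eq (@isd_Ec _ k _) _; first by rewrite k1 andbT; lra.
have cE := cont_sqrtD k1; have cK := cont_isqrtD k1.
rewrite EcE KcE -RintB // mulNr -mulrN [RHS]mulrC -RintZ; last first.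
  by move=> t; apply: cvgB; [exact: cK | exact: cE].
apply: eq_Rintegral => t _.
have hs := sqr_sqrtD t k1; rewrite {2}/Dl in hs.
have r0 := lt0r_neq0 (sqrtD_gt0 t k1); set r := Num.sqrt _ in hs r0 *.
have -> : sin t ^+ 2 = (1 - r ^+ 2) / k by rewrite hs; field; exact: lt0r_neq0.
by field; rewrite r0 lt0r_neq0.
Qed.

Lemma isd_Kc' (R : realType) (k : R) : 0 < k < 1 ->
  is_derive k 1 (@Kc R) ((Ec k / (1 - k) - Kc k) / (2 * k)).
Proof.
move=> /andP[k0 k1]; apply: isd_eq (@isd_Kc _ k _) _; first by rewrite k1 andbT; lra.
have c3 := cont_Dm3 k1; have cK := cont_isqrtD k1.
have n1 : 1 - k != 0 by rewrite subr_eq0 gt_eqF.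
rewrite -int_Dm3 // KcE mulrAC divff // mul1r -RintB // [RHS]mulrC -RintZ; last first.
  by move=> t; apply: cvgB; [exact: c3 | exact: cK].
apply: eq_Rintegral => t _.
have hs := sqr_sqrtD t k1; rewrite {2}/Dl in hs.
have r0 := lt0r_neq0 (sqrtD_gt0 t k1); set r := Num.sqrt _ in hs r0 *.
have -> : sin t ^+ 2 = (1 - r ^+ 2) / k by rewrite hs; field; exact: lt0r_neq0.
by field; rewrite r0 lt0r_neq0.
Qed.

(** K - E vanishes at 0 and increases to infinity. It is twice the derivative of [jc], which is how
    it governs the critical points of [gfun]. *)
Definition Nc (R : realType) (k : R) : R := Kc k - Ec k.

Lemma isd_Nc (R : realType) (k : R) : 0 < k < 1 ->
  is_derive k 1 (@Nc R) (Ec k / (2 * (1 - k))).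
Proof.
move=> k01; apply: isd_eq (isdB (isd_Kc' k01) (isd_Ec' k01)) _.
have /andP[k0 k1] := k01; have n1 : 1 - k != 0 by rewrite subr_eq0 gt_eqF.
by field; rewrite n1 lt0r_neq0.
Qed.

Lemma isd_jc (R : realType) (k : R) : 0 < k < 1 ->
  is_derive k 1 (@jc R) (Nc k / 2).
Proof.
move=> k01; have /andP[k0 k1] := k01.
have n1 : 1 - k != 0 by rewrite subr_eq0 gt_eqF.
apply: isd_eq (isdM (isdB (isdM (isdB (isd_cst 2 k) (isd_id k)) (isd_Ec' k01))
  (isdM (isdZ 2 (isdB (isd_cst 1 k) (isd_id k))) (isd_Kc' k01))) (isd_cst 3^-1 k)) _.
by rewrite /Nc; field; rewrite n1 lt0r_neq0.
Qed.

Lemma cos_ge0 (R : realType) (t : R) : 0 <= t <= pi / 2 -> 0 <= cos t.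
Proof.
move=> /andP[t0 t1]; apply: cos_ge0_pihalf; rewrite t1 andbT.
by apply: le_trans t0; rewrite oppr_le0 pihalf_ge0.
Qed.

Lemma sin_ge0 (R : realType) (t : R) : 0 <= t <= pi / 2 -> 0 <= sin t.
Proof.
move=> /andP[t0 t1]; apply: sin_ge0_pi; rewrite t0 /= (le_trans t1) //.
by have := pi_gt0 R; lra.
Qed.

Lemma RintC (R : realType) (c a b : R) : a <= b ->
  \int[@lebesgue_measure R]_(t in `[a, b]) c = c * (b - a).
Proof.
move=> ab; have cc : continuous (fun _ : R => c) by move=> x; exact: cvg_cst.
have dc (x : R) : is_derive x 1 (fun t => c * t) c.
  by apply: isd_eq (isdZ c (isd_id x)) _; rewrite mulr1.
by rewrite (FTC ab cc dc); ring.
Qed.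

Lemma Rint_le (R : realType) (f g : R -> R) (a b : R) : continuous f -> continuous g ->
  (forall t, a <= t <= b -> f t <= g t) ->
  \int[@lebesgue_measure R]_(t in `[a, b]) f t <=
  \int[@lebesgue_measure R]_(t in `[a, b]) g t.
Proof.
move=> cf cg fg; apply: le_Rintegral => //; try exact: integrable_cont.
Qed.

Lemma Ec_ge1 (R : realType) (k : R) : k < 1 -> 1 <= Ec k.
Proof.
move=> k1; have -> : 1 = \int[@lebesgue_measure R]_(t in `[0, pi / 2]) cos t.
  rewrite (FTC (pihalf_ge0 R) (@continuous_cos R) (@isd_sin R)).
  by rewrite sin_pihalf sin0 subr0.
rewrite EcE; apply: Rint_le; [exact: continuous_cos | exact: cont_sqrtD |].
move=> t t01; rewrite -(ger0_norm (cos_ge0 t01)) -sqrtr_sqr; apply: ler_wsqrtr.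
by rewrite /Dl cos2sin2; have /andP[s0 s1] := sin2_01 t; nra.
Qed.

Lemma Ec0 (R : realType) : Ec 0 = pi / 2 :> R.
Proof.
rewrite EcE (@eq_Rintegral _ _ _ _ _ (fun=> 1)); last first.
  by move=> t _; rewrite /Dl mul0r subr0 sqrtr1.
by rewrite RintC ?pihalf_ge0 // mul1r subr0.
Qed.

Lemma Kc0 (R : realType) : Kc 0 = pi / 2 :> R.
Proof.
rewrite KcE (@eq_Rintegral _ _ _ _ _ (fun=> 1)); last first.
  by move=> t _; rewrite /Dl mul0r subr0 sqrtr1 invr1.
by rewrite RintC ?pihalf_ge0 // mul1r subr0.
Qed.

(** Inserting a factor sin t <= 1 makes the integrand elementary: - ln (sqrt k cos t + sqrt D) /
    sqrt k is a primitive of sin t / sqrt D. The bound expresses the divergence of K at k = 1. *)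
Lemma Kc_ge_ln (R : realType) (k : R) : 0 < k < 1 -> - (ln (1 - k) / 2) <= Kc k.
Proof.
move=> /andP[k0 k1]; have q0 : 0 < Num.sqrt k by rewrite sqrtr_gt0.
have n0 t := lt0r_neq0 (sqrtD_gt0 t k1).
have qs : Num.sqrt k ^+ 2 = k by rewrite sqr_sqrtr // ltW.
have p0 t : 0 < Num.sqrt k * cos t + Num.sqrt (Dl k t).
  rewrite addrC -[Num.sqrt k * _]opprK subr_gt0.
  rewrite (le_lt_trans (ler_norm _)) // normrN normrM (ger0_norm (ltW q0)).
  rewrite -ltr_sqr ?nnegrE ?mulr_ge0 ?sqrtr_ge0 //.
  rewrite exprMn qs real_normK ?num_real // sqr_sqrtD // /Dl cos2sin2; lra.
pose F (t : R) := - (ln (Num.sqrt k * cos t + Num.sqrt (Dl k t)) / Num.sqrt k).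
have dF (t : R) : is_derive t 1 F (sin t / Num.sqrt (Dl k t)).
  have h := isdD (isdZ (Num.sqrt k) (isd_cos t)) (isd_sqrtD t k1).
  apply: isd_eq (isdN (isdM (@isd_comp _ _ (fun t => Num.sqrt k * cos t + Num.sqrt (Dl k t)) _ _ _
    (is_derive1_ln (p0 t)) h) (isd_cst (Num.sqrt k)^-1 t))) _.
  have m0 := lt0r_neq0 (p0 t); have r0 := n0 t; have q1 := lt0r_neq0 q0.
  rewrite -[in - k]qs; set q := Num.sqrt k in m0 q1 *; set r := Num.sqrt _ in m0 r0 *.
  by field; rewrite m0 r0 q1.
have cs : continuous (fun t => sin t / Num.sqrt (Dl k t)).
  by move=> t; apply: cvgM; [exact: continuous_sin | exact: cont_isqrtD].
apply: (@le_trans _ _ (\int[@lebesgue_measure R]_(t in `[0, pi / 2])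
    (sin t / Num.sqrt (Dl k t)))); last first.
  rewrite KcE; apply: Rint_le => //; first exact: cont_isqrtD.
  move=> t _; rewrite ler_piMl ?sin_le1 // invr_ge0 sqrtr_ge0.
rewrite (FTC (pihalf_ge0 R) cs dF) /F cos_pihalf cos0 mulr0 add0r mulr1 /Dl.
rewrite sin_pihalf sin0 expr1n expr0n /= mulr1 mulr0 subr0 sqrtr1.
have s1 : 0 < Num.sqrt (1 - k) by rewrite sqrtr_gt0 subr_gt0.
have l1 : ln (1 - k) = 2 * ln (Num.sqrt (1 - k)).
  rewrite -[in LHS](@sqr_sqrtr _ (1 - k)) ?subr_ge0 ?(ltW k1) // lnXn //.
  by rewrite mulr_natl.
rewrite l1 mulrAC divff // mul1r.
have lq : 0 <= ln (Num.sqrt k + 1) by apply: ln_ge0; rewrite lerDr ltW.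
have ls : ln (Num.sqrt (1 - k)) <= 0.
  by apply: ln_le0; rewrite -[leRHS]sqrtr1; apply: ler_wsqrtr; lra.
have q1 : Num.sqrt k <= 1 by rewrite -[leRHS]sqrtr1; apply: ler_wsqrtr; exact: ltW.
set L := ln (Num.sqrt (1 - k)) in ls *; set l := ln (Num.sqrt k + 1) in lq *.
rewrite [leRHS](_ : _ = (l - L) / Num.sqrt k); last by ring.
rewrite ler_pdivlMr //; nra.
Qed.

Lemma Ec_gt0 (R : realType) (k : R) : k < 1 -> 0 < Ec k.
Proof. by move=> k1; apply: lt_le_trans (Ec_ge1 k1). Qed.

(* [K^2 < K' E] in disguise: integrate [(D - sqrt (1 - k))^2 / D^(3/2) > 0]. *)
Lemma Ec_gt_Kc (R : realType) (k : R) : 0 < k < 1 -> Num.sqrt (1 - k) * Kc k < Ec k.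
Proof.
move=> /andP[k0 k1]; set th := Num.sqrt (1 - k).
have th2 : th ^+ 2 = 1 - k by rewrite sqr_sqrtr // subr_ge0 ltW.
have th1 : th < 1.
  rewrite -[ltRHS]sqrtr1 ltr_sqrt //; lra.
have cE := cont_sqrtD k1; have cK := cont_isqrtD k1; have c3 := cont_Dm3 k1.
have cT : continuous (fun t => 2 * th * (Num.sqrt (Dl k t))^-1).
  by move=> t; apply: cvgM; [exact: cvg_cst | exact: cK].
have cT3 : continuous (fun t => (1 - k) * (Num.sqrt (Dl k t) ^+ 3)^-1).
  by move=> t; apply: cvgM; [exact: cvg_cst | exact: c3].
have cB : continuous (fun t => Num.sqrt (Dl k t) - 2 * th * (Num.sqrt (Dl k t))^-1).
  by move=> t; apply: cvgB; [exact: cE | exact: cT].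
pose f t := Num.sqrt (Dl k t) - 2 * th * (Num.sqrt (Dl k t))^-1
  + (1 - k) * (Num.sqrt (Dl k t) ^+ 3)^-1.
have cf : continuous f by move=> t; apply: cvgD; [exact: cB | exact: cT3].
have fE t : f t = (Dl k t - th) ^+ 2 / Num.sqrt (Dl k t) ^+ 3.
  rewrite /f -th2; have r0 := lt0r_neq0 (sqrtD_gt0 t k1).
  have hs := sqr_sqrtD t k1; set r := Num.sqrt _ in hs r0 *.
  by rewrite -hs; field.
have : 0 < \int[@lebesgue_measure R]_(t in `[0, pi / 2]) f t.
  apply: (@int_gt0 _ _ _ _ 0) => //.
  - by move=> t; rewrite fE divr_ge0 ?sqr_ge0 // exprn_ge0 // sqrtr_ge0.
  - by rewrite lexx divr_gt0 // pi_gt0.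
  - rewrite fE divr_gt0 ?exprn_gt0 ?sqrtD_gt0 //.
    by rewrite /Dl sin0 expr0n /= mulr0 subr0 subr_gt0.
rewrite RintD // RintB // RintZ // RintZ // -EcE -KcE int_Dm3 //.
by move=> h; lra.
Qed.

Lemma cont_Nc (R : realType) (k : R) : -1 < k < 1 -> {for k, continuous (@Nc R)}.
Proof. by move=> h; exact: isd_cont (isdB (isd_Kc h) (isd_Ec h)). Qed.

Lemma cont_jc (R : realType) (k : R) : -1 < k < 1 -> {for k, continuous (@jc R)}.
Proof.
move=> h; exact: isd_cont (isdM (isdB (isdM (isdB (isd_cst 2 k) (isd_id k)) (isd_Ec h))
  (isdM (isdZ 2 (isdB (isd_cst 1 k) (isd_id k))) (isd_Kc h))) (isd_cst 3^-1 k)).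
Qed.

Lemma Nc_incr (R : realType) (k l : R) : 0 <= k -> k < l -> l < 1 -> Nc k < Nc l.
Proof.
move=> k0 kl l1.
have hc x : k <= x <= l -> {for x, continuous (@Nc R)}.
  by move=> /andP[a b]; apply: cont_Nc; apply/andP; split; lra.
have hd x : k < x < l -> is_derive x 1 (@Nc R) (Ec x / (2 * (1 - x))).
  by move=> /andP[a b]; apply: isd_Nc; apply/andP; split; lra.
apply: (isd_smono kl hc hd) => x /andP[a b]; have x1 : x < 1 by lra.
rewrite divr_gt0 ?Ec_gt0 //; lra.
Qed.

Lemma Nc0 (R : realType) : Nc 0 = 0 :> R.
Proof. by rewrite /Nc Kc0 Ec0 subrr. Qed.

Lemma Nc_ge0 (R : realType) (k : R) : 0 <= k < 1 -> 0 <= Nc k.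
Proof.
move=> /andP[]; rewrite le_eqVlt => /orP[/eqP <-|k0] k1; first by rewrite Nc0.
by rewrite -Nc0; apply/ltW/Nc_incr.
Qed.

(** The derivative is (E^2 - (1 - k) K^2) / (2 k (1 - k)), positive by [Ec_gt_Kc]. *)
Lemma KE_incr (R : realType) (k l : R) : 0 <= k -> k < l -> l < 1 ->
  Kc k * Ec k < Kc l * Ec l.
Proof.
move=> k0 kl l1.
have hc x : k <= x <= l -> {for x, continuous (fun k => Kc k * Ec k)}.
  move=> /andP[a b]; have h : -1 < x < 1 by apply/andP; split; lra.
  exact: isd_cont (isdM (isd_Kc h) (isd_Ec h)).
have hd x : k < x < l -> is_derive x 1 (fun k => Kc k * Ec k)
   ((Ec x / (1 - x) - Kc x) / (2 * x) * Ec x + Kc x * (- (Kc x - Ec x) / (2 * x))).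
  move=> /andP[a b]; have h : 0 < x < 1 by apply/andP; split; lra.
  exact: (isdM (isd_Kc' h) (isd_Ec' h)).
apply: (isd_smono kl hc hd).
- move=> x /andP[a b]; have x0 : 0 < x by lra.
  have x1 : 0 < 1 - x by lra.
  have h : 0 < x < 1 by apply/andP; split; lra.
  have gt := Ec_gt_Kc h; have e0 : 0 < Ec x by apply: Ec_gt0; lra.
  have k0' : 0 <= Kc x.
    by have := @Nc_ge0 R x; rewrite /Nc => nn; have := nn ltac:(lra); lra.
  have sq : (1 - x) * Kc x ^+ 2 < Ec x ^+ 2.
    rewrite -(@sqr_sqrtr _ (1 - x)) ?(ltW x1) // -exprMn.
    by rewrite ltr_sqr ?nnegrE ?mulr_ge0 ?sqrtr_ge0 // ltW.
  rewrite [ltRHS](_ : _ = (Ec x ^+ 2 - (1 - x) * Kc x ^+ 2) / (2 * x * (1 - x))).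
    rewrite divr_gt0 ?subr_gt0 // !mulr_gt0 //.
  by field; rewrite !lt0r_neq0.
Qed.

Lemma KE_unbounded (R : realType) (A : R) : exists2 k, 0 < k < 1 & A < Nc k.
Proof.
(* At k = 1 - exp (-2 B) the logarithmic bound reads K >= B; since E <= pi / 2, this leaves K - E >=
   |A| + 1. *)
pose B := `|A| + pi / 2 + 1.
have A0 : A <= `|A| by exact: ler_norm.
have pi0 := pihalf_ge0 R.
have B0 : 0 < B by rewrite /B; have := normr_ge0 A; lra.
have e1 : expR (- (2 * B)) < 1 by rewrite expR_lt1 oppr_lt0 mulr_gt0.
have e0 : 0 < expR (- (2 * B)) by exact: expR_gt0.
have k01 : 0 < 1 - expR (- (2 * B)) < 1 by apply/andP; split; lra.
exists (1 - expR (- (2 * B))) => //.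
have := Kc_ge_ln k01.
have -> : 1 - (1 - expR (- (2 * B))) = expR (- (2 * B)) by ring.
rewrite expRK => hK; rewrite /Nc.
have : Ec (1 - expR (- (2 * B))) <= Ec 0.
  rewrite !EcE; apply: Rint_le; try by apply: cont_sqrtD; lra.
  move=> t _; apply: ler_wsqrtr; rewrite /Dl; have /andP[s0 _] := sin2_01 t; nra.
by rewrite Ec0; move: hK; rewrite /B; lra.
Qed.

Lemma cont_itv (R : realType) (f : R -> R) (a b : R) :
  (forall x, a <= x <= b -> {for x, continuous f}) -> {within `[a, b], continuous f}.
Proof.
by move=> cf; apply: continuous_in_subspaceT => x; rewrite inE /= in_itv /=; exact: cf.
Qed.

Lemma IVT_le (R : realType) (f : R -> R) (a b v : R) : a <= b ->
  (forall x, a <= x <= b -> {for x, continuous f}) -> f a <= v <= f b ->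
  exists2 c, a <= c <= b & f c = v.
Proof.
move=> ab cf /andP[fa fb]; have [|c cab <-] := @IVT R f a b v ab (cont_itv cf).
  by rewrite ge_min le_max fa fb orbT.
by exists c => //; move: cab; rewrite in_itv.
Qed.

Lemma Nc_surj (R : realType) (v : R) : 0 <= v -> exists2 k, 0 <= k < 1 & Nc k = v.
Proof.
move=> v0; have [l /andP[l0 l1] vl] := KE_unbounded v.
have [|||c /andP[c0 cl] e] := @IVT_le _ (@Nc R) 0 l v.
- exact: ltW.
- by move=> x /andP[a b]; apply: cont_Nc; apply/andP; split; lra.
- by rewrite Nc0 v0 ltW.
- by exists c => //; apply/andP; split; lra.
Qed.

Lemma KE_surj (R : realType) (v : R) : (pi / 2) ^+ 2 < v ->
  exists2 k, 0 < k < 1 & Kc k * Ec k = v.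
Proof.
move=> v0; have [l /andP[l0 l1] vl] := KE_unbounded v.
have e1 := Ec_ge1 l1.
have hv : v <= Kc l * Ec l.
  have : 0 <= v by apply: le_trans (ltW v0); exact: sqr_ge0.
  by move: vl; rewrite /Nc; nra.
have [|||c /andP[c0 cl] e] := @IVT_le _ (fun k => Kc k * Ec k) 0 l v.
- exact: ltW.
- move=> x /andP[a b]; have h : -1 < x < 1 by apply/andP; split; lra.
  exact: isd_cont (isdM (isd_Kc h) (isd_Ec h)).
- by rewrite Kc0 Ec0 -expr2 (ltW v0).
- exists c => //; apply/andP; split; last by lra.
  move: c0; rewrite le_eqVlt => /orP[/eqP c0|//].
  by move: e v0; rewrite -c0 Kc0 Ec0 -expr2 => ->; rewrite ltxx.
Qed.

(** * Minimization of the reduced energy *)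

(** The first term comes from the two crossings of [p, q] by [Phif]. The others come from completing
    the square: p^2 + q^2 = (2 - k) q^2 multiplies the mass and p^2 q^2 = (1 - k) q^4 multiplies the
    period. *)
Definition gfun (R : realType) (M T k Q : R) : R :=
  2 * Q ^+ 3 * jc k - (2 - k) * Q ^+ 2 * M + (1 - k) * Q ^+ 4 * T / 2.

(** The bracket increases with [Nc], so for fixed Q > 0 it changes sign at most once, from negative
    to positive: [gfun] decreases and then increases in k. *)
Lemma gfun_k (R : realType) (M T k Q : R) : 0 < k < 1 ->
  is_derive k 1 (fun k => gfun M T k Q) (Q ^+ 2 * (Nc k * Q + M - T * Q ^+ 2 / 2)).
Proof.
move=> k01.
have h1 := isdZ (2 * Q ^+ 3) (isd_jc k01).
have h2 := isdM (isdM (isdB (isd_cst 2 k) (isd_id k)) (isd_cst (Q ^+ 2) k)) (isd_cst M k).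
have h3 := isdM (isdM (isdM (isdB (isd_cst 1 k) (isd_id k)) (isd_cst (Q ^+ 4) k))
   (isd_cst T k)) (isd_cst 2^-1 k).
by apply: isd_eq (isdD (isdB h1 h2) h3) _; field.
Qed.

Lemma gfun_kcont (R : realType) (M T k Q : R) : -1 < k < 1 ->
  {for k, continuous (fun k => gfun M T k Q)}.
Proof.
move=> h; have cj := cont_jc h.
have h2 := isd_cont (isdM (isdM (isdB (isd_cst 2 k) (isd_id k)) (isd_cst (Q ^+ 2) k))
  (isd_cst M k)).
have h3 := isd_cont (isdM (isdM (isdM (isdB (isd_cst 1 k) (isd_id k)) (isd_cst (Q ^+ 4) k))
   (isd_cst T k)) (isd_cst 2^-1 k)).
apply: cvgD; last exact: h3.
by apply: cvgB; [apply: cvgM; [exact: cvg_cst | exact: cj] | exact: h2].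
Qed.

Lemma gfun_lt_right (R : realType) (M T Q k0 k : R) : 0 < Q -> 0 <= k0 -> k0 < k -> k < 1 ->
  T * Q ^+ 2 / 2 - M <= Nc k0 * Q -> gfun M T k0 Q < gfun M T k Q.
Proof.
move=> Q0 k00 kk k1 hN.
have hc x : k0 <= x <= k -> {for x, continuous (fun k => gfun M T k Q)}.
  by move=> /andP[a b]; apply: gfun_kcont; apply/andP; split; lra.
have hd x : k0 < x < k -> is_derive x 1 (fun k => gfun M T k Q)
    (Q ^+ 2 * (Nc x * Q + M - T * Q ^+ 2 / 2)).
  by move=> /andP[a b]; apply: gfun_k; apply/andP; split; lra.
apply: (isd_smono kk hc hd) => x /andP[a b].
rewrite mulr_gt0 ?exprn_gt0 //.
have : Nc k0 * Q < Nc x * Q by rewrite ltr_pM2r // Nc_incr //; lra.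
lra.
Qed.

Lemma gfun_lt_left (R : realType) (M T Q k0 k : R) : 0 < Q -> 0 <= k -> k < k0 -> k0 < 1 ->
  Nc k0 * Q <= T * Q ^+ 2 / 2 - M -> gfun M T k0 Q < gfun M T k Q.
Proof.
move=> Q0 k00 kk k1 hN.
have hc x : k <= x <= k0 -> {for x, continuous (fun k => gfun M T k Q)}.
  by move=> /andP[a b]; apply: gfun_kcont; apply/andP; split; lra.
have hd x : k < x < k0 -> is_derive x 1 (fun k => gfun M T k Q)
    (Q ^+ 2 * (Nc x * Q + M - T * Q ^+ 2 / 2)).
  by move=> /andP[a b]; apply: gfun_k; apply/andP; split; lra.
apply: (isd_santi kk hc hd) => x /andP[a b].
rewrite pmulr_rlt0 ?exprn_gt0 //.
have : Nc x * Q < Nc k0 * Q by rewrite ltr_pM2r // Nc_incr //; lra.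
lra.
Qed.

(* For fixed [k], [gfun] is critical in [k] exactly at [Q = qroot k]. *)
Definition qroot (R : realType) (M T k : R) : R :=
  (Nc k + Num.sqrt (Nc k ^+ 2 + 2 * T * M)) / T.

Lemma qroot_gt0 (R : realType) (M T k : R) : 0 < M -> 0 < T -> 0 <= k < 1 ->
  0 < qroot M T k.
Proof.
move=> M0 T0 k01; have n0 := Nc_ge0 k01.
rewrite /qroot divr_gt0 //; apply: ltr_wpDl => //.
by rewrite sqrtr_gt0 ltr_wpDl ?sqr_ge0 // !mulr_gt0.
Qed.

Lemma qrootP (R : realType) (M T k : R) : 0 < M -> 0 < T ->
  T * qroot M T k ^+ 2 / 2 = Nc k * qroot M T k + M.
Proof.
move=> M0 T0; rewrite /qroot.
have hs : Num.sqrt (Nc k ^+ 2 + 2 * T * M) ^+ 2 = Nc k ^+ 2 + 2 * T * M.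
  by rewrite sqr_sqrtr // addr_ge0 ?sqr_ge0 // !mulr_ge0 // ltW.
set r := Num.sqrt _ in hs *; have T1 := lt0r_neq0 T0.
have -> : M = (r ^+ 2 - Nc k ^+ 2) / (2 * T) by rewrite hs; field.
by field.
Qed.

Lemma qroot_uniq (R : realType) (M T k Q : R) : 0 < M -> 0 < T -> 0 <= k < 1 -> 0 < Q ->
  T * Q ^+ 2 / 2 = Nc k * Q + M -> Q = qroot M T k.
Proof.
move=> M0 T0 k01 Q0 hQ; have q0 := qroot_gt0 M0 T0 k01.
have hq := qrootP k M0 T0; set q := qroot M T k in q0 hq *.
have e : (Q - q) * (T * Q * q / 2 + M) = 0.
  transitivity (q * (T * Q ^+ 2 / 2) - Q * (T * q ^+ 2 / 2) + (Q - q) * M); first by field.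
  by rewrite hQ hq; ring.
have p : 0 < T * Q * q / 2 + M 
  by apply: addr_gt0 => //; apply: divr_gt0 => //; apply: mulr_gt0 => //; exact: mulr_gt0.
move/eqP: e; rewrite mulf_eq0 (gt_eqF p) orbF subr_eq0; exact/eqP.
Qed.

Lemma isd_qroot (R : realType) (M T k : R) : 0 < M -> 0 < T -> 0 < k < 1 ->
  exists2 d, 0 < d & is_derive k 1 (@qroot R M T) d.
Proof.
move=> M0 T0 k01; have /andP[k0 k1] := k01.
have p : 0 < Nc k ^+ 2 + 2 * T * M by rewrite ltr_wpDl ?sqr_ge0 // !mulr_gt0.
have hN := isd_Nc k01.
have h := isdM (isdD hN (@isd_sqrt _ (fun k => Nc k ^+ 2 + 2 * T * M) _ _ p (isdD (isdX 1 hN) (isd_cst (2 * T * M) k))))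
  (isd_cst T^-1 k).
eexists; last exact: h.
rewrite mulr0 addr0 mulr_gt0 ?invr_gt0 //.
have n0 : 0 <= Nc k by apply: Nc_ge0; rewrite k1 ltW.
have d0 : 0 < Ec k / (2 * (1 - k)) by rewrite divr_gt0 ?Ec_gt0 //; lra.
apply: ltr_wpDr => //.
rewrite addr0; apply: divr_ge0; last by apply: mulr_ge0 => //; exact: sqrtr_ge0.
by apply: mulr_ge0; [apply: mulr_ge0 => //; rewrite expr1 | exact: ltW].
Qed.

Definition hfun (R : realType) (M T k : R) : R := gfun M T k (qroot M T k).

(** On the critical curve the partial derivative of [gfun] in k vanishes, so only 2 q k (E q - M)
    times the positive derivative of q remains. Evaluating at M / E the quadratic that defines q
    shows that E q - M has the sign of 2 K E - M T. *)
Lemma isd_hfun (R : realType) (M T k : R) : 0 < M -> 0 < T -> 0 < k < 1 ->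
  exists2 c, 0 < c & is_derive k 1 (@hfun R M T) (c * (2 * (Kc k * Ec k) - M * T)).
Proof.
move=> M0 T0 k01; have /andP[k0 k1] := k01.
have [d d0 hd] := isd_qroot M0 T0 k01.
have k01' : 0 <= k < 1 by rewrite k1 ltW.
have q0 := qroot_gt0 M0 T0 k01'; have hq := qrootP k M0 T0.
have E0 := Ec_gt0 k1.
have h1 := isdM (isdZ 2 (isdX 2 hd)) (isd_jc k01).
have h2 := isdM (isdM (isdB (isd_cst 2 k) (isd_id k)) (isdX 1 hd)) (isd_cst M k).
have h3 := isdM (isdM (isdM (isdB (isd_cst 1 k) (isd_id k)) (isdX 3 hd))
   (isd_cst T k)) (isd_cst 2^-1 k).
set q := qroot M T k in q0 hq hd h1 h2 h3 *.
have p : 0 < T * (M / Ec k + q) / 2 - Nc k.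
  have -> : T * (M / Ec k + q) / 2 - Nc k = T * M / (2 * Ec k) + M / q.
    have -> : Nc k = (T * q ^+ 2 / 2 - M) / q.
      by rewrite hq addrK mulfK // lt0r_neq0.
    by field; rewrite !lt0r_neq0.
  apply: addr_gt0; last exact: divr_gt0.
  by apply: divr_gt0; exact: mulr_gt0.
pose c := 2 * q * k * d * (M / (2 * Ec k)) / (T * (M / Ec k + q) / 2 - Nc k).
exists c.
  rewrite /c; apply: divr_gt0 => //; apply: mulr_gt0.
    by do 3 apply: mulr_gt0 => //.
  by apply: divr_gt0 => //; exact: mulr_gt0.
(* Difference of the quadratic T Q^2 / 2 - Nc k Q - M between its root q and the point M / E,
   divided by the slope of the chord. *)
have e : Ec k * q - M = M / (2 * Ec k) / (T * (M / Ec k + q) / 2 - Nc k) *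
   (2 * (Kc k * Ec k) - M * T).
  apply: (mulIf (lt0r_neq0 p)).
  transitivity (M / (2 * Ec k) * (2 * (Kc k * Ec k) - M * T)); last first.
    move: (_ - Nc k) (lt0r_neq0 p) => P P0.
    by field; rewrite P0 lt0r_neq0.
  have -> : Kc k = Nc k + Ec k by rewrite /Nc subrK.
  transitivity (Ec k * (T * q ^+ 2 / 2) - Nc k * (Ec k * q - M)
     - T * M ^+ 2 / (2 * Ec k)); first by field; rewrite !lt0r_neq0.
  by rewrite hq; field; rewrite !lt0r_neq0.
apply: isd_eq (isdD (isdB h1 h2) h3) _.
transitivity (2 * q * k * d * (Ec k * q - M)); last by rewrite e /c; ring.
have -> : jc k = ((2 - k) * Ec k - 2 * (1 - k) * (Nc k + Ec k)) / 3.
  by rewrite /Nc subrK.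
transitivity (2 * q ^+ 2 * d * ((2 - k) * Ec k - 2 * (1 - k) * (Nc k + Ec k))
   - (2 - k) * M * 2 * q * d + 4 * (1 - k) * q * d * (T * q ^+ 2 / 2)
   + q ^+ 2 * (Nc k * q + M - T * q ^+ 2 / 2)); first by rewrite /=; field.
by rewrite hq; ring.
Qed.

Lemma cont_hfun (R : realType) (M T k : R) : 0 < M -> 0 < T -> -1 < k < 1 ->
  {for k, continuous (@hfun R M T)}.
Proof.
move=> M0 T0 h; have cN := cont_Nc h; have cj := cont_jc h.
have cc (c : R) : {for k, continuous (fun _ : R => c)} by exact: cvg_cst.
have ci : {for k, continuous (fun x : R => x)} by exact: cvg_id.
have cX n (f : R -> R) : {for k, continuous f} -> {for k, continuous (fun x => f x ^+ n)}.
  move=> cf; exact: (@continuous_comp _ _ _ f (fun y => y ^+ n) k cf (@exprn_continuous _ n _)).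
have cq : {for k, continuous (@qroot R M T)}.
  apply: cvgM; last exact: cc.
  apply: cvgD; first exact: cN.
  have c1 : {for k, continuous (fun x => Nc x ^+ 2 + 2 * T * M)}.
    by apply: cvgD; [exact: cX | exact: cc].
  exact: (continuous_comp c1 (@sqrt_continuous _ _)).
apply: cvgD.
- apply: cvgB.
  + by apply: cvgM; [apply: cvgM; [exact: cc | exact: cX] | exact: cj].
  + apply: cvgM; [apply: cvgM; [|exact: cX] | exact: cc].
    by apply: cvgB; [exact: cc | exact: ci].
- apply: cvgM; [apply: cvgM; [apply: cvgM; [|exact: cX] | exact: cc] | exact: cc].
  by apply: cvgB; [exact: cc | exact: ci].
Qed.

Lemma hfun_incr (R : realType) (M T k l : R) : 0 < M -> 0 < T -> 0 <= k -> k < l ->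
  l < 1 -> M * T <= 2 * (Kc k * Ec k) -> hfun M T k < hfun M T l.
Proof.
move=> M0 T0 k0 kl l1 hk.
have /choice[c hc] (x : R) : exists c : R, k < x < l -> 0 < c /\
    is_derive x 1 (@hfun R M T) (c * (2 * (Kc x * Ec x) - M * T)).
  have [/andP[a b]|] := boolP (k < x < l); last by exists 0.
  have h : 0 < x < 1 by apply/andP; split; lra.
  by have [c c0 hc] := isd_hfun M0 T0 h; exists c.
have hcont x : k <= x <= l -> {for x, continuous (@hfun R M T)}.
  by move=> /andP[a b]; apply: cont_hfun => //; apply/andP; split; lra.
have hd x (hx : k < x < l) := (hc x hx).2.
apply: (isd_smono kl hcont hd) => x hx; have [c0 _] := hc x hx.
have /andP[a b] := hx; rewrite mulr_gt0 // subr_gt0.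
have : Kc k * Ec k < Kc x * Ec x by apply: KE_incr => //; lra.
lra.
Qed.

Lemma hfun_decr (R : realType) (M T k l : R) : 0 < M -> 0 < T -> 0 <= k -> k < l ->
  l < 1 -> 2 * (Kc l * Ec l) <= M * T -> hfun M T l < hfun M T k.
Proof.
move=> M0 T0 k0 kl l1 hk.
have /choice[c hc] (x : R) : exists c : R, k < x < l -> 0 < c /\
    is_derive x 1 (@hfun R M T) (c * (2 * (Kc x * Ec x) - M * T)).
  have [/andP[a b]|] := boolP (k < x < l); last by exists 0.
  have h : 0 < x < 1 by apply/andP; split; lra.
  by have [c c0 hc] := isd_hfun M0 T0 h; exists c.
have hcont x : k <= x <= l -> {for x, continuous (@hfun R M T)}.
  by move=> /andP[a b]; apply: cont_hfun => //; apply/andP; split; lra.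
have hd x (hx : k < x < l) := (hc x hx).2.
apply: (isd_santi kl hcont hd) => x hx; have [c0 _] := hc x hx.
have /andP[a b] := hx; rewrite pmulr_rlt0 // subr_lt0.
have : Kc x * Ec x < Kc l * Ec l by apply: KE_incr => //; lra.
lra.
Qed.

Lemma jc0 (R : realType) : jc 0 = 0 :> R.
Proof. by rewrite /jc Kc0 Ec0; ring. Qed.

Lemma gfun0 (R : realType) (M T Q : R) : 0 < T ->
  gfun M T 0 Q = T / 2 * (Q ^+ 2 - 2 * M / T) ^+ 2 - 2 * M ^+ 2 / T.
Proof. by move=> T0; rewrite /gfun jc0; field; exact: lt0r_neq0. Qed.

Lemma hfun0 (R : realType) (M T : R) : 0 < M -> 0 < T -> hfun M T 0 = - (2 * M ^+ 2 / T).
Proof.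
move=> M0 T0; rewrite /hfun gfun0 //.
have := qrootP 0 M0 T0; rewrite Nc0 mul0r add0r => h.
have -> : qroot M T 0 ^+ 2 = 2 * M / T.
  by rewrite -[in RHS]h; field; exact: lt0r_neq0.
by rewrite subrr expr0n /= mulr0 sub0r.
Qed.

(* The case split is on whether [gfun] decreases in [k] at [k = 0]. *)
Lemma gfun_ge_hfun (R : realType) (M T k Q : R) : 0 < M -> 0 < T -> 0 <= k < 1 -> 0 < Q ->
  exists2 k0, 0 <= k0 < 1 & hfun M T k0 <= gfun M T k Q /\
    (gfun M T k Q <= hfun M T k0 -> k = k0 /\ Q = qroot M T k0).
Proof.
move=> M0 T0 /andP[k0 k1] Q0.
have [hQ|hQ] := leP (T * Q ^+ 2 / 2) M.
- exists 0; first by rewrite lexx ltr01.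
  have h0 : hfun M T 0 <= gfun M T 0 Q.
    rewrite hfun0 // gfun0 // lerBrDr addrC addrN.
    by rewrite mulr_ge0 ?sqr_ge0 // divr_ge0 // ltW.
  move: k0; rewrite le_eqVlt => /orP[/eqP <-|k0].
    split => // h; split => //; apply: qroot_uniq => //; first by rewrite lexx ltr01.
    rewrite Nc0 mul0r add0r.
    move: h; rewrite hfun0 // gfun0 // lerBlDr addNr.
    rewrite pmulr_rle0 ?divr_gt0 // => h.
    have /eqP : (Q ^+ 2 - 2 * M / T) ^+ 2 == 0 by rewrite eq_le h sqr_ge0.
    move=> /eqP; rewrite sqrf_eq0 subr_eq0 => /eqP ->; field; exact: lt0r_neq0.
  have h1 : gfun M T 0 Q < gfun M T k Q.
    by apply: gfun_lt_right => //; rewrite Nc0 mul0r subr_le0.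
  split; first by rewrite (le_trans h0) // ltW.
  by move=> h; have := le_lt_trans h0 h1; rewrite ltNge h.
- have [l l01 hl] := @Nc_surj R ((T * Q ^+ 2 / 2 - M) / Q) ltac:(by rewrite divr_ge0 ?subr_ge0 // ltW).
  have e : Nc l * Q = T * Q ^+ 2 / 2 - M by rewrite hl divfK // lt0r_neq0.
  have q : Q = qroot M T l by apply: qroot_uniq => //; rewrite e subrK.
  exists l => //; rewrite /hfun -q; have /andP[l0 l1] := l01.
  have [kl|lk|->] := ltgtP k l; last by split.
    have h : gfun M T l Q < gfun M T k Q by apply: gfun_lt_left => //; rewrite e.
    by split; [exact: ltW | rewrite leNgt h].
  have h : gfun M T l Q < gfun M T k Q by apply: gfun_lt_right => //; rewrite e.
  by split; [exact: ltW | rewrite leNgt h].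
Qed.

(** Since 2 K E equals pi^2 / 2 at k = 0 and increases, [hfun] increases on all of [0, 1). *)
Lemma gfun_min_small (R : realType) (M T k Q : R) : 0 < M -> 0 < T -> 0 <= k < 1 -> 0 < Q ->
  M * T <= pi ^+ 2 / 2 ->
  - (2 * M ^+ 2 / T) <= gfun M T k Q /\
  (gfun M T k Q <= - (2 * M ^+ 2 / T) -> k = 0).
Proof.
move=> M0 T0 k01 Q0 MT; rewrite -hfun0 //.
have [l /andP[l0 l1] [h1 h2]] := gfun_ge_hfun M0 T0 k01 Q0.
move: l0; rewrite le_eqVlt => /orP[/eqP l0|l0].
  by move: h1 h2; rewrite -l0 => h1 h2; split => // /h2[].
have h : hfun M T 0 < hfun M T l.
  by apply: hfun_incr => //; rewrite Kc0 Ec0; move: MT; lra.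
split; first by rewrite ltW // (lt_le_trans h).
by move=> h'; have := le_lt_trans (le_trans h1 h') h; rewrite ltxx.
Qed.

Lemma gfun_min_large (R : realType) (M T k k' Q : R) : 0 < M -> 0 < T ->
  0 <= k < 1 -> 0 < Q -> 0 < k' < 1 -> 2 * (Kc k' * Ec k') = M * T ->
  gfun M T k' (M / Ec k') <= gfun M T k Q /\
  (gfun M T k Q <= gfun M T k' (M / Ec k') -> k = k' /\ Q = M / Ec k').
Proof.
move=> M0 T0 k01 Q0 /andP[k'0 k'1] MT.
have E0 := Ec_gt0 k'1.
(* When 2 K E = M T, the point M / E solves the critical equation, hence lies on the curve of
   [qroot]. *)
have -> : M / Ec k' = qroot M T k'.
  apply: qroot_uniq => //; [by rewrite k'1 ltW | by rewrite divr_gt0 |].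
  have -> : T * (M / Ec k') ^+ 2 / 2 = (M * T) * (M / Ec k' ^+ 2) / 2 by field; exact: lt0r_neq0.
  by rewrite -MT /Nc; field; exact: lt0r_neq0.
rewrite -/(hfun M T k').
have [l /andP[l0 l1] [h1 h2]] := gfun_ge_hfun M0 T0 k01 Q0.
have h3 : l != k' -> hfun M T k' < hfun M T l.
  move=> lk; have [a|a|a] := ltgtP l k'; last by rewrite a eqxx in lk.
    by apply: hfun_decr => //; rewrite MT.
  by apply: hfun_incr => //; rewrite ?MT // ltW.
have [lk|/h3 lk] := eqVneq l k'; first by rewrite -lk.
split; first by rewrite ltW // (lt_le_trans lk).
by move=> h'; have := le_lt_trans (le_trans h1 h') lk; rewrite ltxx.
Qed.

(** The constant competitor sits at k = 0 on the critical curve, and [gfun_min_large] would let it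
    tie only for k = 0. The dn energy is therefore below that of the constant, in particular
    negative. *)
Lemma gfun_large_lt (R : realType) (M T k : R) : 0 < M -> 0 < T -> 0 < k < 1 ->
  2 * (Kc k * Ec k) = M * T -> gfun M T k (M / Ec k) < - (2 * M ^+ 2 / T).
Proof.
move=> M0 T0 k01 MT; have /andP[k0 k1] := k01.
pose Q := qroot M T 0.
have Q0 : 0 < Q by apply: qroot_gt0 => //; rewrite lexx ltr01.
have [h1 h2] := @gfun_min_large R M T 0 k Q M0 T0 ltac:(by rewrite lexx ltr01) Q0 k01 MT.
rewrite -hfun0 // /hfun -/Q lt_neqAle h1 andbT.
by apply/eqP => e; have [] := h2 ltac:(by rewrite e); move=> e0; rewrite -e0 ltxx in k0.
Qed.

(** At fixed Q, [gfun] increases in k past the point l, which leaves a margin d near k = 1. This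
    margin excludes curves whose modulus vanishes, for which k would be 1. *)
Lemma gfun_gap (R : realType) (M T Q v : R) : 0 < M -> 0 < T -> 0 < Q ->
  (forall k, 0 <= k < 1 -> v <= gfun M T k Q) ->
  exists k1 d, [/\ 0 <= k1 < 1, 0 < d & forall k, k1 <= k < 1 -> v + d <= gfun M T k Q].
Proof.
move=> M0 T0 Q0 hv.
have [l l01 hl] := @Nc_surj R (`|T * Q ^+ 2 / 2 - M| / Q) ltac:(by rewrite divr_ge0 // ltW).
have e : T * Q ^+ 2 / 2 - M <= Nc l * Q.
  by rewrite hl divfK ?lt0r_neq0 // ler_norm.
have /andP[l0 l1] := l01.
have m01 : l < (l + 1) / 2 < 1 by apply/andP; split; lra.
have /andP[lm m1] := m01.
have h1 := gfun_lt_right Q0 l0 lm m1 e.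
exists ((l + 1) / 2), (gfun M T ((l + 1) / 2) Q - gfun M T l Q); split.
- by apply/andP; split; lra.
- by rewrite subr_gt0.
- move=> k /andP[mk k1].
  have h2 : gfun M T ((l + 1) / 2) Q <= gfun M T k Q.
    move: mk; rewrite le_eqVlt => /orP[/eqP <- //|mk].
    apply/ltW/gfun_lt_right => //; first lra.
    by apply: (le_trans e); rewrite ler_pM2r // ltW // Nc_incr.
  by have := hv l l01; lra.
Qed.

(** * The function dn as a travelling wave *)

Lemma ellipticKE (R : realType) (k : R) : ellipticK k = Kc (k ^+ 2).
Proof. by []. Qed.

Lemma ellipticEE (R : realType) (k : R) : ellipticE k = Ec (k ^+ 2).
Proof. by rewrite EcE. Qed.

Lemma sqr01 (R : realType) (k : R) : 0 < k < 1 -> 0 < k ^+ 2 < 1.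
Proof.
by move=> /andP[k0 k1]; rewrite exprn_gt0 //= expr_lt1 // ltW.
Qed.

Lemma DlN (R : realType) (k t : R) : Dl k (- t) = Dl k t.
Proof. by rewrite /Dl sinN sqrrN. Qed.

Lemma Dlpi (R : realType) (k t : R) : Dl k (t + pi) = Dl k t.
Proof. by rewrite /Dl sinDpi sqrrN. Qed.

Lemma FincN (R : realType) (k t : R) : k < 1 -> Finc k (- t) = - Finc k t.
Proof.
move=> k1; have d (z : R) : is_derive z 1 (fun t => Finc k t + Finc k (- t)) 0.
  have hN : is_derive z 1 (fun t : R => - t) (- 1) by exact: isdN (isd_id z).
  apply: isd_eq (isdD (isd_Finc z k1) (isd_comp (isd_Finc (- z) k1) hN)) _.
  by rewrite DlN; ring.
have := isd_const t 0 d; rewrite oppr0 /Finc !prim0 => h; lra.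
Qed.

Lemma Fincpi (R : realType) (k t : R) : k < 1 -> Finc k (t + pi) = Finc k t + 2 * Kc k.
Proof.
move=> k1; have d (z : R) : is_derive z 1 (fun t => Finc k (t + pi) - Finc k t) 0.
  apply: isd_eq (isdB (isd_shift (isd_Finc (z + pi) k1)) (isd_Finc z k1)) _.
  by rewrite Dlpi; ring.
have := isd_const t (- (pi / 2)) d.
have -> : - (pi / 2) + pi = pi / 2 :> R by field.
by rewrite (FincN _ k1) -/(Kc k) => h; lra.
Qed.

Lemma Finc_incr (R : realType) (k s t : R) : k < 1 -> s < t -> Finc k s < Finc k t.
Proof.
move=> k1 st; apply: (isd_smono st (fun z _ => isd_cont (isd_Finc z k1))
  (fun z _ => isd_Finc z k1)) => x _.
by rewrite invr_gt0 sqrtD_gt0.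
Qed.

Lemma Finc_le (R : realType) (k s t : R) : k < 1 -> (Finc k s <= Finc k t) = (s <= t).
Proof.
move=> k1; have [st|ts|->] := ltgtP s t; last by rewrite lexx.
  by rewrite ltW // Finc_incr.
by apply/negbTE; rewrite -ltNge Finc_incr.
Qed.

Lemma Finc_inj (R : realType) (k s t : R) : k < 1 -> Finc k s = Finc k t -> s = t.
Proof.
by move=> k1 e; apply/eqP; rewrite eq_le -(@Finc_le _ k s t) // -(@Finc_le _ k t s) // e lexx.
Qed.

Lemma Finc_ge_id (R : realType) (k t : R) : 0 <= k < 1 -> 0 <= t -> t <= Finc k t.
Proof.
move=> /andP[k0 k1] t0.
have hd (z : R) : is_derive z 1 (fun t => Finc k t - t) ((Num.sqrt (Dl k z))^-1 - 1).
  exact: isdB (isd_Finc z k1) (isd_id z).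
have := isd_mono t0 (fun z _ => isd_cont (hd z)) (fun z _ => hd z).
rewrite subr0 /Finc prim0 -/(Finc k) => h; rewrite -subr_ge0; apply: h => x _.
rewrite subr_ge0 invf_ge1 ?sqrtD_gt0 // -[leRHS]sqrtr1 ler_wsqrtr //.
by rewrite /Dl gerBl mulr_ge0 // sqr_ge0.
Qed.

Lemma Finc_surj (R : realType) (k x : R) : 0 <= k < 1 -> exists t, Finc k t = x.
Proof.
move=> k01; have /andP[k0 k1] := k01.
have h : - `|x| <= `|x| by rewrite ge0_cp.
have hF : Finc k (- `|x|) <= x <= Finc k `|x|.
  have := Finc_ge_id k01 (normr_ge0 x); rewrite FincN // => a.
  have h1 : - `|x| <= x by rewrite lerNl -normrN ler_norm.
  by have := ler_norm x; move: h1 a; lra.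
have [t _ e] := IVT_le h (fun z _ => isd_cont (isd_Finc z k1)) hF.
by exists t.
Qed.

Definition am (R : realType) (k x : R) : R := xget 0 [set t | Finc k t = x].

Lemma Finc_am (R : realType) (k x : R) : 0 <= k < 1 -> Finc k (am k x) = x.
Proof.
move=> k01; have [t ht] := Finc_surj x k01.
exact: (@xgetPex _ 0 [set t | Finc k t = x] (ex_intro _ t ht)).
Qed.

Lemma am_Finc (R : realType) (k t : R) : 0 <= k < 1 -> am k (Finc k t) = t.
Proof.
by move=> k01; have /andP[_ k1] := k01; apply: (Finc_inj k1); rewrite Finc_am.
Qed.

Lemma isd_am (R : realType) (k x : R) : 0 <= k < 1 ->
  is_derive x 1 (am k) (Num.sqrt (Dl k (am k x))).
Proof.
move=> k01; have /andP[_ k1] := k01.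
have d := isd_Finc (am k x) k1.
have n0 : (Num.sqrt (Dl k (am k x)))^-1 != 0.
  by rewrite invr_eq0 lt0r_neq0 // sqrtD_gt0.
have c1 : {near am k x, cancel (Finc k) (am k)}.
  by near=> t; exact: am_Finc.
have c2 : {near am k x, continuous (Finc k)}.
  by near=> t; exact: isd_cont (isd_Finc t k1).
have := is_derive_inverse c1 c2 d n0.
by rewrite Finc_am // invrK.
Unshelve. all: by end_near.
Qed.

Lemma am_lt (R : realType) (k x y : R) : 0 <= k < 1 -> x < y -> am k x < am k y.
Proof.
move=> k01 xy; have /andP[_ k1] := k01.
by rewrite ltNge -(@Finc_le _ k (am k y)) // !Finc_am // -ltNge.
Qed.

Lemma am0 (R : realType) (k : R) : 0 <= k < 1 -> am k 0 = 0.
Proof. by move=> k01; rewrite -[in LHS](@prim0 _ (fun t => (Num.sqrt (Dl k t))^-1)) am_Finc. Qed.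

Lemma amK (R : realType) (k : R) : 0 <= k < 1 -> am k (Kc k) = pi / 2.
Proof. exact: am_Finc. Qed.

Lemma amN (R : realType) (k x : R) : 0 <= k < 1 -> am k (- x) = - am k x.
Proof.
move=> k01; have /andP[_ k1] := k01.
by apply: (Finc_inj k1); rewrite FincN // !Finc_am.
Qed.

Lemma am2K (R : realType) (k x : R) : 0 <= k < 1 -> am k (x + 2 * Kc k) = am k x + pi.
Proof.
move=> k01; have /andP[_ k1] := k01.
by apply: (Finc_inj k1); rewrite Fincpi // !Finc_am.
Qed.

Lemma Kc_gt0 (R : realType) (k : R) : k < 1 -> 0 < Kc k.
Proof.
move=> k1; rewrite /Kc -(@prim0 _ (fun t : R => (Num.sqrt (Dl k t))^-1)).
by apply: Finc_incr => //; rewrite divr_gt0 // pi_gt0.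
Qed.

Definition dnf (R : realType) (k x : R) : R := Num.sqrt (Dl k (am k x)).

Lemma dnE (R : realType) (x k : R) : dn x k = dnf (k ^+ 2) x.
Proof. by []. Qed.

Lemma isd_dnf (R : realType) (k x : R) : 0 <= k < 1 ->
  is_derive x 1 (dnf k) (- k * sin (am k x) * cos (am k x)).
Proof.
move=> k01; have /andP[_ k1] := k01.
apply: isd_eq (isd_comp (isd_sqrtD (am k x) k1) (isd_am x k01)) _.
by rewrite divfK // lt0r_neq0 // sqrtD_gt0.
Qed.

Lemma dnf_gt0 (R : realType) (k x : R) : 0 <= k < 1 -> 0 < dnf k x.
Proof. by move=> /andP[_ k1]; exact: sqrtD_gt0. Qed.

Lemma dnf_sqr (R : realType) (k x : R) : 0 <= k < 1 ->
  dnf k x ^+ 2 = 1 - k * sin (am k x) ^+ 2.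
Proof. by move=> /andP[_ k1]; rewrite sqr_sqrtD. Qed.

Lemma dnf_per (R : realType) (k x : R) : 0 <= k < 1 -> dnf k (x + 2 * Kc k) = dnf k x.
Proof. by move=> k01; rewrite /dnf am2K // Dlpi. Qed.

Lemma dnfN (R : realType) (k x : R) : 0 <= k < 1 -> dnf k (- x) = dnf k x.
Proof. by move=> k01; rewrite /dnf amN // DlN. Qed.

Lemma dnf0 (R : realType) (k : R) : 0 <= k < 1 -> dnf k 0 = 1.
Proof. by move=> k01; rewrite /dnf am0 // /Dl sin0 expr0n /= mulr0 subr0 sqrtr1. Qed.

Lemma dnfK (R : realType) (k : R) : 0 <= k < 1 -> dnf k (Kc k) = Num.sqrt (1 - k).
Proof. by move=> k01; rewrite /dnf amK // /Dl sin_pihalf expr1n mulr1. Qed.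

Lemma dnf_ge (R : realType) (k x : R) : 0 <= k < 1 -> Num.sqrt (1 - k) <= dnf k x.
Proof. by move=> /andP[k0 k1]; apply: ler_wsqrtr; exact: Dl_ge. Qed.

Lemma dnf_le1 (R : realType) (k x : R) : 0 <= k < 1 -> dnf k x <= 1.
Proof.
move=> /andP[k0 k1]; rewrite -[leRHS]sqrtr1; apply: ler_wsqrtr.
by rewrite /Dl gerBl mulr_ge0 // sqr_ge0.
Qed.

Lemma am_quarter (R : realType) (k x : R) : 0 <= k < 1 -> 0 < x < Kc k ->
  0 < am k x < pi / 2.
Proof.
move=> k01 /andP[x0 xK]; rewrite -{1}(am0 k01) -(amK k01).
by rewrite !am_lt.
Qed.

Lemma dnf_decr (R : realType) (k x y : R) : 0 < k < 1 -> 0 <= x -> x < y -> y <= Kc k ->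
  dnf k y < dnf k x.
Proof.
move=> /andP[k0 k1] x0 xy yK; have k01 : 0 <= k < 1 by rewrite k1 ltW.
apply: (isd_santi xy (fun z _ => isd_cont (isd_dnf z k01)) (fun z _ => isd_dnf z k01)).
move=> z /andP[xz zy].
have /andP[a0 a1] := am_quarter (x := z) k01 ltac:(apply/andP; split; lra).
have s0 : 0 < sin (am k z) by apply: sin_gt0_pi; have := pi_gt0 R; lra.
have c0 : 0 < cos (am k z) by apply: cos_gt0_pihalf; have := pi_gt0 R; lra.
by rewrite !mulNr oppr_lt0 !mulr_gt0.
Qed.

Lemma dnf_lt1 (R : realType) (k x : R) : 0 < k < 1 -> 0 < x < 2 * Kc k -> dnf k x < 1.
Proof.
move=> /andP[k0 k1] /andP[x0 xK]; have k01 : 0 <= k < 1 by rewrite k1 ltW.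
have a0 : 0 < am k x by rewrite -(am0 k01) am_lt.
have a1 : am k x < pi.
  by rewrite -[ltRHS]add0r -(am0 k01) -am2K // add0r am_lt.
have s0 : 0 < sin (am k x) by apply: sin_gt0_pi; rewrite a0.
rewrite -[ltRHS]sqrtr1 ltr_sqrt // /Dl gtrBl mulr_gt0 // exprn_gt0 //.
Qed.

Lemma isd_Einc_am (R : realType) (k x : R) : 0 <= k < 1 ->
  is_derive x 1 (fun x => Einc k (am k x)) (dnf k x ^+ 2).
Proof.
move=> k01; have /andP[_ k1] := k01.
exact: isd_eq (isd_comp (isd_Einc (am k x) k1) (isd_am x k01)) _.
Qed.

Lemma isd_jinc_am (R : realType) (k x : R) : 0 <= k < 1 ->
  is_derive x 1 (fun x => jinc k (am k x)) ((- k * sin (am k x) * cos (am k x)) ^+ 2).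
Proof.
move=> k01; have /andP[_ k1] := k01.
apply: isd_eq (isd_comp (isd_jinc (am k x) k1) (isd_am x k01)) _.
by rewrite divfK ?lt0r_neq0 ?sqrtD_gt0 //; ring.
Qed.

Lemma Eincpi (R : realType) (k : R) : k < 1 -> Einc k pi = 2 * Ec k.
Proof.
move=> k1; have d (z : R) : is_derive z 1 (fun t => Einc k (t + pi) - Einc k t) 0.
  apply: isd_eq (isdB (isd_shift (isd_Einc (z + pi) k1)) (isd_Einc z k1)) _.
  by rewrite Dlpi; ring.
have d' (z : R) : is_derive z 1 (fun t => Einc k t + Einc k (- t)) 0.
  have hN : is_derive z 1 (fun t : R => - t) (- 1) by exact: isdN (isd_id z).
  apply: isd_eq (isdD (isd_Einc z k1) (isd_comp (isd_Einc (- z) k1) hN)) _.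
  by rewrite DlN; ring.
have := isd_const 0 (- (pi / 2)) d; have := isd_const (pi / 2) 0 d'.
have -> : - (pi / 2) + pi = pi / 2 :> R by field.
have E0 : Einc k 0 = 0 by exact: prim0.
by rewrite oppr0 add0r !E0 /Ec => h1 h2; lra.
Qed.

Lemma jincpi (R : realType) (k : R) : k < 1 -> jinc k pi = 2 * jc k.
Proof.
move=> k1; rewrite /jinc Eincpi // sinpi -[in Finc k pi](add0r pi) Fincpi //.
by rewrite /Finc prim0 /jc; field.
Qed.

(* A wave train of the travelling-wave equation between its minimum [p] and its
   maximum [q], with first integral [w'^2 = (b/2) (w^2 - p^2) (q^2 - w^2)]. *)
Record wave (R : realType) (b T p q : R) (w dw : R -> R) : Prop := Wave {
  wave_isd : forall x : R, is_derive x 1 w (dw x);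
  wave_cont : continuous dw;
  wave_per : forall x, w (x + T) = w x;
  wave_even : forall x, w (- x) = w x;
  wave_0 : w 0 = q;
  wave_half : w (T / 2) = p;
  wave_decr : forall x y, 0 <= x -> x < y -> y <= T / 2 -> w y < w x;
  wave_dle0 : forall x, 0 <= x <= T / 2 -> dw x <= 0;
  wave_eq : forall x, dw x ^+ 2 = b / 2 * (w x ^+ 2 - p ^+ 2) * (q ^+ 2 - w x ^+ 2)
}.

(** Rescaling dn'^2 = (1 - dn^2) (dn^2 - (1 - kap)): amplitude q and scale bet give the first
    integral of [wave] exactly when bet^2 q^2 = 2 / b, and 2 K bet is the period. *)
Lemma dn_wave (R : realType) (b T p q kap bet : R) :
  0 < b -> 0 < q -> 0 < bet -> 0 < kap < 1 -> T = 2 * Kc kap * bet ->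
  bet = (Num.sqrt (b / 2) * q)^-1 -> p = q * Num.sqrt (1 - kap) ->
  wave b T p q (fun x => q * dnf kap (x / bet))
    (fun x => q * (- kap * sin (am kap (x / bet)) * cos (am kap (x / bet))) / bet).
Proof.
move=> b0 q0 bet0 /andP[k0 k1] TE betE pE.
have k01 : 0 <= kap < 1 by rewrite k1 ltW.
have b1 := lt0r_neq0 bet0.
have hlin (x : R) : is_derive x 1 (fun x : R => x / bet) bet^-1.
  by apply: isd_eq (isdM (isd_id x) (isd_cst bet^-1 x)) _; ring.
have hd (x : R) := isdZ q (@isd_comp _ _ (fun x : R => x / bet) _ _ _
  (isd_dnf (x / bet) k01) (hlin x)).
have ham (x : R) := @isd_comp _ _ (fun x : R => x / bet) _ _ _
  (isd_am (x / bet) k01) (hlin x).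
have K0 := Kc_gt0 k1.
have T2 : T / 2 / bet = Kc kap by rewrite TE; field.
have bb : bet ^- 2 = b / 2 * q ^+ 2.
  by rewrite -exprVn betE invrK exprMn sqr_sqrtr // ltW // divr_gt0.
split.
- by move=> x; apply: isd_eq (hd x) _; ring.
- move=> x; apply: isd_cont (isdM (isdZ q (isdM (isdZ (- kap) (isd_comp (isd_sin _) (ham x)))
    (isd_comp (isd_cos _) (ham x)))) (isd_cst bet^-1 x)).
- move=> x; have -> : (x + T) / bet = x / bet + 2 * Kc kap by rewrite TE; field.
  by rewrite dnf_per.
- by move=> x; rewrite mulNr dnfN.
- by rewrite mul0r dnf0 // mulr1.
- by rewrite T2 dnfK.
- move=> x y x0 xy yT; rewrite ltr_pM2l //; apply: dnf_decr; rewrite ?k0 //.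
  + by rewrite divr_ge0 // ltW.
  + by rewrite ltr_pM2r ?invr_gt0.
  + by rewrite -T2 ler_pM2r ?invr_gt0.
- move=> x /andP[x0 xT].
  have a0 : 0 <= am kap (x / bet).
    rewrite -(@Finc_le _ kap) // Finc_am // /Finc prim0 divr_ge0 // ltW //.
  have a1 : am kap (x / bet) <= pi / 2.
    by rewrite -(@Finc_le _ kap) // Finc_am // -/(Kc kap) -T2 ler_pM2r ?invr_gt0.
  have s0 : 0 <= sin (am kap (x / bet)) by apply: sin_ge0; rewrite a0.
  have c0 : 0 <= cos (am kap (x / bet)) by apply: cos_ge0; rewrite a0.
  rewrite !mulNr mulrN mulNr oppr_le0 !mulr_ge0 // ?invr_ge0; exact: ltW.
- move=> x; rewrite pE !exprMn dnf_sqr // sqr_sqrtr ?subr_ge0 ?(ltW k1) //.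
  by rewrite exprVn bb cos2sin2; ring.
Qed.

Lemma int_dn_sqr (R : realType) (q kap bet : R) : 0 < bet -> 0 <= kap < 1 ->
  \int[@lebesgue_measure R]_(x in `[0, 2 * Kc kap * bet]) (q * dnf kap (x / bet)) ^+ 2
  = q ^+ 2 * bet * (2 * Ec kap).
Proof.
move=> bet0 k01; have b1 := lt0r_neq0 bet0; have /andP[_ k1] := k01.
have hlin (x : R) : is_derive x 1 (fun x : R => x / bet) bet^-1.
  by apply: isd_eq (isdM (isd_id x) (isd_cst bet^-1 x)) _; ring.
have hd (x : R) : is_derive x 1 (fun x => q ^+ 2 * bet * Einc kap (am kap (x / bet)))
    ((q * dnf kap (x / bet)) ^+ 2).
  apply: isd_eq (isdZ (q ^+ 2 * bet) (@isd_comp _ (fun x => Einc kap (am kap x))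
    (fun x : R => x / bet) _ _ _ (isd_Einc_am (x / bet) k01) (hlin x))) _.
  by field.
have T0 : 0 <= 2 * Kc kap * bet by rewrite !mulr_ge0 ?(ltW bet0) // ltW // Kc_gt0.
have cw : continuous (fun x : R => (q * dnf kap (x / bet)) ^+ 2).
  move=> x; exact: isd_cont (isdX 1 (isdZ q (@isd_comp _ _ (fun x : R => x / bet) _ _ _
  (isd_dnf (x / bet) k01) (hlin x)))).
rewrite (FTC T0 cw hd) mulfK // mul0r am0 // {2}/Einc prim0.
by rewrite -(add0r (2 * Kc kap)) am2K // am0 // add0r Eincpi //; ring.
Qed.

Lemma int_ddn_sqr (R : realType) (q kap bet : R) : 0 < bet -> 0 <= kap < 1 ->
  \int[@lebesgue_measure R]_(x in `[0, 2 * Kc kap * bet])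
    (q * (- kap * sin (am kap (x / bet)) * cos (am kap (x / bet))) / bet) ^+ 2
  = q ^+ 2 / bet * (2 * jc kap).
Proof.
move=> bet0 k01; have b1 := lt0r_neq0 bet0; have /andP[_ k1] := k01.
have hlin (x : R) : is_derive x 1 (fun x : R => x / bet) bet^-1.
  by apply: isd_eq (isdM (isd_id x) (isd_cst bet^-1 x)) _; ring.
have hd (x : R) : is_derive x 1 (fun x => q ^+ 2 / bet * jinc kap (am kap (x / bet)))
    ((q * (- kap * sin (am kap (x / bet)) * cos (am kap (x / bet))) / bet) ^+ 2).
  apply: isd_eq (isdZ (q ^+ 2 / bet) (@isd_comp _ (fun x => jinc kap (am kap x))
    (fun x : R => x / bet) _ _ _ (isd_jinc_am (x / bet) k01) (hlin x))) _.
  by field.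
have T0 : 0 <= 2 * Kc kap * bet by rewrite !mulr_ge0 ?(ltW bet0) // ltW // Kc_gt0.
have ham (x : R) := @isd_comp _ _ (fun x : R => x / bet) _ _ _
  (isd_am (x / bet) k01) (hlin x).
have cw : continuous (fun x : R =>
    (q * (- kap * sin (am kap (x / bet)) * cos (am kap (x / bet))) / bet) ^+ 2).
  move=> x; apply: isd_cont (isdX 1 (isdM (isdZ q (isdM (isdZ (- kap)
    (isd_comp (isd_sin _) (ham x))) (isd_comp (isd_cos _) (ham x)))) (isd_cst bet^-1 x))).
rewrite (FTC T0 cw hd) mulfK // mul0r am0 // jinc0.
by rewrite -(add0r (2 * Kc kap)) am2K // am0 // add0r jincpi //; ring.
Qed.

(** * The calibration inequality *)

(** The hypothesis on d is [h1curve] for one increment. The weight mu is kept free because its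
    variation around 1 is what the equality case exploits. *)
Lemma young (R : realType) (h mu A d dk : R) : 0 < h -> 0 < mu -> 0 <= A ->
  d ^+ 2 <= h * dk -> A * `|d| <= mu / 2 * dk + A ^+ 2 * h / (2 * mu).
Proof.
move=> h0 mu0 A0 hd.
have p : 0 < 2 * mu * h by rewrite !mulr_gt0.
rewrite -(ler_pM2r p).
have -> : (mu / 2 * dk + A ^+ 2 * h / (2 * mu)) * (2 * mu * h) =
   mu ^+ 2 * (h * dk) + A ^+ 2 * h ^+ 2 by field; exact: lt0r_neq0.
have : mu ^+ 2 * d ^+ 2 <= mu ^+ 2 * (h * dk) by rewrite ler_wpM2l // sqr_ge0.
have := sqr_ge0 (mu * `|d| - A * h); rewrite sqrrB !exprMn real_normK ?num_real //.
rewrite -mulr_natl; lra.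
Qed.

(* [v] is (an ordinary function standing for) an [H^1] function, and [k] a
   primitive of [|v'|^2] or of something larger. *)
Definition h1curve (R : realType) (v k : R -> R) : Prop :=
  forall x y, x <= y -> (v y - v x) ^+ 2 <= (y - x) * (k y - k x).

Lemma h1curve_mono (R : realType) (v k : R -> R) (x y : R) : h1curve v k ->
  x <= y -> k x <= k y.
Proof.
move=> H; rewrite le_eqVlt => /orP[/eqP -> //|xy].
have := le_trans (sqr_ge0 _) (H x y (ltW xy)).
by rewrite pmulr_rge0 ?subr_gt0 // subr_ge0.
Qed.

Lemma h1curve_cont (R : realType) (v k : R -> R) : h1curve v k -> continuous v.
Proof.
move=> H x; apply: eps_cont => e e0.
have mk := fun y z => @h1curve_mono _ v k y z H.
pose C := k (x + 1) - k (x - 1) + 1.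
have C0 : 0 < C by have := mk (x - 1) (x + 1); rewrite /C; lra.
have bnd y z : x - 1 <= y -> y <= z -> z <= x + 1 -> k z - k y <= C.
  by move=> a b c; have := mk (x - 1) y a; have := mk z (x + 1) c; rewrite /C; lra.
exists (Num.min 1 (e ^+ 2 / C)); first by rewrite lt_min ltr01 divr_gt0 // exprn_gt0.
move=> y; rewrite lt_min => /andP[y1 ye].
rewrite -ler_sqr ?nnegrE ?(ltW e0) // real_normK ?num_real //.
have : `|y - x| * C <= e ^+ 2 by rewrite -ler_pdivlMr // ltW.
move: y1; rewrite ltr_norml => /andP[ya yb].
apply: le_trans; have [xy|yx] := leP x y.
  apply: le_trans (H x y xy) _; rewrite ger0_norm ?subr_ge0 //.
  apply: ler_wpM2l; first by rewrite subr_ge0.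
  by apply: bnd; lra.
rewrite -sqrrN opprB; apply: le_trans (H y x (ltW yx)) _.
rewrite ler0_norm ?subr_le0 ?(ltW yx) // opprB.
apply: ler_wpM2l; first by rewrite subr_ge0 ltW.
by apply: bnd; lra.
Qed.

Lemma ler_addeps (R : realType) (x y c : R) : 0 <= c ->
  (forall e, 0 < e -> x <= y + e * c) -> x <= y.
Proof.
move=> c0 h; rewrite leNgt; apply/negP => yx.
have p : 0 < (x - y) / (2 * (c + 1)) by apply: divr_gt0; lra.
have := h _ p.
have : (x - y) / (2 * (c + 1)) * c <= (x - y) / 2.
  have -> : (x - y) / 2 = (x - y) / (2 * (c + 1)) * (c + 1) by field; lra.
  by apply: ler_wpM2l; lra.
lra.
Qed.

(* The calibration inequality
   [|Phi(v)' | <= |psi(v)| |v'| <= mu/2 |v'|^2 + psi(v)^2 / (2 mu)], integrated. *)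
Lemma calibration1 (R : realType) (v k Phi psi P pi_ : R -> R) (mu s t : R) :
  h1curve v k -> (forall z : R, is_derive z 1 Phi (psi z)) ->
  (forall x : R, is_derive x 1 P (pi_ x)) -> (forall x, s <= x <= t -> psi (v x) ^+ 2 <= pi_ x) ->
  0 < mu -> s <= t ->
  Phi (v t) - Phi (v s) <= mu / 2 * (k t - k s) + (P t - P s) / (2 * mu).
Proof.
move=> H dPhi dP hpsi mu0 st.
have cv := h1curve_cont H.
apply: (@ler_addeps _ _ _ (t - s)); first by rewrite subr_ge0.
move=> e e0.
pose f x := Phi (v x) - mu / 2 * k x - P x / (2 * mu) - e * x.
suff : f t <= f s by rewrite /f => h; have -> : (P t - P s) / (2 * mu) = P t / (2 * mu) - P s / (2 * mu) by [ring]; lra.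
apply: locally_nonincreasing st _ => x xst.
set a := `|psi (v x)|; have a0 : 0 <= a by exact: normr_ge0.
(* e1 bounds the errors of both Phi and P: (a + e1)^2 + e1 is at most a^2 + e1 (2 a + 2), hence at
   most a^2 + 2 mu e. *)
pose e1 := Num.min 1 (2 * mu * e / (2 * a + 2)).
have q0 : 0 < 2 * a + 2 by lra.
have e10 : 0 < e1 by rewrite lt_min ltr01 divr_gt0 // !mulr_gt0.
have e11 : e1 <= 1 by rewrite ge_min lexx.
have e12 : e1 * (2 * a + 2) <= 2 * mu * e by rewrite -ler_pdivlMr // ge_min lexx orbT.
have [d1 d10 h1] := isd_eps (dPhi (v x)) e10.
have [d2 d20 h2] := isd_eps (dP x) e10.
have [d3 d30 h3] := cont_eps (cv x) d10.
exists (Num.min d2 d3); first by rewrite lt_min d20.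
have key y h dk : `|y - x| < Num.min d2 d3 -> 0 < h -> h = `|y - x| ->
   (v y - v x) ^+ 2 <= h * dk ->
   `|Phi (v y) - Phi (v x)| <= mu / 2 * dk + (pi_ x - e1) * h / (2 * mu) + e * h.
  rewrite lt_min => /andP[yd2 yd3] h0 hE hd.
  have := h1 (v y) (h3 y yd3); set d := v y - v x => hPhi.
  have b1 : `|Phi (v y) - Phi (v x)| <= (a + e1) * `|d|.
    have -> : Phi (v y) - Phi (v x) = (Phi (v y) - Phi (v x) - psi (v x) * d) + psi (v x) * d by ring.
    by apply: le_trans (ler_normD _ _) _; rewrite normrM -/a mulrDl addrC lerD2l.
  apply: (le_trans b1).
  have ae0 : 0 <= a + e1 by lra.
  apply: le_trans (young h0 mu0 ae0 hd) _.
  rewrite -addrA lerD2l.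
  have m2 : 0 < 2 * mu by rewrite mulr_gt0.
  rewrite -(ler_pM2r m2).
  have -> : ((pi_ x - e1) * h / (2 * mu) + e * h) * (2 * mu) = (pi_ x - e1 + 2 * mu * e) * h.
    by field; exact: lt0r_neq0.
  rewrite divfK ?lt0r_neq0 // ler_pM2r //.
  have := hpsi x xst; have -> : psi (v x) ^+ 2 = a ^+ 2 by rewrite real_normK ?num_real.
  by nra.
have Pbnd y : `|y - x| < Num.min d2 d3 -> `|P y - P x - pi_ x * (y - x)| <= e1 * `|y - x|.
  by rewrite lt_min => /andP[yd2 _]; exact: h2.
move=> y yst yd; split => [|] xy.
- move: xy; rewrite le_eqVlt => /orP[/eqP <- //|xy].
  have h0 : 0 < y - x by rewrite subr_gt0.
  have hE : y - x = `|y - x| by rewrite gtr0_norm.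
  have := key y _ _ yd h0 hE (H x y (ltW xy)).
  have := Pbnd y yd; rewrite -hE => hP hPhi.
  have c1 : Phi (v y) - Phi (v x) <= `|Phi (v y) - Phi (v x)| by exact: ler_norm.
  have c2 : (pi_ x - e1) * (y - x) / (2 * mu) <= P y / (2 * mu) - P x / (2 * mu).
    rewrite -mulrBl ler_pM2r ?invr_gt0 ?mulr_gt0 //.
    by move: hP; rewrite ler_norml => /andP[]; lra.
  rewrite /f; lra.
- move: xy; rewrite le_eqVlt => /orP[/eqP -> //|xy].
  have h0 : 0 < x - y by rewrite subr_gt0.
  have hE : x - y = `|y - x| by rewrite distrC gtr0_norm.
  have hs : (v y - v x) ^+ 2 <= (x - y) * (k x - k y).
    by rewrite -sqrrN opprB; exact: H (ltW xy).
  have := key y _ _ yd h0 hE hs.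
  have := Pbnd y yd; rewrite -hE distrC => hP hPhi.
  have c1 : Phi (v x) - Phi (v y) <= `|Phi (v y) - Phi (v x)| by rewrite distrC ler_norm.
  have c2 : (pi_ x - e1) * (x - y) / (2 * mu) <= P x / (2 * mu) - P y / (2 * mu).
    rewrite -mulrBl ler_pM2r ?invr_gt0 ?mulr_gt0 //.
    by move: hP; rewrite ler_norml => /andP[]; lra.
  rewrite /f; lra.
Qed.

Lemma calibration (R : realType) (v k Phi psi P pi_ : R -> R) (mu s t : R) :
  h1curve v k -> (forall z : R, is_derive z 1 Phi (psi z)) ->
  (forall x : R, is_derive x 1 P (pi_ x)) -> (forall x, s <= x <= t -> psi (v x) ^+ 2 <= pi_ x) ->
  0 < mu -> s <= t ->
  `|Phi (v t) - Phi (v s)| <= mu / 2 * (k t - k s) + (P t - P s) / (2 * mu).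
Proof.
move=> H dPhi dP hpsi mu0 st; rewrite ler_norml; apply/andP; split; last first.
  exact: calibration1 H dPhi dP hpsi mu0 st.
have dN (z : R) := isdN (dPhi z).
have hN x : s <= x <= t -> (- psi (v x)) ^+ 2 <= pi_ x by rewrite sqrrN; exact: hpsi.
have := calibration1 H dN dP hN mu0 st; lra.
Qed.

(** The path from time 0 to one extremum, on to the other, and back to the starting value covers
    [a, c] twice. The control L is arbitrary because the equality case uses one with different
    weights on different intervals. *)
Lemma round_trip (R : realType) (g L : R -> R) (T x1 x2 a c : R) :
  0 <= x1 <= T -> 0 <= x2 <= T -> g 0 = g T -> g x1 = a -> g x2 = c ->
  (forall x, 0 <= x <= T -> a <= g x <= c) ->
  (forall x y, 0 <= x -> x <= y -> y <= T -> `|g y - g x| <= L y - L x) ->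
  2 * (c - a) <= L T - L 0.
Proof.
move=> /andP[a1 b1] /andP[a2 b2] g0T g1 g2 gac hL.
have T0 : 0 <= T by lra.
have /andP[m1 m2] := gac 0 ltac:(by rewrite lexx).
have [x12|x21] := leP x1 x2.
- have := hL 0 x1 (lexx _) a1 b1; have := hL x1 x2 a1 x12 b2; have := hL x2 T a2 b2 (lexx _).
  rewrite -g0T g1 g2 !ler_norml => /andP[? ?] /andP[? ?] /andP[? ?]; lra.
- have := hL 0 x2 (lexx _) a2 b2; have := hL x2 x1 a2 (ltW x21) b1.
  have := hL x1 T a1 b1 (lexx _).
  rewrite -g0T g1 g2 !ler_norml => /andP[? ?] /andP[? ?] /andP[? ?]; lra.
Qed.

(* Twice the potential energy whose wave oscillates between [p] and [q]. *)
Definition pot2 (R : realType) (b p q s : R) : R :=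
  b / 2 * (s ^+ 2 - p ^+ 2) * (q ^+ 2 - s ^+ 2).

Lemma pot2_cont (R : realType) (b p q : R) (v : R -> R) : continuous v ->
  continuous (fun x => pot2 b p q (v x)).
Proof.
move=> cv x; have c2 : {for x, continuous (fun x => v x ^+ 2)}.
  exact: (@continuous_comp _ _ _ v (fun y => y ^+ 2) x (cv x) (@exprn_continuous _ 2 _)).
by apply: cvgM; [apply: cvgM; [exact: cvg_cst|] |];
  apply: cvgB => //; exact: cvg_cst.
Qed.

(** Where [pot2] is negative, [Num.sqrt] returns 0; this makes [psif] continuous on the whole line
    and lets [Phif] be used also for values below p. *)
Definition psif (R : realType) (b p q s : R) : R := Num.sqrt (pot2 b p q s).
Definition Phif (R : realType) (b p q : R) : R -> R := prim (psif b p q).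

Lemma psif_cont (R : realType) (b p q : R) : continuous (psif b p q).
Proof.
move=> x; apply: (@continuous_comp _ _ _ (pot2 b p q) Num.sqrt x _ (@sqrt_continuous _ _)).
exact: (@pot2_cont _ b p q (fun x => x) (fun x => cvg_id) x).
Qed.

Lemma isd_Phif (R : realType) (b p q s : R) :
  is_derive s 1 (Phif b p q) (psif b p q s).
Proof. by apply: prim_isd; exact: psif_cont. Qed.

Lemma Phif_mono (R : realType) (b p q s t : R) : s <= t -> Phif b p q s <= Phif b p q t.
Proof.
move=> st; apply: (isd_mono st (fun z _ => isd_cont (isd_Phif b p q z))
  (fun z _ => isd_Phif b p q z)) => z _; exact: sqrtr_ge0.
Qed.

Lemma psif_sqr (R : realType) (b p q s : R) : 0 <= b -> 0 <= p -> p <= s -> s <= q ->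
  psif b p q s ^+ 2 = pot2 b p q s.
Proof.
move=> b0 p0 ps sq; rewrite sqr_sqrtr // /pot2 !mulr_ge0 ?divr_ge0 // subr_ge0.
  by rewrite ler_sqr ?nnegrE //; lra.
by rewrite ler_sqr ?nnegrE //; lra.
Qed.

(** The substitution s = q sqrt D turns [Phif] into [jinc]: [Phif] at q sqrt D plus a multiple of
    [jinc] has zero derivative on the quarter period, and the two ends are compared. *)
Lemma Phif_diff (R : realType) (b q kap : R) : 0 < b -> 0 < q -> 0 <= kap < 1 ->
  Phif b (q * Num.sqrt (1 - kap)) q q - Phif b (q * Num.sqrt (1 - kap)) q (q * Num.sqrt (1 - kap))
  = Num.sqrt (b / 2) * q ^+ 3 * jc kap.
Proof.
move=> b0 q0 /andP[k0 k1]; set p := q * _.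
have pq : p <= q.
  rewrite /p -[leRHS]mulr1 ler_pM2l // -[leRHS]sqrtr1 ler_wsqrtr //; lra.
have p0 : 0 <= p by rewrite mulr_ge0 ?sqrtr_ge0 // ltW.
have b20 : 0 <= b / 2 by rewrite divr_ge0 // ltW.
have hd (t : R) := isdD (isd_comp (isd_Phif b p q _) (isdZ q (isd_sqrtD t k1)))
   (isdZ (Num.sqrt (b / 2) * q ^+ 3) (isd_jinc t k1)).
have hc t := isd_cont (hd t).
have hdE t : 0 < t < pi / 2 -> is_derive t 1 (fun y => Phif b p q (q * Num.sqrt (Dl kap y)) +
   Num.sqrt (b / 2) * q ^+ 3 * jinc kap y) 0.
  move=> /andP[t0 t1]; apply: isd_eq (hd t) _.
  have s0 : 0 <= sin t by apply: sin_ge0; rewrite !ltW.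
  have c0 : 0 <= cos t by apply: cos_ge0; rewrite !ltW.
  have hs := sqr_sqrtD t k1.
  have -> : psif b p q (q * Num.sqrt (Dl kap t)) = Num.sqrt (b / 2) * (q ^+ 2 * kap * sin t * cos t).
    rewrite /psif /pot2 /p !exprMn hs sqr_sqrtr ?subr_ge0 ?(ltW k1) //.
    have -> : b / 2 * (q ^+ 2 * Dl kap t - q ^+ 2 * (1 - kap)) * (q ^+ 2 - q ^+ 2 * Dl kap t)
       = b / 2 * (q ^+ 2 * kap * sin t * cos t) ^+ 2.
      rewrite !exprMn cos2sin2 /Dl; ring.
    by rewrite sqrtrM // sqrtr_sqr ger0_norm // !mulr_ge0 // ltW.
  by field; rewrite lt0r_neq0 // sqrtD_gt0.
have h1 := isd_mono (pihalf_ge0 R) (fun z _ => hc z) hdE (fun _ _ => lexx 0).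
have h2 := isd_anti (pihalf_ge0 R) (fun z _ => hc z) hdE (fun _ _ => lexx 0).
have := le_anti (introT andP (conj h1 h2)).
rewrite jinc0 jinc_pihalf /Dl sin0 sin_pihalf expr1n expr0n /= !mulr0 mulr1 subr0 sqrtr1.
by rewrite mulr1 addr0 => ->; rewrite -/p addrAC subrr add0r.
Qed.

(** On the descending half the derivative of w is minus [psif] at w, so [Phif] moves at the very
    rate at which the action accumulates: the wave saturates the calibration. *)
Lemma wave_Phif (R : realType) (b T p q : R) (w dw : R -> R) (z : R) :
  wave b T p q w dw -> 0 <= z <= T / 2 ->
  is_derive z 1 (fun z => Phif b p q (w z)) (- pot2 b p q (w z)).
Proof.
move=> W z01; apply: isd_eq (isd_comp (isd_Phif b p q (w z)) (wave_isd W z)) _.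
rewrite /psif /pot2 -(wave_eq W) sqrtr_sqr ler0_norm; last by apply: (wave_dle0 W).
by rewrite mulNr expr2.
Qed.

Lemma contX (R : realType) (v : R -> R) (n : nat) : continuous v ->
  continuous (fun x => v x ^+ n).
Proof.
move=> cv x; exact: (@continuous_comp _ _ _ v (fun y => y ^+ n) x (cv x)
  (@exprn_continuous _ n _)).
Qed.

Lemma int_pot2 (R : realType) (b p q T : R) (v : R -> R) : 0 <= T -> continuous v ->
  \int[@lebesgue_measure R]_(x in `[0, T]) pot2 b p q (v x) =
  b / 2 * ((p ^+ 2 + q ^+ 2) * \int[@lebesgue_measure R]_(x in `[0, T]) (v x ^+ 2)
    - \int[@lebesgue_measure R]_(x in `[0, T]) (v x ^+ 4) - p ^+ 2 * q ^+ 2 * T).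
Proof.
move=> T0 cv; have c2 := @contX R v 2 cv; have c4 := @contX R v 4 cv.
have cc (c : R) : continuous (fun _ : R => c) by move=> x; exact: cvg_cst.
have cz : continuous (fun x => (p ^+ 2 + q ^+ 2) * v x ^+ 2).
  by move=> x; apply: cvgM; [exact: cc | exact: c2].
have cb : continuous (fun x => (p ^+ 2 + q ^+ 2) * v x ^+ 2 - v x ^+ 4).
  by move=> x; apply: cvgB; [exact: cz | exact: c4].
have cp : continuous (fun x => (p ^+ 2 + q ^+ 2) * v x ^+ 2 - v x ^+ 4 - p ^+ 2 * q ^+ 2).
  by move=> x; apply: cvgB; [exact: cb | exact: cc].
rewrite -[in RHS](subr0 T) -[in RHS](@RintC _ _ 0 T) // subr0 -RintZ // -RintB // -RintB //.
rewrite -RintZ //; apply: eq_Rintegral => x _; rewrite /pot2; ring.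
Qed.

(** Completing the square: the energy minus its bound is the total cost in Young's inequality minus
    twice the oscillation of [Phif]. S2 and S4 stand for the integrals of v^2 and v^4, and dk for
    the kinetic integral. *)
Lemma energy_action (R : realType) (b m T p q S2 S4 dk : R) (kap : R) :
  0 < b -> 0 < q -> 0 <= kap < 1 -> p = q * Num.sqrt (1 - kap) -> S2 = 2 * m ->
  dk / 2 - b / 4 * S4 - 2 / b * gfun (b * m / 2) T kap (Num.sqrt (b / 2) * q) =
  dk / 2 + b / 2 * ((p ^+ 2 + q ^+ 2) * S2 - S4 - p ^+ 2 * q ^+ 2 * T) / 2
  - 2 * (Num.sqrt (b / 2) * q ^+ 3 * jc kap).
Proof.
move=> b0 q0 /andP[k0 k1] -> ->.
have hs : Num.sqrt (b / 2) ^+ 2 = b / 2 by rewrite sqr_sqrtr // divr_ge0 // ltW.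
have hk : Num.sqrt (1 - kap) ^+ 2 = 1 - kap by rewrite sqr_sqrtr // subr_ge0 ltW.
have h3 : Num.sqrt (b / 2) ^+ 3 = Num.sqrt (b / 2) * (b / 2) by rewrite exprS hs.
have h4 : Num.sqrt (b / 2) ^+ 4 = (b / 2) ^+ 2 by rewrite (exprM _ 2 2) hs.
by rewrite /gfun !exprMn hk h3 h4 hs; field; exact: lt0r_neq0.
Qed.

(** * The energy bound for a closed curve, and its equality case *)

Section EnergyBound.
Variables (R : realType) (b m T p p' q kap e x1 x2 : R) (v k : R -> R).
Hypotheses (b0 : 0 < b) (T0 : 0 < T) (H : h1curve v k) (vT : v 0 = v T).
Hypotheses (x1T : 0 <= x1 <= T) (x2T : 0 <= x2 <= T) (v1 : v x1 = p) (v2 : v x2 = q).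
Hypothesis vpq : forall x, 0 <= x <= T -> p <= v x <= q.
Hypotheses (q0 : 0 < q) (kap01 : 0 <= kap < 1).
Hypotheses (p'E : p' = q * Num.sqrt (1 - kap)) (pp' : p <= p').
Hypothesis he : forall s, p <= s <= q -> psif b p' q s ^+ 2 <= pot2 b p' q s + e.
Hypothesis hmass : \int[@lebesgue_measure R]_(x in `[0, T]) (v x ^+ 2) = 2 * m.

Let Phi := Phif b p' q.
Let P x := prim (fun x => pot2 b p' q (v x)) x + e * x.

Lemma isd_action (x : R) : is_derive x 1 P (pot2 b p' q (v x) + e).
Proof.
have cp := @pot2_cont R b p' q v (h1curve_cont H).
by apply: isd_eq (isdD (prim_isd x cp) (isdZ e (isd_id x))) _; rewrite mulr1.
Qed.

Lemma action_total : P T - P 0 = b / 2 * ((p' ^+ 2 + q ^+ 2) * (2 * m)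
  - \int[@lebesgue_measure R]_(x in `[0, T]) (v x ^+ 4) - p' ^+ 2 * q ^+ 2 * T) + e * T.
Proof.
have cv := h1curve_cont H.
rewrite -hmass -int_pot2 ?(ltW T0) // -prim_diff ?(ltW T0) //.
  by rewrite /P; ring.
by apply: locint_cont; exact: pot2_cont.
Qed.

Lemma Phi_osc (L : R -> R) :
  (forall x y, 0 <= x -> x <= y -> y <= T -> `|Phi (v y) - Phi (v x)| <= L y - L x) ->
  2 * (Num.sqrt (b / 2) * q ^+ 3 * jc kap) <= L T - L 0.
Proof.
move=> hL; rewrite -Phif_diff // -p'E.
have := @round_trip R (fun x => Phi (v x)) L T x1 x2 (Phi p) (Phi q) x1T x2T.
rewrite vT v1 v2 => h; apply: le_trans (h _ _ _ _ hL) => //.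
- by rewrite ler_pM2l // lerD2l lerN2; exact: Phif_mono.
- by move=> x xT; have /andP[? ?] := vpq xT; rewrite !Phif_mono.
Qed.

(** [p] is the minimum of v and [p'] the lower end of the calibrating well. They coincide, with e =
    0, when the minimum is positive; otherwise [p'] is taken small and positive and e pays for the
    values of v below it. *)
Lemma energy_lower : 2 / b * gfun (b * m / 2) T kap (Num.sqrt (b / 2) * q) - e * T / 2 <=
  (k T - k 0) / 2 - b / 4 * \int[@lebesgue_measure R]_(x in `[0, T]) (v x ^+ 4).
Proof.
have := @energy_action R b m T p' q _ (\int[@lebesgue_measure R]_(x in `[0, T]) (v x ^+ 4))
  (k T - k 0) kap b0 q0 kap01 p'E (erefl (2 * m)).
have := Phi_osc (L := fun x => k x / 2 + P x / 2).
have hL x y : 0 <= x -> x <= y -> y <= T ->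
    `|Phi (v y) - Phi (v x)| <= (k y / 2 + P y / 2) - (k x / 2 + P x / 2).
  move=> x0 xy yT.
  have hp z : x <= z <= y -> psif b p' q (v z) ^+ 2 <= pot2 b p' q (v z) + e.
    by move=> /andP[? ?]; apply/he/vpq/andP; split; lra.
  have := calibration H (isd_Phif b p' q) isd_action hp ltr01 xy.
  by move=> h; apply: (le_trans h); lra.
move=> /(_ hL); have := action_total; lra.
Qed.

Lemma energy_equality (s t : R) : e = 0 ->
  (k T - k 0) / 2 - b / 4 * \int[@lebesgue_measure R]_(x in `[0, T]) (v x ^+ 4) <=
  2 / b * gfun (b * m / 2) T kap (Num.sqrt (b / 2) * q) ->
  0 <= s -> s <= t -> t <= T ->
  k t - k s = P t - P s /\ `|Phi (v t) - Phi (v s)| <= P t - P s.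
Proof.
move=> e0 hE s0 st tT.
have hp z x y : 0 <= x -> y <= T -> x <= z <= y ->
    psif b p' q (v z) ^+ 2 <= pot2 b p' q (v z) + e.
  by move=> ? ? /andP[? ?]; apply/he/vpq/andP; split; lra.
have cal mu x y : 0 < mu -> 0 <= x -> x <= y -> y <= T ->
    `|Phi (v y) - Phi (v x)| <= mu / 2 * (k y - k x) + (P y - P x) / (2 * mu).
  move=> mu0 x0 xy yT.
  exact: (calibration H (isd_Phif b p' q) isd_action (fun z => @hp z x y x0 yT) mu0 xy).
pose A x := k x / 2 + P x / 2.
have calA x y : 0 <= x -> x <= y -> y <= T -> `|Phi (v y) - Phi (v x)| <= A y - A x.
  by move=> x0 xy yT; apply: le_trans (cal 1 x y ltr01 x0 xy yT) _; rewrite /A; lra.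
have tot : A T - A 0 <= 2 * (Num.sqrt (b / 2) * q ^+ 3 * jc kap).
  have := @energy_action R b m T p' q _ (\int[@lebesgue_measure R]_(x in `[0, T]) (v x ^+ 4))
    (k T - k 0) kap b0 q0 kap01 p'E (erefl (2 * m)).
  by have := action_total; rewrite e0 mul0r /A; lra.
(* Weight mu on [s, t] and weight 1 outside give another admissible control for the round trip. As A
   already has the least possible total change, the piece on [s, t] cannot be cheaper than with
   weight 1. *)
have opt mu : 0 < mu -> A t - A s <= mu / 2 * (k t - k s) + (P t - P s) / (2 * mu).
  move=> mu0; pose B x := mu / 2 * k x + P x / (2 * mu).
  have calB x y : 0 <= x -> x <= y -> y <= T -> `|Phi (v y) - Phi (v x)| <= B y - B x.
    move=> x0 xy yT; apply: le_trans (cal mu x y mu0 x0 xy yT) _.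
    by rewrite /B mulrBl mulrBr; lra.
  have tri x y z : `|Phi (v z) - Phi (v x)| <= `|Phi (v y) - Phi (v x)| + `|Phi (v z) - Phi (v y)|.
    by rewrite [leRHS]addrC; exact: ler_distD.
  pose L x := if x <= s then A x else if x <= t then A s + B x - B s
              else A s + B t - B s + A x - A t.
  have hL x y : 0 <= x -> x <= y -> y <= T -> `|Phi (v y) - Phi (v x)| <= L y - L x.
    move=> x0 xy yT; rewrite /L.
    have [ys|sy] := leP y s.
      have -> : x <= s by lra.
      exact: calA.
    have [xs|sx] := leP x s.
      have h1 := calA x s x0 xs ltac:(lra).
      have [yt|ty] := leP y t.
        have h2 := calB s y s0 ltac:(lra) yT.
        by have := tri x s y; lra.
      have h2 := calB s t s0 st tT; have h3 := calA t y ltac:(lra) ltac:(lra) yT.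
      by have := tri x s y; have := tri s t y; lra.
    have [yt|ty] := leP y t.
      have -> : x <= t by lra.
      by have := calB x y x0 xy yT; lra.
    have [xt|tx] := leP x t.
      have h1 := calB x t x0 xt tT; have h2 := calA t y ltac:(lra) ltac:(lra) yT.
      by have := tri x t y; lra.
    by have := calA x y x0 xy yT; lra.
  have := Phi_osc hL.
  have -> : L 0 = A 0 by rewrite /L s0.
  have LT : L T = A s + B t - B s + A T - A t.
    rewrite /L; have [Ts|sT] := leP T s.
      by have -> : s = T by [lra]; have -> : t = T by [lra]; lra.
    by have [Tt|tT'] := leP T t => //; have -> : t = T by [lra]; lra.
  rewrite LT => h; move: tot h; rewrite /B mulrBl mulrBr; lra.
have PE : k t - k s = P t - P s.
  set a := k t - k s in opt *; set c := P t - P s in opt *.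
  have a0 : 0 <= a by rewrite subr_ge0; exact: h1curve_mono H st.
  have AE : A t - A s = a / 2 + c / 2 by rewrite /A /a /c; lra.
  have c0 : 0 <= c.
    have dP z := isd_action z.
    rewrite subr_ge0; apply: (isd_mono st (fun z _ => isd_cont (dP z)) (fun z _ => dP z)).
    move=> z /andP[? ?]; apply: le_trans (@hp z 0 T (lexx _) (lexx _) _); first exact: sqr_ge0.
    by apply/andP; split; lra.
  (* Multiplied by 2 mu, [opt] says that mu^2 a - mu (a + c) + c is nonnegative for mu > 0. For a >
     0 its minimum, at mu = (a + c) / (2 a), is - (a - c)^2 / (4 a), which forces a = c. *)
  have opt' mu : 0 < mu -> mu * (a + c) <= mu ^+ 2 * a + c.
    move=> mu0; have := opt mu mu0; rewrite AE.
    have m2 : 0 < 2 * mu by rewrite mulr_gt0.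
    move/(ler_wpM2r (ltW m2)).
    have -> : (mu / 2 * a + c / (2 * mu)) * (2 * mu) = mu ^+ 2 * a + c.
      by field; exact: lt0r_neq0.
    by move=> h; apply: le_trans h; lra.
  apply/eqP; rewrite eq_le; apply/andP; split; rewrite leNgt; apply/negP => hac.
  - (* take [mu < 1] *)
    have a1 : 0 < a by lra.
    have := opt' ((a + c) / (2 * a)) ltac:(by apply: divr_gt0; lra).
    have -> : ((a + c) / (2 * a)) ^+ 2 * a = (a + c) ^+ 2 / (4 * a) by field; lra.
    have -> : (a + c) / (2 * a) * (a + c) = 2 * ((a + c) ^+ 2 / (4 * a)) by field; lra.
    have -> : (a + c) ^+ 2 / (4 * a) = c + (a - c) ^+ 2 / (4 * a) by field; lra.
    have : 0 < (a - c) ^+ 2 / (4 * a) by apply: divr_gt0; [rewrite exprn_gt0 // subr_gt0 | exact: mulr_gt0].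
    lra.
  - have [a1|a1] := ltP 0 a; last first.
      by have := opt' 2 ltac:(lra); have -> : a = 0 by [lra]; lra.
    have := opt' ((a + c) / (2 * a)) ltac:(by apply: divr_gt0; lra).
    have -> : ((a + c) / (2 * a)) ^+ 2 * a = (a + c) ^+ 2 / (4 * a) by field; lra.
    have -> : (a + c) / (2 * a) * (a + c) = 2 * ((a + c) ^+ 2 / (4 * a)) by field; lra.
    have -> : (a + c) ^+ 2 / (4 * a) = c + (c - a) ^+ 2 / (4 * a) by field; lra.
    have : 0 < (c - a) ^+ 2 / (4 * a) by apply: divr_gt0; [rewrite exprn_gt0 // subr_gt0 | exact: mulr_gt0].
    lra.
split => //; apply: le_trans (calA s t s0 st tT) _.
by rewrite /A; lra.
Qed.

End EnergyBound.

(** * Rigidity in the calibration inequality *)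

Lemma locally_lipschitz (R : realType) (f : R -> R) (C s t : R) : s <= t ->
  (forall x, s <= x <= t -> exists2 d, 0 < d & forall y, s <= y <= t ->
     `|y - x| < d -> `|f y - f x| <= C * `|y - x|) ->
  `|f t - f s| <= C * (t - s).
Proof.
move=> st loc; rewrite ler_norml; apply/andP; split.
- suff : - f t - C * t <= - f s - C * s by lra.
  apply: (@locally_nonincreasing _ (fun x => - f x - C * x)) => // x /loc[d d0 hd].
  exists d => // y yst yd; have H := hd y yst yd.
  split => xy; move: H; rewrite ler_norml => /andP[].
    rewrite (ger0_norm (x := y - x)) ?subr_ge0 //; lra.
  rewrite (ler0_norm (x := y - x)) ?subr_le0 //; lra.
- suff : f t - C * t <= f s - C * s by lra.
  apply: (@locally_nonincreasing _ (fun x => f x - C * x)) => // x /loc[d d0 hd].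
  exists d => // y yst yd; have H := hd y yst yd.
  split => xy; move: H; rewrite ler_norml => /andP[].
    rewrite (ger0_norm (x := y - x)) ?subr_ge0 //; lra.
  rewrite (ler0_norm (x := y - x)) ?subr_le0 //; lra.
Qed.

Section Rigidity.
Variables (R : realType) (b T p q x1 x2 : R) (w dw v P : R -> R).
Hypotheses (b0 : 0 < b) (T0 : 0 < T) (p0 : 0 < p) (W : wave b T p q w dw).
Hypotheses (cv : continuous v) (vT : v 0 = v T).
Hypotheses (x1T : 0 <= x1 <= T) (x2T : 0 <= x2 <= T) (v1 : v x1 = p) (v2 : v x2 = q).
Hypothesis vpq : forall x, 0 <= x <= T -> p <= v x <= q.
Hypothesis dP : forall x : R, is_derive x 1 P (pot2 b p q (v x)).
Hypothesis hPhi : forall s t, 0 <= s -> s <= t -> t <= T ->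
  `|Phif b p q (v t) - Phif b p q (v s)| <= P t - P s.

Lemma wave_inj (y z : R) : 0 <= y <= T / 2 -> 0 <= z <= T / 2 -> w y = w z -> y = z.
Proof.
move=> /andP[y0 yT] /andP[z0 zT] e; have [yz|zy|//] := ltgtP y z.
  by have := wave_decr W y0 yz zT; rewrite e ltxx.
by have := wave_decr W z0 zy yT; rewrite e ltxx.
Qed.

(** [y t] is the time at which the descending half of the wave takes the value v t. The aim is to
    show that this clock runs at speed one, forwards or backwards, which makes v a translate of
    w. *)
Lemma clock : exists y : R -> R, forall t, 0 <= t <= T -> 0 <= y t <= T / 2 /\ w (y t) = v t.
Proof.
have /choice[y hy] (t : R) : exists z : R, 0 <= t <= T -> 0 <= z <= T / 2 /\ w z = v t.
  have [tT|] := boolP (0 <= t <= T); last by exists 0.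
  have /andP[a c] := vpq tT.
  have T2 : 0 <= T / 2 by rewrite divr_ge0 // ltW.
  have hc z : 0 <= z <= T / 2 -> {for z, continuous (fun z => - w z)}.
    by move=> _; exact: isd_cont (isdN (wave_isd W z)).
  have [|z zT e] := IVT_le (v := - v t) T2 hc.
    by rewrite (wave_0 W) (wave_half W) !lerN2 a c.
  by exists z => _; split => //; apply: oppr_inj.
by exists y.
Qed.

Variable y : R -> R.
Hypothesis hy : forall t, 0 <= t <= T -> 0 <= y t <= T / 2 /\ w (y t) = v t.

(** Continuity of the clock, from the strict decrease of w. The two bounds are separate because at
    an end of [0, T / 2] one of them is automatic. *)
Lemma clock_near (x r : R) : 0 <= x <= T -> 0 < r ->
  exists2 d, 0 < d & forall t, 0 <= t <= T -> `|t - x| < d -> `|y t - y x| < r.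
Proof.
move=> xT r0; have [/andP[yx0 yxT] wx] := hy xT.
have [d1 d10 h1] : exists2 d, 0 < d & forall t, 0 <= t <= T -> `|t - x| < d -> y t < y x + r.
  have [le|lt] := leP (T / 2) (y x).
    by exists 1 => // t tT _; have [/andP[_ a] _] := hy tT; lra.
  pose z := Num.min (T / 2) (y x + r).
  have z1 : y x < z by rewrite lt_min lt; lra.
  have z2 : z <= T / 2 by rewrite ge_min lexx.
  have z3 : z <= y x + r by rewrite ge_min lexx orbT.
  have dec := wave_decr W yx0 z1 z2.
  have e0 : 0 < v x - w z by rewrite -wx subr_gt0.
  have [d d0 hd] := cont_eps (@cv x) e0.
  exists d => // t tT td; have [yt wt] := hy tT.
  apply: lt_le_trans z3; rewrite ltNge; apply/negP => zy.
  have : w (y t) <= w z.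
    move: zy; rewrite le_eqVlt => /orP[/eqP <- //|zy]; apply/ltW/(wave_decr W) => //; first lra.
    by case/andP: yt.
  by have := hd t td; rewrite wt ltr_norml => /andP[]; lra.
have [d2 d20 h2] : exists2 d, 0 < d & forall t, 0 <= t <= T -> `|t - x| < d -> y x - r < y t.
  have [le|lt] := leP (y x) 0.
    by exists 1 => // t tT _; have [/andP[a _] _] := hy tT; lra.
  pose z := Num.max 0 (y x - r).
  have z1 : z < y x by rewrite gt_max lt; lra.
  have z2 : 0 <= z by rewrite le_max lexx.
  have z3 : y x - r <= z by rewrite le_max lexx orbT.
  have dec := wave_decr W z2 z1 yxT.
  have e0 : 0 < w z - v x by rewrite -wx subr_gt0.
  have [d d0 hd] := cont_eps (@cv x) e0.
  exists d => // t tT td; have [yt wt] := hy tT.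
  apply: le_lt_trans z3 _; rewrite ltNge; apply/negP => zy.
  have : w z <= w (y t).
    move: zy; rewrite le_eqVlt => /orP[/eqP -> //|zy]; apply/ltW/(wave_decr W) => //; last lra.
    by case/andP: yt.
  by have := hd t td; rewrite wt ltr_norml => /andP[]; lra.
exists (Num.min d1 d2); first by rewrite lt_min d10.
move=> t tT; rewrite lt_min => /andP[td1 td2].
by have := h1 t tT td1; have := h2 t tT td2; rewrite ltr_norml; lra.
Qed.

(** With D = [pot2] at v x, positive in the interior, [Phif] along the wave has derivative - D at
    [y x] and P has derivative D at x. As [Phif] changes at most as much as P, the clock cannot run
    faster than time. At the ends of [0, T / 2] D vanishes and the argument is void. *)
Lemma clock_interior (x e : R) : 0 <= x <= T -> 0 < y x < T / 2 -> 0 < e ->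
  exists2 d, 0 < d & forall t, 0 <= t <= T -> `|t - x| < d ->
    `|y t - y x| <= (1 + e) * `|t - x|.
Proof.
move=> xT /andP[yx0 yxT] e0; have [/andP[_ _] wx] := hy xT.
have yx : 0 <= y x <= T / 2 by rewrite !ltW.
pose D := pot2 b p q (v x).
have D0 : 0 < D.
  have h1 : w (y x) < q by rewrite -(wave_0 W); apply: (wave_decr W) => //; exact: ltW.
  have h2 : p < w (y x) by rewrite -(wave_half W); apply: (wave_decr W) => //; exact: ltW.
  rewrite wx in h1 h2.
  rewrite /D /pot2; apply: mulr_gt0; [apply: mulr_gt0; first by rewrite divr_gt0|].
    rewrite subr_sqr mulr_gt0 ?subr_gt0 //.
    by rewrite addr_gt0 // (lt_trans p0).
  rewrite subr_sqr mulr_gt0 ?subr_gt0 // addr_gt0 // ?(lt_trans p0) //.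
  exact: lt_trans h1.
(* Chosen so that (D + eta) / (D - eta) = 1 + e. *)
pose eta := D * e / (2 + e).
have q0 : 0 < 2 + e by lra.
have eta0 : 0 < eta by rewrite divr_gt0 // mulr_gt0.
have etaE : D + eta = (1 + e) * (D - eta) by rewrite /eta; field; exact: lt0r_neq0.
have Deta : 0 < D - eta.
  have : 0 < (1 + e) * (D - eta) by rewrite -etaE; lra.
  by rewrite pmulr_rgt0 //; lra.
have [d1 d10 h1] := isd_eps (wave_Phif W yx) eta0.
have [d2 d20 h2] := isd_eps (dP x) eta0.
have [d3 d30 h3] := clock_near xT d10.
exists (Num.min d2 d3); first by rewrite lt_min d20.
move=> t tT; rewrite lt_min => /andP[td2 td3].
have := h1 (y t) (h3 t tT td3); have := h2 t td2.
have [_ wt] := hy tT; rewrite wt wx -/D => hP hF.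
have hPP : `|Phif b p q (v t) - Phif b p q (v x)| <= `|P t - P x|.
  have /andP[t0 t1] := tT; have /andP[xx0 xx1] := xT.
  have [xt|tx] := leP x t.
    by apply: le_trans (hPhi xx0 xt t1) (ler_norm _).
  by rewrite distrC [leRHS]distrC; apply: le_trans (hPhi t0 (ltW tx) xx1) (ler_norm _).
have hPb : `|P t - P x| <= (D + eta) * `|t - x|.
  have -> : P t - P x = (P t - P x - D * (t - x)) + D * (t - x) by ring.
  apply: le_trans (ler_normD _ _) _; rewrite normrM (gtr0_norm D0) mulrDl addrC.
  by rewrite lerD2l.
have hFb : D * `|y t - y x| - eta * `|y t - y x| <= `|Phif b p q (v t) - Phif b p q (v x)|.
  have -> : D * `|y t - y x| = `|D * (y t - y x)| by rewrite normrM (gtr0_norm D0).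
  set F := _ - Phif _ _ _ _ in hF *.
  have -> : D * (y t - y x) = (F - - D * (y t - y x)) - F by ring.
  by have := ler_normB (F - - D * (y t - y x)) F; lra.
rewrite -(ler_pM2l Deta) mulrBl mulrA [_ * (1 + e)]mulrC -etaE.
exact: le_trans hFb (le_trans hPP hPb).
Qed.

(** To avoid the extrema of the wave, the clock is truncated to [e, T / 2 - e]. The truncated clock
    is locally constant where the clock is outside this interval, and truncation moves values by at
    most e. *)
Lemma clock_lipschitz (s t : R) : 0 <= s -> s <= t -> t <= T -> `|y t - y s| <= t - s.
Proof.
move=> s0 st tT.
apply: (@ler_addeps _ _ _ (t - s + 2)); first lra.
move=> e e0.
have [Te|eT] := leP (T / 2) (2 * e).
  have [/andP[a c] _] := @hy t ltac:(lra); have [/andP[a' c'] _] := @hy s ltac:(lra).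
  rewrite ler_norml; have : 0 <= e * (t - s) by rewrite mulr_ge0 // ?subr_ge0 // ltW.
  lra.
pose c z := Num.min (Num.max z e) (T / 2 - e).
have cz z : 0 <= z <= T / 2 -> `|c z - z| <= e.
  move=> /andP[z0 z1]; rewrite /c.
  by rewrite ler_norml maxElt; case: (ltP z e) => h1; rewrite minElt; case: ltP => h2; lra.
have c1 z z' : `|c z - c z'| <= `|z - z'|.
  have h5 := ler_norm (z - z'); have h6 := ler_norm (z' - z); rewrite distrC in h6.
  rewrite ler_norml /c !maxElt; case: (ltP z e) => h1; case: (ltP z' e) => h2;
  rewrite !minElt; case: ltP => h3; case: ltP => h4; lra.
have lip : `|c (y t) - c (y s)| <= (1 + e) * (t - s).
  apply: (@locally_lipschitz _ (fun x => c (y x))) => // x xst.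
  have xT : 0 <= x <= T by lra.
  have [h1|h1] := ltP (y x) e.
    have r0 : 0 < e - y x by lra.
    have [d d0 hd] := clock_near xT r0; exists d => // z zst zd.
    have zT : 0 <= z <= T by lra.
    have := hd z zT zd; rewrite ltr_norml => /andP[_ h2].
    have cE u : u <= e -> c u = e by move=> ue; rewrite /c max_r // min_l //; lra.
    rewrite !cE ?subrr ?normr0; [|lra|lra].
    by rewrite mulr_ge0 //; lra.
  have [h2|h2] := ltP (T / 2 - e) (y x).
    have r0 : 0 < y x - (T / 2 - e) by lra.
    have [d d0 hd] := clock_near xT r0; exists d => // z zst zd.
    have zT : 0 <= z <= T by lra.
    have := hd z zT zd; rewrite ltr_norml => /andP[h3 _].
    have cE u : T / 2 - e <= u -> c u = T / 2 - e.
      by move=> ue; rewrite /c min_r // le_max ue.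
    rewrite !cE ?subrr ?normr0; [|lra|lra].
    by rewrite mulr_ge0 //; lra.
  have [d d0 hd] := @clock_interior x e xT ltac:(lra) e0.
  exists d => // z zst zd; have zT : 0 <= z <= T by lra.
  exact: le_trans (c1 _ _) (hd z zT zd).
have e1 := cz _ (@hy t ltac:(lra)).1; have e2 := cz _ (@hy s ltac:(lra)).1.
move: lip e1 e2; rewrite !ler_norml => /andP[? ?] /andP[? ?] /andP[? ?].
apply/andP; split; lra.
Qed.

(** The clock is 0 at x2, T / 2 at x1, and takes equal values at 0 and T. Being 1-Lipschitz it needs
    time T / 2 for each of its two passages, one of them across the period boundary, so every bound
    is an equality. Evenness and periodicity of w absorb the sign and the shift by T. *)
Lemma clock_dist (x : R) : 0 <= x <= T -> v x = w (x - x2).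
Proof.
move=> xT.
have T2 : 0 <= T / 2 by rewrite divr_ge0 // ltW.
have h0 : 0 <= (0 : R) <= T / 2 by rewrite lexx.
have hT : 0 <= T / 2 <= T / 2 by rewrite T2 lexx.
have y2 : y x2 = 0.
  by have [yr e] := hy x2T; apply: wave_inj => //; rewrite e v2 (wave_0 W).
have y1 : y x1 = T / 2.
  by have [yr e] := hy x1T; apply: wave_inj => //; rewrite e v1 (wave_half W).
have y0T : y 0 = y T.
  have [yr e] := @hy 0 ltac:(lra); have [yr' e'] := @hy T ltac:(lra).
  by apply: wave_inj => //; rewrite e e' vT.
have [_ wx] := hy xT; rewrite -wx.
have /andP[a1 c1] := x1T; have /andP[a2 c2] := x2T; have /andP[ax cx] := xT.
have lip s t : 0 <= s -> s <= t -> t <= T -> - (t - s) <= y t - y s <= t - s.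
  by move=> s0 st tT; have := clock_lipschitz s0 st tT; rewrite ler_norml.
have per z : w (z + T) = w z := wave_per W z.
have [x12|x21] := leP x1 x2.
- have /andP[l1 _] := lip x1 x2 a1 x12 c2.
  have /andP[_ l2] := lip 0 x1 (lexx _) a1 c1.
  have /andP[_ l3] := lip x2 T a2 c2 (lexx _).
  have d : x2 - x1 = T / 2 by lra.
  have [xx1|x1x] := leP x x1.
    have -> : y x = x - x2 + T.
      have /andP[? ?] := lip 0 x (lexx _) ax cx.
      have /andP[? ?] := lip x x1 ax xx1 c1; lra.
    exact: per.
  have [xx2|x2x] := leP x x2.
    have -> : y x = - (x - x2).
      have /andP[? ?] := lip x1 x a1 (ltW x1x) cx.
      have /andP[? ?] := lip x x2 ax xx2 c2; lra.
    exact: wave_even W _.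
  congr w; have /andP[? ?] := lip x2 x a2 (ltW x2x) cx.
  have /andP[? ?] := lip x T ax cx (lexx _); lra.
- have /andP[_ l1] := lip x2 x1 a2 (ltW x21) c1.
  have /andP[l2 _] := lip 0 x2 (lexx _) a2 c2.
  have /andP[l3 _] := lip x1 T a1 c1 (lexx _).
  have d : x1 - x2 = T / 2 by lra.
  have [x1x|xx1] := leP x1 x.
    have -> : y x = - (x - x2 - T).
      have /andP[? ?] := lip x T ax cx (lexx _).
      have /andP[? ?] := lip x1 x a1 x1x cx; lra.
    by rewrite (wave_even W) -per subrK.
  have [xx2|x2x] := leP x x2.
    have -> : y x = - (x - x2).
      have /andP[? ?] := lip 0 x (lexx _) ax cx.
      have /andP[? ?] := lip x x2 ax xx2 c2; lra.
    exact: wave_even W _.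
  congr w; have /andP[? ?] := lip x2 x a2 (ltW x2x) cx.
  have /andP[? ?] := lip x x1 ax (ltW xx1) c1; lra.
Qed.

End Rigidity.

Lemma rigidity (R : realType) (b T p q x1 x2 : R) (w dw v P : R -> R) :
  0 < b -> 0 < T -> 0 < p -> wave b T p q w dw ->
  continuous v -> v 0 = v T -> 0 <= x1 <= T -> 0 <= x2 <= T -> v x1 = p -> v x2 = q ->
  (forall x, 0 <= x <= T -> p <= v x <= q) ->
  (forall x : R, is_derive x 1 P (pot2 b p q (v x))) ->
  (forall s t, 0 <= s -> s <= t -> t <= T ->
    `|Phif b p q (v t) - Phif b p q (v s)| <= P t - P s) ->
  forall x, 0 <= x <= T -> v x = w (x - x2).
Proof.
move=> b0 T0 p0 W cv vT x1T x2T v1 v2 vpq dP hPhi x xT.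
have [y hy] := clock T0 W vpq.
exact: (clock_dist b0 T0 p0 W cv vT x1T x2T v1 v2 dP hPhi hy xT).
Qed.

(* The speed of a complex curve is [|v'|^2 + v^2 |z'|^2] with [v] its modulus and
   [z] its phase factor, so [z] is constant when the modulus takes it all. *)
Lemma phase_const (R : realType) (T p c : R) (u1 u2 v k P w dw : R -> R) :
  0 < p -> (forall x : R, is_derive x 1 w (dw x)) ->
  (forall x, v x ^+ 2 = u1 x ^+ 2 + u2 x ^+ 2) ->
  (forall x y, x <= y ->
     (u1 y - u1 x) ^+ 2 + (u2 y - u2 x) ^+ 2 <= (y - x) * (k y - k x)) ->
  (forall x, 0 <= x <= T -> v x = w (x - c) /\ p <= v x) ->
  (forall x, 0 <= x <= T -> is_derive x 1 P (dw (x - c) ^+ 2)) ->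
  (forall s t, 0 <= s -> s <= t -> t <= T -> k t - k s = P t - P s) ->
  forall x, 0 <= x <= T -> u1 x / v x = u1 0 / v 0.
Proof.
move=> p0 dW vE H hv dP kP x xT; have /andP[xx0 xx1] := xT.
apply/eqP; rewrite -subr_eq0 -normr_le0.
apply: (@ler_addeps _ _ _ x) => // e e0; rewrite add0r -[in leRHS](subr0 x).
apply: (@locally_lipschitz _ (fun x => u1 x / v x)) => // z /andP[z0 zx].
have zT : 0 <= z <= T by apply/andP; split; lra.
set a := dw (z - c).
have a1 : 0 < 1 + 2 * `|a| by have := normr_ge0 a; lra.
(* The speed bound is off by eta h^2 and the lower bound on the change of v by 2 |a| eta h^2;
   together they must not exceed (e p h)^2. *)
pose eta := e ^+ 2 * p ^+ 2 / (1 + 2 * `|a|).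
have eta0 : 0 < eta by rewrite divr_gt0 // mulr_gt0 // exprn_gt0.
have etaE : eta * (1 + 2 * `|a|) = e ^+ 2 * p ^+ 2 by rewrite divfK // lt0r_neq0.
have dw' : is_derive z 1 (fun x => w (x - c)) a by exact: isd_shift (dW (z - c)).
have [d1 d10 h1] := isd_eps dw' eta0.
have [d2 d20 h2] := isd_eps (dP z zT) eta0.
exists (Num.min d1 d2); first by rewrite lt_min d10.
move=> y /andP[y0 yx]; rewrite lt_min => /andP[yd1 yd2].
have yT : 0 <= y <= T by apply/andP; split; lra.
have [vz pz] := hv z zT; have [vy py] := hv y yT.
have hw := h1 y yd1; have hP := h2 y yd2; rewrite -/a -vz -vy in hw hP.
set h := `|y - z| in hw hP *; have h0 : 0 <= h by exact: normr_ge0.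
have h2E : h ^+ 2 = (y - z) ^+ 2 by rewrite real_normK ?num_real.
have speed : (u1 y - u1 z) ^+ 2 + (u2 y - u2 z) ^+ 2 <= h ^+ 2 * (a ^+ 2 + eta).
  have hPP : h * `|P y - P z| <= h ^+ 2 * (a ^+ 2 + eta).
    rewrite expr2 -mulrA; apply: ler_wpM2l => //.
    have -> : P y - P z = (P y - P z - a ^+ 2 * (y - z)) + a ^+ 2 * (y - z) by ring.
    apply: le_trans (ler_normD _ _) _.
    by rewrite normrM (ger0_norm (sqr_ge0 a)) -/h; lra.
  apply: le_trans hPP; have [zy|yz] := leP z y.
    apply: le_trans (H z y zy) _; rewrite kP //; last by lra.
    by rewrite /h (ger0_norm (x := y - z)) ?subr_ge0 // ler_wpM2l ?subr_ge0 // ler_norm.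
  rewrite -(sqrrN (u1 y - _)) -(sqrrN (u2 y - _)) !opprB.
  apply: le_trans (H y z (ltW yz)) _; rewrite kP ?(ltW yz) //; last by lra.
  rewrite /h (ler0_norm (x := y - z)) ?subr_le0 ?(ltW yz) // opprB.
  by rewrite ler_wpM2l ?subr_ge0 ?(ltW yz) // distrC ler_norm.
have dv : h ^+ 2 * (a ^+ 2 - 2 * `|a| * eta) <= (v y - v z) ^+ 2.
  set r := v y - v z - a * (y - z) in hw.
  have -> : v y - v z = a * (y - z) + r by rewrite /r; ring.
  rewrite sqrrD exprMn -h2E -mulr_natr.
  have : `|a * (y - z) * r| <= `|a| * h * (eta * h).
    by rewrite !normrM ler_wpM2l // mulr_ge0.
  rewrite ler_norml => /andP[lo _]; have := sqr_ge0 r; nra.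
have vy0 : 0 < v y by lra.
have vz0 : 0 < v z by lra.
(* Law of cosines for the chord: its square minus the squared change of modulus is the product of
   the two moduli, each at least p, times the squared change of the phase factor. *)
have id : (u1 y - u1 z) ^+ 2 + (u2 y - u2 z) ^+ 2 - (v y - v z) ^+ 2 =
   v y * v z * ((u1 y / v y - u1 z / v z) ^+ 2 + (u2 y / v y - u2 z / v z) ^+ 2).
  transitivity (u1 y ^+ 2 + u2 y ^+ 2 + (u1 z ^+ 2 + u2 z ^+ 2) - 2 * (u1 y * u1 z + u2 y * u2 z)
    - (v y - v z) ^+ 2); first by ring.
  transitivity (v y * v z * ((u1 y ^+ 2 + u2 y ^+ 2) / v y ^+ 2 + (u1 z ^+ 2 + u2 z ^+ 2) / v z ^+ 2)
    - 2 * (u1 y * u1 z + u2 y * u2 z)); last by field; rewrite !lt0r_neq0.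
  by rewrite -!vE; field; rewrite !lt0r_neq0.
set D := u1 y / v y - u1 z / v z in id *.
have D2 : p ^+ 2 * D ^+ 2 <= (e * h) ^+ 2 * p ^+ 2.
  apply: (@le_trans _ _ (v y * v z * (D ^+ 2 + (u2 y / v y - u2 z / v z) ^+ 2))).
    apply: ler_pM; rewrite ?sqr_ge0 //; last by rewrite lerDl sqr_ge0.
    by rewrite expr2; apply: ler_pM => //; exact: ltW.
  rewrite -id exprMn; apply: (@le_trans _ _ (h ^+ 2 * (eta * (1 + 2 * `|a|)))).
    by move: speed dv; lra.
  by rewrite etaE; lra.
have pp : 0 < p ^+ 2 by rewrite exprn_gt0.
move: D2; rewrite mulrC ler_pM2r // -[D ^+ 2](real_normK (num_real _)).
by rewrite ler_sqr ?nnegrE ?mulr_ge0 // ltW.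
Qed.

(** * Energy of periodic curves *)

Lemma periodic_int (R : realType) (f : R -> R) (T : R) : (forall x, f (x + T) = f x) ->
  forall (x : R) (n : int), f (x + n%:~R * T) = f x.
Proof.
move=> fT x n; have nat_case (y : R) (j : nat) : f (y + j%:R * T) = f y.
  elim: j => [|j ih]; first by rewrite mul0r addr0.
  by rewrite -ih -[in RHS]fT; congr f; rewrite -natr1; ring.
case: n => n; first by rewrite -pmulrn nat_case.
rewrite NegzE -(nat_case (x + _) n.+1); congr f.
by rewrite mulrNz mulNr -pmulrn addrNK.
Qed.

Lemma periodic_eq (R : realType) (f g : R -> R) (T : R) : 0 < T ->
  (forall x, f (x + T) = f x) -> (forall x, g (x + T) = g x) ->
  (forall x, 0 <= x <= T -> f x = g x) -> f =1 g.
Proof.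
move=> T0 fT gT fg x; pose n := Num.floor (x / T).
rewrite -(periodic_int fT x (- n)) -(periodic_int gT x (- n)); apply: fg.
rewrite mulrNz mulNr subr_ge0 lerBlDr.
have /andP[h1 h2] : n%:~R <= x / T < (n + 1)%:~R by apply: real_floor_itv; exact: num_real.
move: h1 h2; rewrite ler_pdivlMr // ltr_pdivrMr // intrD => -> /= h2.
by apply/ltW/(lt_le_trans h2); rewrite mulrDl mul1r addrC.
Qed.

Definition absf (R : realType) (u1 u2 : R -> R) (x : R) : R :=
  Num.sqrt (u1 x ^+ 2 + u2 x ^+ 2).

Lemma absf_sqr (R : realType) (u1 u2 : R -> R) (x : R) :
  absf u1 u2 x ^+ 2 = u1 x ^+ 2 + u2 x ^+ 2.
Proof. by rewrite sqr_sqrtr // addr_ge0 // sqr_ge0. Qed.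

Definition h1curve2 (R : realType) (u1 u2 k : R -> R) : Prop := forall x y, x <= y ->
  (u1 y - u1 x) ^+ 2 + (u2 y - u2 x) ^+ 2 <= (y - x) * (k y - k x).

(** Reverse triangle inequality for the chord, from Cauchy-Schwarz in the plane: passing to the
    modulus does not increase the kinetic energy. *)
Lemma h1curve_absf (R : realType) (u1 u2 k : R -> R) : h1curve2 u1 u2 k ->
  h1curve (absf u1 u2) k.
Proof.
move=> H x y xy; apply: le_trans (H x y xy).
have ax := absf_sqr u1 u2 x; have ay := absf_sqr u1 u2 y.
have px : 0 <= absf u1 u2 x by exact: sqrtr_ge0.
have py : 0 <= absf u1 u2 y by exact: sqrtr_ge0.
suff : u1 x * u1 y + u2 x * u2 y <= absf u1 u2 x * absf u1 u2 y.
  by move: ax ay; nra.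
apply: le_trans (ler_norm _) _.
rewrite -ler_sqr ?nnegrE ?mulr_ge0 // real_normK ?num_real // exprMn ax ay.
have := sqr_ge0 (u1 x * u2 y - u2 x * u1 y); lra.
Qed.

(** Below p the root [psif] is 0, while (s^2 - p^2) (q^2 - s^2) + p^2 q^2 = s^2 (p^2 + q^2 - s^2)
    stays nonnegative. This is the price of calibrating with p above the minimum of the curve. *)
Lemma pot2_defect (R : realType) (b p q s : R) : 0 < b -> 0 <= p -> p <= q -> 0 <= s <= q ->
  psif b p q s ^+ 2 <= pot2 b p q s + b / 2 * (p ^+ 2 * q ^+ 2).
Proof.
move=> b0 p0 pq /andP[s0 sq].
have b2 : 0 < b / 2 by rewrite divr_gt0.
have [ps|sp] := leP p s.
  by rewrite psif_sqr ?(ltW b0) // lerDl mulr_ge0 ?(ltW b2) // mulr_ge0 // sqr_ge0.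
have h1 : s ^+ 2 <= p ^+ 2 by rewrite ler_sqr ?nnegrE // ltW.
have h2 : s ^+ 2 <= q ^+ 2 by rewrite ler_sqr ?nnegrE //; lra.
have -> : psif b p q s = 0.
  apply: ler0_sqrtr; rewrite /pot2 -mulrA pmulr_rle0 //.
  by rewrite mulr_le0_ge0 ?subr_ge0 ?subr_le0.
rewrite expr0n /= /pot2 -mulrA -mulrDr pmulr_rge0 //.
have := sqr_ge0 s; have := sqr_ge0 p; nra.
Qed.

Lemma unit_angle (R : realType) (c s : R) : c ^+ 2 + s ^+ 2 = 1 ->
  exists t, cos t = c /\ sin t = s.
Proof.
move=> cs; have c1 : -1 <= c <= 1.
  rewrite -ler_norml -(@ler_sqr _ _ 1) ?nnegrE // real_normK ?num_real //.
  by rewrite expr1n -cs lerDl sqr_ge0.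
have sE : Num.sqrt (1 - c ^+ 2) = `|s| by rewrite -cs addrC addKr sqrtr_sqr.
have [s0|s0] := leP 0 s.
  by exists (acos c); rewrite acosK ?in_itv // sin_acos // sE ger0_norm.
by exists (- acos c); rewrite cosN sinN acosK ?in_itv // sin_acos // sE ltr0_norm // opprK.
Qed.

Section CurveEnergy.
Variables (R : realType) (b m T : R) (u1 u2 k : R -> R).
Hypotheses (b0 : 0 < b) (m0 : 0 < m) (T0 : 0 < T).
Hypotheses (H : h1curve2 u1 u2 k).
Hypotheses (per1 : forall x, u1 (x + T) = u1 x) (per2 : forall x, u2 (x + T) = u2 x).
Hypothesis hmass :
  \int[@lebesgue_measure R]_(x in `[0, T]) (absf u1 u2 x ^+ 2) = 2 * m.
Let v := absf u1 u2.
Let En := (k T - k 0) / 2 - b / 4 * \int[@lebesgue_measure R]_(x in `[0, T]) (v x ^+ 4).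

Lemma modulus_range : exists x1 x2,
  [/\ 0 <= x1 <= T, 0 <= x2 <= T, 0 <= v x1, 0 < v x2 &
      forall x, 0 <= x <= T -> v x1 <= v x <= v x2].
Proof.
have cv := h1curve_cont (h1curve_absf H).
have cvT : {within `[0, T], continuous v} by exact: continuous_subspaceT.
have [x2 x2T h2] := EVT_max (ltW T0) cvT.
have [x1 x1T h1] := EVT_min (ltW T0) cvT.
move: x1T x2T; rewrite !in_itv /= => x1T x2T.
have bnd x : 0 <= x <= T -> v x1 <= v x <= v x2.
  by move=> xT; rewrite h1 ?h2 // in_itv.
exists x1, x2; split => //; first exact: sqrtr_ge0.
rewrite lt0r sqrtr_ge0 andbT; apply/eqP => v20.
have : \int[@lebesgue_measure R]_(x in `[0, T]) (v x ^+ 2) = 0.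
  rewrite (@eq_Rintegral _ _ _ _ _ (fun=> 0)); first by rewrite RintC ?mul0r // ltW.
  move=> x; rewrite inE /= in_itv /= => /bnd /andP[_]; rewrite v20 => a.
  have -> : v x = 0 by apply/eqP; rewrite eq_le a sqrtr_ge0.
  by rewrite expr0n.
by rewrite hmass => /eqP; rewrite mulf_eq0 pnatr_eq0 /= gt_eqF.
Qed.

Lemma v_per : v 0 = v T.
Proof. by rewrite /v /absf -(add0r T) per1 per2. Qed.

(* A vanishing minimum of [|u|] is approached by positive ones. *)
Lemma curve_energy_bound (V : R) :
  (forall kap Q, 0 <= kap < 1 -> 0 < Q -> V <= gfun (b * m / 2) T kap Q) ->
  2 / b * V <= En /\
  (En <= 2 / b * V -> exists x1 x2 q kap, [/\ 0 < q, 0 <= kap < 1,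
    [/\ 0 <= x1 <= T, 0 <= x2 <= T, v x1 = q * Num.sqrt (1 - kap), v x2 = q &
     forall x, 0 <= x <= T -> q * Num.sqrt (1 - kap) <= v x <= q] &
    gfun (b * m / 2) T kap (Num.sqrt (b / 2) * q) <= V]).
Proof.
move=> hV; have [x1 [x2 [x1T x2T p0 q0 vpq]]] := modulus_range.
set p := v x1 in p0 vpq; set q := v x2 in q0 vpq.
have hc := h1curve_absf H.
have b2 : 0 < Num.sqrt (b / 2) by rewrite sqrtr_gt0 divr_gt0.
have Q0 : 0 < Num.sqrt (b / 2) * q by rewrite mulr_gt0.
have pq : p <= q by have /andP[] := vpq x2 x2T.
have bb : 0 < 2 / b by rewrite divr_gt0.
move: p0; rewrite le_eqVlt => /orP[/eqP p0|p0]; last first.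
  pose kap := 1 - (p / q) ^+ 2.
  have pq0 : 0 < p / q by rewrite divr_gt0.
  have pq1 : p / q <= 1 by rewrite ler_pdivrMr // mul1r.
  have kap01 : 0 <= kap < 1.
    rewrite /kap subr_ge0 expr_le1 ?(ltW pq0) // pq1 /=.
    by rewrite ltrBlDr ltrDl exprn_gt0.
  have pE : p = q * Num.sqrt (1 - kap).
    rewrite /kap opprB addrC subrK sqrtr_sqr (gtr0_norm pq0) mulrC divfK //.
    exact: lt0r_neq0.
  have he s : p <= s <= q -> psif b p q s ^+ 2 <= pot2 b p q s + 0.
    by move=> /andP[? ?]; rewrite addr0 psif_sqr // ltW.
  have := energy_lower b0 T0 hc v_per x1T x2T (erefl p) (erefl q) vpq q0 kap01
    pE (lexx p) he hmass.
  rewrite mul0r mul0r subr0 -/v -/En => hE; split.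
    by apply: le_trans hE; rewrite ler_pM2l // hV.
  move=> hE'; exists x1, x2, q, kap; split => //; first by rewrite -pE.
  by rewrite -(ler_pM2l bb); exact: le_trans hE hE'.
have [k1 [d [k101 d0 hd]]] := gfun_gap (M := b * m / 2) (T := T) ltac:(by rewrite divr_gt0 // mulr_gt0) T0 Q0
  (fun kap h => hV kap _ h Q0).
have /andP[k10 k11] := k101.
have q4 : 0 < b / 2 * q ^+ 4 * T by rewrite !mulr_gt0 // exprn_gt0.
(* So close to 1 that the defect over a period, (1 - kap) (b / 2) q^4 T, is at most (2 / b) d.
   [energy_lower] loses only half of it, less than the margin from [gfun_gap]. *)
pose kap := Num.max k1 (1 - 2 / b * d / (b / 2 * q ^+ 4 * T)).
have bd : 0 < 2 / b * d / (b / 2 * q ^+ 4 * T) by rewrite divr_gt0 // mulr_gt0.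
have kap1 : k1 <= kap < 1 by rewrite le_max lexx /= gt_max k11 /=; lra.
have /andP[ka kb] := kap1.
have kap01 : 0 <= kap < 1 by rewrite kb (le_trans k10).
have kap2 : (1 - kap) * (b / 2 * q ^+ 4 * T) <= 2 / b * d.
  rewrite -ler_pdivlMr // lerBlDr -lerBlDl /kap le_max; apply/orP; right; lra.
pose p' := q * Num.sqrt (1 - kap).
have p'0 : 0 <= p' by rewrite mulr_ge0 ?sqrtr_ge0 // ltW.
have p'q : p' <= q.
  rewrite /p' -[leRHS]mulr1 ler_pM2l // -[leRHS]sqrtr1 ler_wsqrtr //; lra.
have p'2 : p' ^+ 2 = q ^+ 2 * (1 - kap).
  by rewrite /p' exprMn (@sqr_sqrtr _ (1 - kap)) // subr_ge0 ltW.
have he s : p <= s <= q -> psif b p' q s ^+ 2 <= pot2 b p' q s + b / 2 * (p' ^+ 2 * q ^+ 2).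
  by rewrite -p0; exact: pot2_defect.
have pp' : p <= p' by rewrite -p0.
have := energy_lower b0 T0 hc v_per x1T x2T (erefl p) (erefl q) vpq q0 kap01
    (erefl p') pp' he hmass.
rewrite -/v -/En => hE.
have hE1 : 2 / b * V < En.
  apply: lt_le_trans hE.
  have h1 : 2 / b * (V + d) <= 2 / b * gfun (b * m / 2) T kap (Num.sqrt (b / 2) * q).
    by rewrite ler_pM2l // hd.
  have h2 : b / 2 * (p' ^+ 2 * q ^+ 2) * T = (1 - kap) * (b / 2 * q ^+ 4 * T).
    by rewrite p'2; ring.
  have h3 : 0 < 2 / b * d by rewrite mulr_gt0.
  rewrite h2; lra.
by split; [exact: ltW | rewrite leNgt hE1].
Qed.

(** When |u| is constant, the mass fixes the quartic term, which alone already equals the bound; no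
    kinetic energy is left and u itself is constant. *)
Lemma curve_energy_const (x1 x2 q : R) : 0 < q -> 0 <= x1 <= T ->
  (forall x, 0 <= x <= T -> v x = q) -> En <= - (b * m ^+ 2 / T) ->
  exists t, forall x, u1 x = cos t * Num.sqrt (2 * m / T) /\ u2 x = sin t * Num.sqrt (2 * m / T).
Proof.
move=> q0 _ vq hE.
have int_cst (n : nat) : \int[@lebesgue_measure R]_(x in `[0, T]) (v x ^+ n) = q ^+ n * T.
  rewrite (@eq_Rintegral _ _ _ _ _ (fun=> q ^+ n)); first by rewrite RintC ?subr0 // ltW.
  by move=> x; rewrite inE /= in_itv /= => /vq ->.
have T1 := lt0r_neq0 T0.
have q2 : q ^+ 2 = 2 * m / T by rewrite -hmass -/v int_cst mulfK.
have qE : q = Num.sqrt (2 * m / T) by rewrite -q2 sqrtr_sqr gtr0_norm.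
have dk : k T - k 0 <= 0.
  move: hE; rewrite /En int_cst (exprM q 2 2) q2.
  have -> : b / 4 * ((2 * m / T) ^+ 2 * T) = b * m ^+ 2 / T by field.
  lra.
have km x y : x <= y -> k x <= k y by move=> xy; exact: h1curve_mono (h1curve_absf H) xy.
have cst x : 0 <= x <= T -> u1 x = u1 0 /\ u2 x = u2 0.
  move=> /andP[x0 xT].
  have := H x0; have -> : k x - k 0 = 0 by have := km 0 x x0; have := km x T xT; lra.
  rewrite mulr0 => h.
  have h1 := sqr_ge0 (u1 x - u1 0); have h2 := sqr_ge0 (u2 x - u2 0).
  by split; apply/eqP; rewrite -subr_eq0 -sqrf_eq0 eq_le; apply/andP; split; lra.
have v0 := vq 0 ltac:(by rewrite lexx ltW).
have cs : (u1 0 / q) ^+ 2 + (u2 0 / q) ^+ 2 = 1.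
  rewrite !exprMn -mulrDl -absf_sqr -/v v0 exprVn divff // expf_eq0 /=.
  exact: lt0r_neq0.
have [t [ct st]] := unit_angle cs.
exists t => x; rewrite -qE ct st !divfK ?lt0r_neq0 //; split.
  exact: (periodic_eq T0 per1 (g := fun=> u1 0) (fun=> erefl) (fun x xT => (cst x xT).1)).
exact: (periodic_eq T0 per2 (g := fun=> u2 0) (fun=> erefl) (fun x xT => (cst x xT).2)).
Qed.

Lemma curve_energy_small : b * m / 2 * T <= pi ^+ 2 / 2 ->
  - (b * m ^+ 2 / T) <= En /\
  (En <= - (b * m ^+ 2 / T) -> exists t, forall x,
     u1 x = cos t * Num.sqrt (2 * m / T) /\ u2 x = sin t * Num.sqrt (2 * m / T)).
Proof.
move=> hs; have M0 : 0 < b * m / 2 by rewrite divr_gt0 // mulr_gt0.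
have VE : 2 / b * - (2 * (b * m / 2) ^+ 2 / T) = - (b * m ^+ 2 / T).
  by field; rewrite !lt0r_neq0.
have [] := @curve_energy_bound (- (2 * (b * m / 2) ^+ 2 / T)) _.
  by move=> kap Q k01 Q0; have [] := gfun_min_small M0 T0 k01 Q0 hs.
rewrite VE => h1 h2; split => // hE.
have [x1 [x2 [q [kap [q0 k01 [x1T x2T v1 v2 vq] hg]]]]] := h2 hE.
have Q0 : 0 < Num.sqrt (b / 2) * q by rewrite mulr_gt0 // sqrtr_gt0 divr_gt0.
have [_ /(_ hg) k0] := gfun_min_small M0 T0 k01 Q0 hs.
apply: (@curve_energy_const x1 x1 q) => // x /vq.
by rewrite k0 subr0 sqrtr1 mulr1 => h; apply/eqP; rewrite eq_le andbC.
Qed.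

Lemma curve_energy_large (kap p q : R) (w dw : R -> R) : 0 < kap < 1 ->
  2 * (Kc kap * Ec kap) = b * m / 2 * T ->
  Num.sqrt (b / 2) * q = b * m / 2 / Ec kap -> p = q * Num.sqrt (1 - kap) ->
  wave b T p q w dw ->
  2 / b * gfun (b * m / 2) T kap (Num.sqrt (b / 2) * q) <= En /\
  (En <= 2 / b * gfun (b * m / 2) T kap (Num.sqrt (b / 2) * q) ->
   exists t c, forall x, u1 x = cos t * w (x - c) /\ u2 x = sin t * w (x - c)).
Proof.
move=> k01 hKE hQ pE W; have M0 : 0 < b * m / 2 by rewrite divr_gt0 // mulr_gt0.
have b2 : 0 < Num.sqrt (b / 2) by rewrite sqrtr_gt0 divr_gt0.
have /andP[k0 k1] := k01.
have [] := @curve_energy_bound (gfun (b * m / 2) T kap (Num.sqrt (b / 2) * q)) _.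
  move=> l Q l01 Q0; rewrite hQ.
  by have [] := gfun_min_large M0 T0 l01 Q0 k01 hKE.
move=> h1 h2; split => // hE.
have [x1 [x2 [q' [l [q'0 l01 [x1T x2T v1 v2 vq] hg]]]]] := h2 hE.
have Q0 : 0 < Num.sqrt (b / 2) * q' by rewrite mulr_gt0.
rewrite hQ in hg; have [_ /(_ hg) [lk qq]] := gfun_min_large M0 T0 l01 Q0 k01 hKE.
have qE : q' = q by apply: (mulfI (lt0r_neq0 b2)); rewrite qq hQ.
rewrite {}qE in q'0 v1 v2 vq; rewrite {}lk -?pE in v1 vq.
rewrite -/v in v1 v2 vq.
have hc := h1curve_absf H; have cv := h1curve_cont hc.
have k01' : 0 <= kap < 1 by rewrite k1 ltW.
have p0 : 0 < p by rewrite pE mulr_gt0 // sqrtr_gt0 subr_gt0.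
have he s : p <= s <= q -> psif b p q s ^+ 2 <= pot2 b p q s + 0.
  by move=> /andP[? ?]; rewrite addr0 psif_sqr // ltW.
pose P x := prim (fun x => pot2 b p q (v x)) x + 0 * x.
have hEq s t : 0 <= s -> s <= t -> t <= T -> k t - k s = P t - P s /\
    `|Phif b p q (v t) - Phif b p q (v s)| <= P t - P s.
  exact: (energy_equality b0 T0 hc v_per x1T x2T v1 v2 vq q'0 k01' pE (lexx p) he hmass
    (erefl 0) hE).
have dP (x : R) : is_derive x 1 P (pot2 b p q (v x)).
  apply: isd_eq (isdD (prim_isd x (pot2_cont cv)) (isdZ 0 (isd_id x))) _.
  by rewrite mul0r addr0.
have vw : forall x, 0 <= x <= T -> v x = w (x - x2).
  apply: (rigidity b0 T0 p0 W cv v_per x1T x2T v1 v2 vq dP).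
  by move=> s t s0 st tT; have [] := hEq s t s0 st tT.
have hv x : 0 <= x <= T -> v x = w (x - x2) /\ p <= v x.
  by move=> xT; split; [exact: vw | case/andP: (vq x xT)].
have dP' (x : R) : 0 <= x <= T -> is_derive x 1 P (dw (x - x2) ^+ 2).
  by move=> xT; apply: isd_eq (dP x) _; rewrite (wave_eq W) -vw.
have kP s t : 0 <= s -> s <= t -> t <= T -> k t - k s = P t - P s.
  by move=> s0 st tT; have [] := hEq s t s0 st tT.
have c1 := phase_const p0 (wave_isd W) (absf_sqr u1 u2) H hv dP' kP.
(* [phase_const] treats the first component; swapping the components gives the second. *)
have H' : h1curve2 u2 u1 k by move=> x y xy; rewrite addrC; exact: H.
have sq' x : v x ^+ 2 = u2 x ^+ 2 + u1 x ^+ 2 by rewrite absf_sqr addrC.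
have c2 := phase_const p0 (wave_isd W) sq' H' hv dP' kP.
have h00 : 0 <= (0 : R) <= T by rewrite lexx ltW.
have v0 : 0 < v 0 by have [_ a] := hv 0 h00; exact: lt_le_trans a.
have cs : (u1 0 / v 0) ^+ 2 + (u2 0 / v 0) ^+ 2 = 1.
  rewrite !exprMn -mulrDl -absf_sqr -/v exprVn divff // expf_eq0 /=.
  exact: lt0r_neq0.
have [t [ct st]] := unit_angle cs.
exists t, x2; rewrite ct st.
have wper c x : c * w (x + T - x2) = c * w (x - x2).
  by rewrite -[in RHS](wave_per W) addrAC.
have vx0 x : 0 <= x <= T -> v x != 0.
  by move=> xT; have [_ a] := hv x xT; apply: lt0r_neq0; exact: lt_le_trans a.
move=> x; split.
- apply: (periodic_eq T0 per1 (g := fun x => u1 0 / v 0 * w (x - x2))) => // z zT.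
  by rewrite -vw // -(c1 z zT) divfK // vx0.
- apply: (periodic_eq T0 per2 (g := fun x => u2 0 / v 0 * w (x - x2))) => // z zT.
  by rewrite -vw // -(c2 z zT) divfK // vx0.
Qed.

End CurveEnergy.

(** * Smooth cut-off functions *)

Definition smooth (R : realType) (f : R -> R) : Prop :=
  forall (n : nat) (x : R), derivable (derive1n n f) x 1.

Lemma isd_derive1 (R : realType) (f df : R -> R) :
  (forall x : R, is_derive x 1 f (df x)) -> derive1 f = df.
Proof. by move=> h; apply/funext => x; rewrite derive1E; exact: derive_val. Qed.

(** Induction on the order of the derivative, with f varying in the class. Smoothness proofs then
    only exhibit a class stable under differentiation, without formulas for higher derivatives. *)
Lemma smooth_coind (R : realType) (S : (R -> R) -> Prop) :
  (forall f, S f -> exists2 df, forall x : R, is_derive x 1 f (df x) & S df) ->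
  forall f, S f -> smooth f.
Proof.
move=> hS f Sf n; elim: n f Sf => [|n ih] f Sf x.
  by have [df h _] := hS f Sf; rewrite derive1n0; exact: (@ex_derive _ _ _ _ _ _ (df x) (h x)).
have [df h Sdf] := hS f Sf.
by rewrite derive1Sn (isd_derive1 h); exact: ih.
Qed.

Lemma smooth_isd (R : realType) (f : R -> R) : smooth f ->
  exists2 df, forall x : R, is_derive x 1 f (df x) & smooth df.
Proof.
move=> sf; exists (derive1 f).
  by move=> x; rewrite derive1E; apply: derivableP; exact: (sf 0).
by move=> n x; rewrite -derive1Sn; exact: sf.
Qed.

Lemma smooth_primitive (R : realType) (f df : R -> R) :
  (forall x : R, is_derive x 1 f (df x)) -> smooth df -> smooth f.
Proof.
move=> h sdf [|n] x; first by rewrite derive1n0; exact: (@ex_derive _ _ _ _ _ _ (df x) (h x)).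
by rewrite derive1Sn (isd_derive1 h); exact: sdf.
Qed.

Lemma smooth_cont (R : realType) (f : R -> R) : smooth f -> continuous f.
Proof. by move=> /smooth_isd [df h _]; exact: isd_all_cont h. Qed.

Lemma smooth_affine (R : realType) (f : R -> R) (c a d : R) : smooth f ->
  smooth (fun x => c * f (a * x + d)).
Proof.
pose S (g : R -> R) := exists f c, smooth f /\ g = fun x => c * f (a * x + d).
move=> sf; apply: (@smooth_coind R S); last by exists f, c.
move=> _ [{sf}f [{}c [sf ->]]]; have [df h sdf] := smooth_isd sf.
exists (fun x => c * a * df (a * x + d)); last by exists df, (c * a).
move=> x; have hl : is_derive x 1 (fun x : R => a * x + d) a.
  by apply: isd_eq (isdD (isdZ a (isd_id x)) (isd_cst d x)) _; ring.
by apply: isd_eq (isdZ c (@isd_comp _ _ (fun x : R => a * x + d) _ _ _ (h _) hl)) _; ring.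
Qed.

Lemma smoothB (R : realType) (f g : R -> R) : smooth f -> smooth g ->
  smooth (fun x => f x - g x).
Proof.
pose S (h : R -> R) := exists f g, [/\ smooth f, smooth g & h = fun x => f x - g x].
move=> sf sg; apply: (@smooth_coind R S); last by exists f, g.
move=> _ [{sf}f [{sg}g [sf sg ->]]].
have [df h sdf] := smooth_isd sf; have [dg h' sdg] := smooth_isd sg.
exists (fun x => df x - dg x); last by exists df, dg.
by move=> x; exact: isdB.
Qed.

(** The derivative of a product is a sum of two products; closing products under sums gives a class
    stable under differentiation, as [smooth_coind] asks. *)
Inductive prod_sum (R : realType) : (R -> R) -> Prop :=
| PSmul f g : smooth f -> smooth g -> prod_sum (fun x => f x * g x)
| PSadd f g : prod_sum f -> prod_sum g -> prod_sum (fun x => f x + g x).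

Lemma smoothM (R : realType) (f g : R -> R) : smooth f -> smooth g ->
  smooth (fun x => f x * g x).
Proof.
move=> sf sg; apply: (@smooth_coind R (@prod_sum R)); last exact: PSmul.
move=> h; elim=> {sf sg}{}f {}g.
- move=> sf sg; have [df hf sdf] := smooth_isd sf; have [dg hg sdg] := smooth_isd sg.
  exists (fun x => df x * g x + f x * dg x); first by move=> x; exact: isdM.
  by apply: PSadd; exact: PSmul.
- move=> _ [df hf sdf] _ [dg hg sdg].
  exists (fun x => df x + dg x); first by move=> x; exact: isdD.
  exact: PSadd.
Qed.

(** The power n serves the induction, since each further factor X of the polynomial raises it by
    one. The case n = 2 at y = 1/x bounds [flat] by a multiple of x^2, hence its derivative at 0 is
    zero. *)
Lemma horner_exp_bound (R : realType) (P : {poly R}) (n : nat) :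
  exists2 C, 0 <= C & forall y, 1 <= y -> y ^+ n * `|P.[y]| <= C * expR y.
Proof.
elim/poly_ind: P n => [|P c ih] n.
  by exists 0 => // y _; rewrite horner0 normr0 mulr0 mul0r.
have [C C0 hC] := ih n.+1.
exists (C + `|c| * (n.+1)`!%:R); first by rewrite addr_ge0 // mulr_ge0.
move=> y y1; have y0 : 0 <= y by lra.
rewrite hornerMXaddC mulrDl.
apply: (@le_trans _ _ (y ^+ n.+1 * `|P.[y]| + `|c| * y ^+ n)).
  have h : `|P.[y] * y + c| <= `|P.[y]| * y + `|c|.
    by apply: le_trans (ler_normD _ _) _; rewrite normrM (ger0_norm y0).
  apply: le_trans (ler_wpM2l (exprn_ge0 n y0) h) _.
  by rewrite le_eqVlt; apply/orP; left; apply/eqP; rewrite exprSr; ring.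
apply: lerD; first exact: hC.
rewrite -mulrA ler_wpM2l //.
have := expR_ge1Dxn n y0; rewrite -[X in _ -> _ <= X](@mulrC _ (expR y)) => h.
have f0 : 0 < (n.+1)`!%:R :> R by rewrite ltr0n fact_gt0.
rewrite -ler_pdivrMr //; apply: le_trans h.
apply: (@le_trans _ _ (y ^+ n.+1 / (n.+1)`!%:R)); last by rewrite lerDr.
by rewrite ler_pM2r ?invr_gt0 // exprS ler_peMl // exprn_ge0.
Qed.

(** The classical flat function exp (-1/x), with a polynomial factor in 1/x that makes the family
    stable under differentiation: P becomes X^2 (P - P'). *)
Definition flat (R : realType) (P : {poly R}) (x : R) : R :=
  if 0 < x then P.[x^-1] * expR (- x^-1) else 0.

Lemma isd_near (R : realType) (f g : R -> R) (x a : R) :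
  (\near x, f x = g x) -> is_derive x 1 f a -> is_derive x 1 g a.
Proof. exact: near_eq_is_derive. Qed.

Lemma isd_flat (R : realType) (P : {poly R}) (x : R) :
  is_derive x 1 (flat P) (flat ('X^2 * (P - P^`())) x).
Proof.
have [x0|x0|<-] := ltgtP 0 x.
- apply: (@isd_near _ (fun x => P.[x^-1] * expR (- x^-1))).
    by near=> y; rewrite /flat ifT //; near: y; exact: lt_nbhsr.
  have xn := lt0r_neq0 x0.
  have hi := @isd_inv _ (fun x : R => x) _ _ xn (isd_id x).
  apply: isd_eq (isdM (@isd_comp _ (horner P) _ _ _ _ (is_derive_poly P _) hi)
    (@isd_comp _ (@expR R) _ _ _ _ (is_derive_expR _) (isdN hi))) _.
  rewrite /flat x0 hornerM hornerXn hornerD hornerN.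
  by rewrite exprVn; ring.
- apply: (@isd_near _ (fun=> 0)).
    near=> y; rewrite /flat ifF //; apply/negbTE; rewrite -leNgt; near: y.
    by apply: lt_le_nbhsl.
  apply: isd_eq (isd_cst 0 x) _.
  by rewrite /flat ifF //; apply/negbTE; rewrite -leNgt ltW.
- rewrite [X in is_derive _ _ _ X](_ : _ = 0); last by rewrite /flat ltxx.
  apply: eps_isd => e e0.
  have [C C0 hC] := horner_exp_bound P 2.
  exists (Num.min 1 (e / (C + 1))); first by rewrite lt_min ltr01 divr_gt0 // ltr_wpDl.
  move=> y; rewrite !subr0 lt_min mul0r subr0 => /andP[y1 ye].
  rewrite {2}/flat ltxx subr0 /flat; case: ifPn => [y0|_]; last first.
    by rewrite normr0 mulr_ge0 // ltW.
  rewrite gtr0_norm // in y1 ye *.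
  have i1 : 1 <= y^-1 by rewrite invf_ge1 // ltW.
  have := hC _ i1; rewrite normrM (gtr0_norm (expR_gt0 _)) expRN exprVn => h.
  rewrite ler_pdivrMr ?expR_gt0 //.
  have y2 : 0 < y ^+ 2 by rewrite exprn_gt0.
  move: h; rewrite ler_pdivrMl // => h; apply: (le_trans h).
  rewrite mulrA ler_pM2r ?expR_gt0 // expr2 mulrAC ler_pM2r //.
  have C1 : 0 < C + 1 by lra.
  move: ye; rewrite ltr_pdivlMr // => ye; nra.
Unshelve. all: by end_near.
Qed.

Lemma smooth_flat (R : realType) (P : {poly R}) : smooth (flat P).
Proof.
pose S (f : R -> R) := exists P : {poly R}, f = flat P.
apply: (@smooth_coind R S); last by exists P.
move=> _ [Q ->]; exists (flat ('X^2 * (Q - Q^`()))); first exact: isd_flat.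
by eexists.
Qed.

Definition bump (R : realType) (x : R) : R := flat 1 x * flat 1 (1 - x).

Lemma smooth_bump (R : realType) : smooth (@bump R).
Proof.
apply: smoothM; first exact: smooth_flat.
have := @smooth_affine R _ 1 (-1) 1 (@smooth_flat R 1).
by congr smooth; apply/funext => x; rewrite mul1r mulN1r addrC.
Qed.

Lemma flat1_ge0 (R : realType) (x : R) : 0 <= flat 1 x.
Proof. by rewrite /flat; case: ifP => // _; rewrite hornerE mul1r expR_ge0. Qed.

Lemma bump_ge0 (R : realType) (x : R) : 0 <= bump x.
Proof. by rewrite mulr_ge0 // flat1_ge0. Qed.

Lemma bump_out (R : realType) (x : R) : x <= 0 \/ 1 <= x -> bump x = 0.
Proof.
rewrite /bump /flat => -[x0|x1].
  by rewrite ifF ?mul0r //; apply/negbTE; rewrite -leNgt.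
by rewrite [X in _ * X]ifF ?mulr0 //; apply/negbTE; rewrite -leNgt subr_le0.
Qed.

Lemma bump_half (R : realType) : 0 < bump (2^-1 : R).
Proof.
rewrite /bump /flat; have -> : 1 - 2^-1 = 2^-1 :> R by field.
by rewrite invr_gt0 ltr0n /= hornerC mul1r mulr_gt0 ?expR_gt0.
Qed.

(** [ker] is the bump divided by its mass and [step] its primitive. Under rescaling, [ker] tends to
    a Dirac mass and [step] to the indicator of a half-line. *)
Lemma smooth_step (R : realType) : exists ker step : R -> R,
  [/\ smooth step, smooth ker, forall x : R, is_derive x 1 step (ker x),
      (forall x, x <= 0 \/ 1 <= x -> ker x = 0) /\ (exists B, forall x, 0 <= ker x <= B) &
      [/\ forall x, x <= 0 -> step x = 0, forall x, 1 <= x -> step x = 1 &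
          forall x, 0 <= step x <= 1]].
Proof.
have cb := smooth_cont (@smooth_bump R).
pose c := prim (@bump R) 1.
have c0 : 0 < c.
  rewrite /c /prim ler01.
  apply: (int_gt0 cb (@bump_ge0 R) (x := 2^-1)); last exact: bump_half.
  by apply/andP; split; lra.
have mono x y : x <= y -> prim (@bump R) x <= prim (@bump R) y.
  move=> xy; apply: (isd_mono xy (fun z _ => isd_cont (prim_isd z cb)) (fun z _ => prim_isd z cb)).
  by move=> z _; exact: bump_ge0.
(* The form [1 * x + 0] matches [smooth_affine]. *)
pose ker (x : R) := c^-1 * bump (1 * x + 0); pose step (x : R) := c^-1 * prim (@bump R) x.
have kerE x : ker x = c^-1 * bump x by rewrite /ker mul1r addr0.
have dstep (x : R) : is_derive x 1 step (ker x).
  by rewrite kerE; exact: isdZ (prim_isd x cb).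
have sker : smooth ker by exact: smooth_affine (@smooth_bump R).
have kout x : x <= 0 \/ 1 <= x -> ker x = 0.
  by move=> h; rewrite kerE bump_out // mulr0.
have cst_out (a b : R) : a <= b -> (b <= 0 \/ 1 <= a) -> step a = step b.
  move=> ab h; have hd z : a < z < b -> is_derive z 1 step 0.
    move=> /andP[az zb]; apply: isd_eq (dstep z) _; apply: kout.
    by case: h => h; [left | right]; lra.
  have cs z : a <= z <= b -> {for z, continuous step} by move=> _; exact: isd_cont (dstep z).
  apply: le_anti; apply/andP; split.
    by apply: (isd_mono ab cs hd) => ? _.
  by apply: (isd_anti ab cs hd) => ? _.
have st0 x : x <= 0 -> step x = 0.
  by move=> x0; rewrite (cst_out x 0) //; [rewrite /step prim0 mulr0 | left].
have st1 x : 1 <= x -> step x = 1.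
  by move=> x0; rewrite -(cst_out 1 x) //; [rewrite /step mulVf // lt0r_neq0 | right].
exists ker, step; split => //.
- exact: smooth_primitive dstep sker.
- split => //.
  have cw : {within `[0, 1], continuous ker} by apply: continuous_subspaceT; exact: smooth_cont.
  have [z _ hz] := EVT_max ler01 cw.
  exists (ker z) => x; rewrite {1}kerE mulr_ge0 ?invr_ge0 ?(ltW c0) ?bump_ge0 //=.
  have kz : 0 <= ker z by rewrite kerE mulr_ge0 ?invr_ge0 ?(ltW c0) // bump_ge0.
  have [x0|x0] := leP x 0; first by rewrite kout //; left.
  have [x1|x1] := leP 1 x; first by rewrite kout //; right.
  by apply: hz; rewrite in_itv /= !ltW.
- split => // x.
  have sm a b : a <= b -> step a <= step b.
    by move=> ab; rewrite ler_pM2l ?invr_gt0 // mono.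
  have [x0|x0] := leP x 0; first by rewrite st0 // lexx ler01.
  have [x1|x1] := leP 1 x; first by rewrite st1 // lexx ler01.
  by rewrite -{1}(st0 0 (lexx _)) -{1}(st1 1 (lexx _)) !sm // ltW.
Qed.

(** * Weak derivatives *)

Definition mlocint (R : realType) (f : R -> R) : Prop :=
  measurable_fun setT f /\ locint f.

Lemma mlocint_cont (R : realType) (f : R -> R) : continuous f -> mlocint f.
Proof.
by move=> cf; split; [exact: continuous_measurable_fun | exact: locint_cont].
Qed.

Lemma mlocintM (R : realType) (f g : R -> R) : mlocint f -> continuous g ->
  mlocint (fun x => f x * g x).
Proof.
move=> [mf lf] cg; have mg := continuous_measurable_fun cg.
split; first exact: measurable_funM.
move=> a c.
have bg : [bounded g x | x in (`[a, c]%classic : set R)].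
  have cgi : compact (g @` `[a, c]%classic).
    apply: continuous_compact; last exact: segment_compact.
    exact: continuous_subspaceT.
  have [M [Mr hM]] := compact_bounded cgi.
  by exists M; split => // N MN x Ax; apply: (hM N MN); exists x.
rewrite (_ : EFin \o _ = ((EFin \o f) \* (EFin \o g))%E); last by apply/funext.
by apply: integrableMl => //; exact: measurable_funTS.
Qed.

Lemma mlocintB (R : realType) (f g : R -> R) : mlocint f -> mlocint g ->
  mlocint (fun x => f x - g x).
Proof.
move=> [mf lf] [mg lg]; split; first exact: measurable_funB.
move=> a c; rewrite (_ : EFin \o _ = ((EFin \o f) \- (EFin \o g))%E).
  by apply: integrableB.
by apply/funext.
Qed.

Lemma mlocint_norm (R : realType) (f : R -> R) : mlocint f -> mlocint (fun x => `|f x|).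
Proof.
move=> [mf lf]; split; first exact: measurableT_comp.
by move=> a c; exact: integrable_abse (lf a c).
Qed.

Lemma mlocint_locally (R : realType) (f : R -> R) : mlocint f ->
  locally_integrable setT f.
Proof.
move=> [mf lf]; split => //; first exact: openT.
move=> K _ cK.
have [M [Mr hM]] := compact_bounded cK.
pose B := `|M| + 1.
have KB : K `<=` `[- B, B]%classic.
  move=> x Kx; rewrite /= in_itv /= -ler_norml; apply: (hM B) => //.
  by apply: le_lt_trans (ler_norm M) _; rewrite ltrDl.
have /integrableP[m1 h1] := lf (- B) B.
apply: le_lt_trans h1; apply: ge0_subset_integral => //.
- exact: compact_measurable.
- by apply/measurable_EFinP; apply: measurableT_comp => //; exact: measurable_funTS.
Qed.

Lemma Rint_supp (R : realType) (f : R -> R) (a c : R) :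
  (forall x, ~~ (a <= x <= c) -> f x = 0) ->
  \int[@lebesgue_measure R]_x f x = \int[@lebesgue_measure R]_(x in `[a, c]) f x.
Proof.
move=> h; rewrite [RHS]Rintegral_mkcond; apply: eq_Rintegral => x _.
rewrite patchE; case: ifPn => // /negP xac; apply: h; apply/negP => xac'.
by apply: xac; rewrite inE /= in_itv.
Qed.


Lemma mlocint_integrable (R : realType) (f : R -> R) (a c : R) : mlocint f ->
  (@lebesgue_measure R).-integrable `[a, c] (EFin \o f).
Proof. by move=> [_]; exact. Qed.

Lemma lebesgue_pt_eps (R : realType) (f : R -> R) (s e : R) :
  mlocint f -> lebesgue_pt f s -> 0 < e ->
  exists2 d, 0 < d & forall h, 0 < h < d ->
    \int[@lebesgue_measure R]_(x in `[s - h, s + h]) `|f x - f s| <= e * h.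
Proof.
move=> mlf lp e0.
have mlg : mlocint (fun x => `|f x - f s|).
  by apply: mlocint_norm; apply: mlocintB => //; apply: mlocint_cont => x; exact: cvg_cst.
(* The ball of radius 2 h has length 4 h and contains the closed interval [s - h, s + h], whence e /
   4. *)
have : (\forall r \near (0 : R)^'+, davg f s r < (e / 4)%:E)%E.
  have /fine_cvgP [fin /cvgrPdist_lt lim] := lp.
  have e4 : 0 < e / 4 by rewrite divr_gt0.
  near=> r.
  have h1 : davg f s r \is a fin_num by near: r.
  have h2 : `|0 - (fine \o davg f s) r| < e / 4 by near: r; exact: lim.
  rewrite -(fineK h1) lte_fin; apply: le_lt_trans h2.
  by rewrite sub0r normrN /= ler_norm.
rewrite near_withinE => /nbhs_ballP [d /= d0 hd].
exists (d / 2); first by rewrite divr_gt0.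
move=> h /andP[h0 hd2].
have := hd (2 * h) _ _; rewrite /ball /= sub0r normrN gtr0_norm ?mulr_gt0 //.
move=> /(_ ltac:(lra) isT).
rewrite /davg /iavg lebesgue_measure_ball ?mulr_ge0 ?(ltW h0) //.
have hh : 0 < 2 * h by rewrite mulr_gt0.
have hh2 : 0 < (2 * h) *+ 2 by rewrite pmulrn_lgt0.
rewrite inver gt_eqF //.
set I := (X in (_ * X)%E) => hI.
have I0 : (0 <= I)%E by exact: integral_ge0.
have JI : (\int[@lebesgue_measure R]_(x in `[(s - h)%R, (s + h)%R]) (`|(f x - f s)%R|%R%:E) <= I)%E.
  apply: ge0_subset_integral => //.
  - exact: measurable_ball.
  - by case: mlg => mg _; apply: measurable_funTS; apply/measurable_EFinP.
  - move=> x; rewrite /= in_itv /= => /andP[x1 x2]; rewrite /ball /=.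
    rewrite ltr_norml; apply/andP; split; lra.
rewrite -lee_fin /Rintegral fineK; last first.
  exact: integrable_fin_num (mlocint_integrable (s - h) (s + h) mlg).
apply: le_trans JI _; apply/ltW.
rewrite muleC lte_pdivrMr // in hI.
apply: lt_le_trans hI _; rewrite -EFinM lee_fin -mulr_natr; lra.
Unshelve. all: by end_near.
Qed.

(** With N = n + 1, the kernel lives on [s, s + 1/N], is at most N B, and has mass one because [ker]
    is the derivative of [step]. The error is at most N B times the integral of |f - f s| over
    [s - 1/N, s + 1/N], which is o(1/N) at a Lebesgue point. *)
Lemma kernel_lebesgue (R : realType) (ker step : R -> R) (B : R) (f : R -> R) (s : R) :
  (forall x : R, is_derive x 1 step (ker x)) -> continuous ker ->
  (forall x, x <= 0 \/ 1 <= x -> ker x = 0) -> (forall x, 0 <= ker x <= B) ->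
  (forall x, x <= 0 -> step x = 0) -> (forall x, 1 <= x -> step x = 1) ->
  mlocint f -> lebesgue_pt f s ->
  (fun n : nat => \int[@lebesgue_measure R]_x (f x * (n.+1%:R * ker (n.+1%:R * (x - s)))))
    @ \oo --> f s.
Proof.
move=> dstep cker kout kB st0 st1 mlf lp.
have B0 : 0 <= B by have /andP[a b] := kB 0; exact: le_trans b.
apply/cvgrPdist_le => e e0.
have eB : 0 < e / (B + 1) by rewrite divr_gt0 // ltr_wpDl.
have [d d0 hd] := lebesgue_pt_eps mlf lp eB.
near=> n.
have hnd : (n.+1%:R^-1 : R) < d.
  near: n; have [K _ hK] := (@cvgrPdist_lt _ _ _ _ _ _ _).1 (@cvg_harmonic R) d d0.
  by exists K => // j /hK /=; rewrite sub0r normrN gtr0_norm // harmonic_gt0.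
have N0 : 0 < n.+1%:R :> R by rewrite ltr0n.
set N := n.+1%:R in N0 hnd *.
have hd0 : 0 < N^-1 < d by rewrite invr_gt0 N0.
have := hd _ hd0; have /andP[h0 _] := hd0; set h := N^-1 in h0 * => hI.
have cK : continuous (fun x => N * ker (N * (x - s))).
  move=> x; apply: cvgM; first exact: cvg_cst.
  apply: (@continuous_comp _ _ _ (fun x => N * (x - s)) ker x _ (cker _)).
  by apply: cvgM; [exact: cvg_cst | apply: cvgB; [exact: cvg_id | exact: cvg_cst]].
have Nh : N * h = 1 by rewrite mulfV // lt0r_neq0.
have out x : ~~ (s - h <= x <= s + h) -> N * ker (N * (x - s)) = 0.
  rewrite negb_and -!ltNge => /orP[xs|xs]; rewrite kout ?mulr0 //.
    by left; rewrite pmulr_rle0 //; lra.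
  by right; rewrite -Nh ler_pM2l //; lra.
rewrite (@Rint_supp _ _ (s - h) (s + h)); last by move=> x /out ->; rewrite mulr0.
have dK (x : R) : is_derive x 1 (fun x => f s * step (N * (x - s))) (f s * (N * ker (N * (x - s)))).
  have hl : is_derive x 1 (fun x : R => N * (x - s)) N.
    by apply: isd_eq (isdZ N (isdB (isd_id x) (isd_cst s x))) _; ring.
  apply: isd_eq (isdZ (f s) (@isd_comp _ _ (fun x : R => N * (x - s)) _ _ _ (dstep _) hl)) _.
  by rewrite (mulrC (ker _)).
have cfK : continuous (fun x => f s * (N * ker (N * (x - s)))).
  by move=> x; apply: cvgM; [exact: cvg_cst | exact: cK].
have sh : s - h <= s + h by lra.
have fsE : f s = \int[@lebesgue_measure R]_(x in `[s - h, s + h]) (f s * (N * ker (N * (x - s)))).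
  rewrite (FTC sh cfK dK) (_ : N * (s + h - s) = 1); last by rewrite addrC addKr.
  rewrite st1 // st0 ?mulr0 ?subr0 ?mulr1 //.
  by rewrite pmulr_rle0 //; lra.
rewrite [X in X - _]fsE -RintegralB //; last 2 first.
- exact: integrable_cont.
- exact: mlocint_integrable (mlocintM mlf cK).
have mlg : mlocint (fun x => f s * (N * ker (N * (x - s))) - f x * (N * ker (N * (x - s)))).
  by apply: mlocintB; [exact: mlocint_cont | exact: mlocintM].
apply: le_trans (le_normr_Rintegral _ (mlocint_integrable (s - h) (s + h) mlg)) _ => //.
have mla : mlocint (fun x => `|f x - f s|).
  by apply: mlocint_norm; apply: mlocintB => //; apply: mlocint_cont => x; exact: cvg_cst.
apply: (@le_trans _ _ (\int[@lebesgue_measure R]_(x in `[s - h, s + h]) (N * B * `|f x - f s|))).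
  apply: le_Rintegral => //.
  - exact: mlocint_integrable (mlocint_norm mlg).
  - apply: (@mlocint_integrable _ (fun x => N * B * `|f x - f s|)).
    rewrite (_ : (fun x => N * B * _) = (fun x => `|f x - f s| * (N * B))).
      by apply: mlocintM => // x; exact: cvg_cst.
    by apply/funext => x; rewrite mulrC.
  move=> x _; rewrite -mulrBl normrM mulrC distrC; apply: ler_wpM2r => //.
  have /andP[k0 kb] := kB (N * (x - s)).
  by rewrite ger0_norm ?mulr_ge0 ?(ltW N0) // ler_pM2l.
rewrite RintegralZl //; last exact: mlocint_integrable mla.
apply: (@le_trans _ _ (N * B * (e / (B + 1) * h))).
  by apply: ler_wpM2l => //; rewrite mulr_ge0 // ltW.
have -> : N * B * (e / (B + 1) * h) = (N * h) * (e * (B / (B + 1))) by ring.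
rewrite Nh mul1r ler_piMr ?(ltW e0) // ler_pdivrMr ?mul1r ?lerDl //.
by rewrite ltr_wpDl.
Unshelve. all: by end_near.
Qed.

Lemma ae_lebesgue_pt (R : realType) (f : R -> R) : mlocint f ->
  {ae @lebesgue_measure R, forall x, lebesgue_pt f x}.
Proof. by move=> mlf; apply: lebesgue_differentiation; exact: mlocint_locally. Qed.

Definition weak_real (R : realType) (r rho : R -> R) : Prop :=
  forall phi : R -> R, test_function phi ->
    \int[@lebesgue_measure R]_x (r x * derive1 phi x) =
    - \int[@lebesgue_measure R]_x (rho x * phi x).

Lemma test_kernel (R : realType) (ker : R -> R) (N s : R) : smooth ker -> 0 < N ->
  (forall x, x <= 0 \/ 1 <= x -> ker x = 0) -> test_function (fun x => N * ker (N * (x - s))).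
Proof.
move=> sk N0 kout; split.
  have := @smooth_affine R ker N N (- (N * s)) sk.
  by congr smooth; apply/funext => x; congr (_ * ker _); ring.
exists (`|s| + N^-1) => x hx; rewrite kout ?mulr0 //.
have i0 : 0 < N^-1 by rewrite invr_gt0.
have [x0|x0] := leP x 0.
  left; rewrite pmulr_rle0 //; have := ler_norm (- s); rewrite normrN.
  by move: hx; rewrite (ler0_norm x0); lra.
right; rewrite -(mulfV (lt0r_neq0 N0)) ler_pM2l //.
by have := ler_norm s; move: hx; rewrite (gtr0_norm x0); lra.
Qed.

(** At a common Lebesgue point both functions are limits of their integrals against the same
    shrinking kernels, and these integrals are determined by r. *)
Lemma weak_real_unique (R : realType) (r rho1 rho2 : R -> R) :
  mlocint rho1 -> mlocint rho2 -> weak_real r rho1 -> weak_real r rho2 ->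
  {ae @lebesgue_measure R, forall x, rho1 x = rho2 x}.
Proof.
move=> m1 m2 w1 w2.
have [ker [step [sstep sker dstep [kout [B kB]] [st0 st1 st01]]]] := smooth_step R.
have ck := smooth_cont sker.
have FF := ae_filter_ringOfSetsType (@lebesgue_measure R).
apply: filterS2 (ae_lebesgue_pt m1) (ae_lebesgue_pt m2) => x l1 l2.
have c1 := kernel_lebesgue dstep ck kout kB st0 st1 m1 l1.
have c2 := kernel_lebesgue dstep ck kout kB st0 st1 m2 l2.
have E : (fun n : nat => \int[@lebesgue_measure R]_y (rho1 y * (n.+1%:R * ker (n.+1%:R * (y - x)))))
  = (fun n : nat => \int[@lebesgue_measure R]_y (rho2 y * (n.+1%:R * ker (n.+1%:R * (y - x))))).
  apply/funext => n.
  have tf := @test_kernel R ker n.+1%:R x sker ltac:(by rewrite ltr0n) kout.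
  by have := w1 _ tf; rewrite (w2 _ tf) => /oppr_inj.
by rewrite E in c1; exact: cvg_unique c1 c2.
Qed.

(** For s < t this approximates the indicator of [s, t], and its derivative is a Dirac-like kernel
    at s minus one at t: tested against it, a weak derivative becomes a difference of values. *)
Lemma test_window (R : realType) (ker step : R -> R) (N s t : R) : smooth step ->
  (forall x : R, is_derive x 1 step (ker x)) -> 0 < N ->
  (forall x, x <= 0 -> step x = 0) -> (forall x, 1 <= x -> step x = 1) ->
  let phi := fun x => step (N * (x - s)) - step (N * (x - t)) in
  test_function phi /\
  derive1 phi = fun x => N * ker (N * (x - s)) - N * ker (N * (x - t)).
Proof.
move=> ss dstep N0 st0 st1 phi.
have aff c : (fun x => step (N * (x - c))) = (fun x => 1 * step (N * x + - (N * c))).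
  by apply/funext => x; rewrite mul1r; congr step; ring.
have da c (x : R) : is_derive x 1 (fun x => step (N * (x - c))) (N * ker (N * (x - c))).
  have hl : is_derive x 1 (fun x : R => N * (x - c)) N.
    by apply: isd_eq (isdZ N (isdB (isd_id x) (isd_cst c x))) _; ring.
  by apply: isd_eq (@isd_comp _ _ (fun x : R => N * (x - c)) _ _ _ (dstep _) hl) _; rewrite mulrC.
split; last by apply: isd_derive1 => x; exact: isdB (da s x) (da t x).
split.
  by apply: smoothB; rewrite aff; exact: smooth_affine.
have i0 : 0 < N^-1 by rewrite invr_gt0.
exists (`|s| + `|t| + N^-1) => x hx; rewrite /phi.
have as0 := normr_ge0 s; have at0 := normr_ge0 t.
have [x0|x0] := leP x 0.
  rewrite (ler0_norm x0) in hx.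
  have h c : `|c| <= `|s| + `|t| -> step (N * (x - c)) = 0.
    move=> hc; apply: st0; rewrite pmulr_rle0 //.
    by have := ler_norm (- c); rewrite normrN; lra.
  by rewrite !h ?subrr //; lra.
rewrite (gtr0_norm x0) in hx.
have h c : `|c| <= `|s| + `|t| -> step (N * (x - c)) = 1.
  move=> hc; apply: st1; rewrite -(mulfV (lt0r_neq0 N0)) ler_pM2l //.
  by have := ler_norm c; lra.
by rewrite !h ?subrr //; lra.
Qed.

Lemma window_limit (R : realType) (step f : R -> R) (s t : R) : s < t ->
  continuous step -> (forall x, 0 <= step x <= 1) ->
  (forall x, x <= 0 -> step x = 0) -> (forall x, 1 <= x -> step x = 1) ->
  mlocint f ->
  (fun n : nat => \int[@lebesgue_measure R]_x
     (f x * (step (n.+1%:R * (x - s)) - step (n.+1%:R * (x - t)))))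
    @ \oo --> \int[@lebesgue_measure R]_(x in `[s, t]) f x.
Proof.
move=> st cstep st01 st0 st1 mlf.
pose phi n x := step (n.+1%:R * (x - s)) - step (n.+1%:R * (x - t)).
have cphi n : continuous (phi n).
  have cc (c : R) : continuous (fun x : R => step (n.+1%:R * (x - c))).
    move=> x; apply: (@continuous_comp _ _ _ (fun x => n.+1%:R * (x - c)) step x _ (cstep _)).
    by apply: cvgM; [exact: cvg_cst | apply: cvgB; [exact: cvg_id | exact: cvg_cst]].
  by move=> x; apply: cvgB; exact: cc.
have out n x : ~~ (s <= x <= t + 1) -> f x * phi n x = 0.
  rewrite negb_and -!ltNge => /orP[xs|xs]; rewrite /phi.
    by rewrite !st0 ?subrr ?mulr0 // pmulr_rle0 ?ltr0n //; lra.
  have N1 : 1 <= n.+1%:R :> R by rewrite ler1n.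
  by rewrite !st1 ?subrr ?mulr0 //; nra.
pose F n x := (f x * phi n x)%:E.
(* Open at s and closed at t because [step] vanishes at 0, so that each rescaled step is 0 at its
   own base point. *)
pose g x := (if s < x <= t then f x else 0)%:E.
have FF := ae_filter_ringOfSetsType (@lebesgue_measure R).
have mF n : measurable_fun (`[s, t + 1]%classic : set R) (F n).
  by apply/measurable_EFinP; have [mm _] := mlocintM mlf (cphi n); exact: measurable_funTS.
have mg : measurable_fun (`[s, t + 1]%classic : set R) g.
  apply/measurable_EFinP; apply: measurable_funTS.
  apply: measurable_fun_ifT => //; last by case: mlf.
  apply: measurable_and; apply: measurable_fun_ltr || apply: measurable_fun_ler; exact: measurable_id || exact: measurable_cst.
have Fgx (x : R) : F ^~ x @ \oo --> g x.
  apply/fine_cvgP; split; first exact: nearW.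
  rewrite /=.
  have lim (c : R) : (fun n : nat => step (n.+1%:R * (x - c))) @ \oo --> (if c < x then 1 else 0 : R).
    case: ltP => cx; last first.
      rewrite (_ : (fun n => _) = (fun=> 0)); first exact: cvg_cst.
      by apply/funext => n; rewrite st0 // pmulr_rle0 ?ltr0n // subr_le0.
    apply: (@cvg_trans _ ((fun=> 1 : R) @ \oo)); last exact: cvg_cst.
    apply: near_eq_cvg.
    have d0 : 0 < x - c by rewrite subr_gt0.
    have [K _ hK] := (@cvgrPdist_lt _ _ _ _ _ _ _).1 (@cvg_harmonic R) _ d0.
    exists K => // n /hK /=; rewrite sub0r normrN gtr0_norm ?harmonic_gt0 // => hn.
    rewrite st1 //; have N0 : 0 < n.+1%:R :> R by rewrite ltr0n.
    apply: (@le_trans _ _ (n.+1%:R * n.+1%:R^-1)); first by rewrite mulfV // lt0r_neq0.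
    by rewrite ler_pM2l // ltW.
  have E : (if s < x <= t then f x else 0) =
      f x * ((if s < x then 1 else 0) - (if t < x then 1 else 0)).
    case: (ltP s x) => sx; case: (leP x t) => xt /=;
      rewrite ?subr0 ?mulr1 ?subrr ?mulr0 //; lra.
  rewrite /g E; apply: cvgM; first exact: cvg_cst.
  by apply: cvgB; exact: lim.
have Fg : {ae @lebesgue_measure R, forall x, (`[s, t + 1]%classic : set R) x ->
    F ^~ x @ \oo --> g x} by apply: aeW => x _; exact: Fgx.
have ig : (@lebesgue_measure R).-integrable `[s, t + 1] (fun x => `|f x|%:E).
  exact: mlocint_integrable (mlocint_norm mlf).
have Fle : {ae @lebesgue_measure R, forall x n, (`[s, t + 1]%classic : set R) x ->
    (`|F n x| <= `|f x|%:E)%E}.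
  apply: aeW => x n _; rewrite /F /= lee_fin normrM ler_piMr // ler_norml /phi.
  have /andP[? ?] := st01 (n.+1%:R * (x - s)); have /andP[? ?] := st01 (n.+1%:R * (x - t)); lra.
have [_ _ L] := @dominated_convergence _ _ _ (@lebesgue_measure R) `[s, t + 1]%classic
  ltac:(by []) F g (fun x => `|f x|%:E) mF mg Fg ig Fle.
have gE : (\int[@lebesgue_measure R]_(x in `[s, (t + 1)%R]) g x)%E =
    (\int[@lebesgue_measure R]_(x in `[s, t]) f x)%:E.
  have gi : (@lebesgue_measure R).-integrable `[s, t + 1] g.
    by have [] := @dominated_convergence _ _ _ (@lebesgue_measure R) `[s, t + 1]%classic
      ltac:(by []) F g (fun x => `|f x|%:E) mF mg Fg ig Fle.
  rewrite -[LHS]fineK; last exact: integrable_fin_num gi.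
  congr (_%:E); rewrite -(@Rintegral_itv_obnd_cbnd _ s (BRight t)); last first.
    by apply: integrableS (mlocint_integrable s t mlf) => //; exact: subset_itv_oc_cc.
  rewrite (_ : [set` `]s, t]] = `[s, t + 1]%classic `&` `]s, t]%classic); last first.
    apply/seteqP; split=> x /=; rewrite !in_itv /=; last by case.
    by move=> /andP[a c]; split; apply/andP; split; lra.
  rewrite Rintegral_mkcondr; apply: eq_Rintegral => x _.
  by rewrite /g patchE mem_setE in_itv.
rewrite gE in L.
have -> : (fun n : nat => \int[@lebesgue_measure R]_x (f x * phi n x)) =
   (fun n => fine (\int[@lebesgue_measure R]_(x in `[s, (t + 1)%R]) F n x)%E).
  by apply/funext => n; rewrite (@Rint_supp _ _ s (t + 1)) // => x; exact: out.
exact: fine_cvg L.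
Qed.

(** Testing on windows shows that r and [prim rho] have the same increment between any two Lebesgue
    points of r; one such point fixes the constant. *)
Lemma weak_real_primitive (R : realType) (r rho : R -> R) :
  mlocint r -> mlocint rho -> weak_real r rho ->
  exists c, {ae @lebesgue_measure R, forall x, r x = c + prim rho x}.
Proof.
move=> mr mrho w.
have [ker [step [sstep sker dstep [kout [B kB]] [st0 st1 st01]]]] := smooth_step R.
have ck := smooth_cont sker; have cs := smooth_cont sstep.
have key s t : s < t -> lebesgue_pt r s -> lebesgue_pt r t ->
    r t - r s = prim rho t - prim rho s.
  move=> st ls lt; rewrite prim_diff ?(ltW st) //; last by case: mrho.
  have Ls := kernel_lebesgue dstep ck kout kB st0 st1 mr ls.
  have Lt := kernel_lebesgue dstep ck kout kB st0 st1 mr lt.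
  have Lw := window_limit st cs st01 st0 st1 mrho.
  pose A (u : R) (n : nat) :=
    \int[@lebesgue_measure R]_y (r y * (n.+1%:R * ker (n.+1%:R * (y - u)))).
  have L : (fun n => A t n - A s n) @ \oo --> r t - r s by exact: cvgB Lt Ls.
  have E : (fun n => A t n - A s n) =
    (fun n : nat => \int[@lebesgue_measure R]_x
     (rho x * (step (n.+1%:R * (x - s)) - step (n.+1%:R * (x - t))))).
    apply/funext => n; rewrite /A; have N0 : 0 < n.+1%:R :> R by rewrite ltr0n.
    have [tf d] := @test_window R ker step n.+1%:R s t sstep dstep N0 st0 st1.
    have := w _ tf; rewrite d => h; rewrite -[RHS]opprK -h.
    pose a := Num.min (s - 1) (t - 1); pose c := Num.max (s + 1) (t + 1).
    have N1 : 1 <= n.+1%:R :> R by rewrite ler1n.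
    have out (u x : R) : (u = s) \/ (u = t) -> ~~ (a <= x <= c) -> n.+1%:R * ker (n.+1%:R * (x - u)) = 0.
      move=> us; rewrite negb_and -!ltNge /a /c lt_min gt_max => hx; rewrite kout ?mulr0 //.
      case/orP: hx => /andP[h1 h2]; [left | right]; case: us => ->; nra.
    have cK (u : R) : continuous (fun x : R => n.+1%:R * ker (n.+1%:R * (x - u))).
      move=> x; apply: cvgM; first exact: cvg_cst.
      apply: (@continuous_comp _ _ _ (fun x => n.+1%:R * (x - u)) ker x _ (ck _)).
      by apply: cvgM; [exact: cvg_cst | apply: cvgB; [exact: cvg_id | exact: cvg_cst]].
    rewrite !(@Rint_supp _ _ a c) => [|x hx|x hx|x hx].
    - rewrite -RintegralB //; last 2 first.
      + exact: mlocint_integrable (mlocintM mr (cK t)).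
      + exact: mlocint_integrable (mlocintM mr (cK s)).
      rewrite -[RHS]mulN1r -RintegralZl //; last first.
        apply: (@mlocint_integrable _ (fun x => r x * (n.+1%:R * ker (n.+1%:R * (x - s)) -
          n.+1%:R * ker (n.+1%:R * (x - t))))); apply: mlocintM => // x.
        by apply: cvgB; exact: cK.
      by apply: eq_Rintegral => x _; ring.
    - by rewrite !out ?subrr ?mulr0 //; [right | left].
    - by rewrite out ?mulr0 //; left.
    - by rewrite out ?mulr0 //; right.
  rewrite E in L; exact: cvg_unique L Lw.
(* The line has positive measure, so a property that holds almost everywhere holds somewhere. *)
have mT : (0 < @lebesgue_measure R setT)%E by rewrite -set_itvNyy lebesgue_measure_itv /= ltry.
have FF := ae_properfilter_algebraOfSetsType mT.
have [s ls] := filter_ex (ae_lebesgue_pt mr).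
exists (r s - prim rho s).
apply: filterS (ae_lebesgue_pt mr) => x lx.
have [sx|xs|->] := ltgtP s x; last by rewrite subrK.
  by have := key s x sx ls lx; lra.
by have := key x s xs lx ls; lra.
Qed.

(** * Periodic functions of class H^1_loc *)

Lemma mlocint_le (R : realType) (f g : R -> R) : measurable_fun setT f -> mlocint g ->
  (forall x, `|f x| <= g x) -> mlocint f.
Proof.
move=> mf mg fg; split => // a c.
apply: (le_integrable _ _ _ (mlocint_integrable a c mg)) => //.
  by apply/measurable_EFinP; exact: (measurable_funS measurableT).
by move=> x _ /=; rewrite lee_fin (le_trans (fg x)) // ler_norm.
Qed.

Lemma cmodulus_sqrt (R : realType) (z : R[i]) :
  cmodulus z = Num.sqrt (complex.Re z ^+ 2 + complex.Im z ^+ 2).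
Proof. by case: z. Qed.

Lemma cmodulus_sqr (R : realType) (z : R[i]) :
  cmodulus z ^+ 2 = complex.Re z ^+ 2 + complex.Im z ^+ 2.
Proof. by rewrite cmodulus_sqrt sqr_sqrtr // addr_ge0 // sqr_ge0. Qed.

Lemma Re_le_cmodulus (R : realType) (z : R[i]) : `|complex.Re z| <= cmodulus z.
Proof.
by rewrite cmodulus_sqrt -sqrtr_sqr ler_wsqrtr // lerDl sqr_ge0.
Qed.

Lemma Im_le_cmodulus (R : realType) (z : R[i]) : `|complex.Im z| <= cmodulus z.
Proof.
by rewrite cmodulus_sqrt -sqrtr_sqr ler_wsqrtr // lerDr sqr_ge0.
Qed.

Lemma measurable_cmodulus (R : realType) (u : R -> R[i]) : cmeasurable u ->
  measurable_fun setT (fun x => cmodulus (u x)).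
Proof.
move=> [m1 m2].
rewrite (_ : (fun x => _) = fun x => Num.sqrt (complex.Re (u x) ^+ 2 + complex.Im (u x) ^+ 2)).
  apply: (@measurableT_comp _ _ _ _ _ _ (@Num.sqrt R)).
    by apply: continuous_measurable_fun; exact: sqrt_continuous.
  by apply: measurable_funD; exact: measurable_funX.
by apply/funext => x; exact: cmodulus_sqrt.
Qed.

Lemma Lploc_mlocint (R : realType) (p : nat) (u : R -> R[i]) : Lploc p u ->
  mlocint (fun x => cmodulus (u x) ^+ p).
Proof.
move=> [mu lu]; have mc := measurable_cmodulus mu.
have mp : measurable_fun setT (fun x => cmodulus (u x) ^+ p) by exact: measurable_funX.
split => // a c; apply/integrableP; split.
  by apply/measurable_EFinP; exact: (measurable_funS measurableT).
apply: le_lt_trans (lu a c); apply: ge0_le_integral => //.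
- apply: measurableT_comp => //.
  by apply/measurable_EFinP; exact: (measurable_funS measurableT).
- by apply/measurable_EFinP; exact: (measurable_funS measurableT).
- move=> x _ /=; rewrite lee_fin ger0_norm //.
  by rewrite exprn_ge0 // cmodulus_sqrt sqrtr_ge0.
Qed.

Lemma mlocint_Lploc (R : realType) (p : nat) (u : R -> R[i]) : cmeasurable u ->
  mlocint (fun x => cmodulus (u x) ^+ p) -> Lploc p u.
Proof.
move=> mu mp; split => // a c.
have /integrableP[_] := mlocint_integrable a c mp.
apply: le_lt_trans; apply: ge0_le_integral => //.
- by move=> x _; rewrite lee_fin exprn_ge0 // cmodulus_sqrt sqrtr_ge0.
- by apply/measurable_EFinP; case: mp => mp _; exact: (measurable_funS measurableT).
- apply: measurableT_comp => //.
  by apply/measurable_EFinP; case: mp => mp _; exact: (measurable_funS measurableT).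
- by move=> x _ /=; rewrite lee_fin ler_norm.
Qed.

Lemma Lploc2_Lploc1 (R : realType) (u : R -> R[i]) : Lploc 2 u -> Lploc 1 u.
Proof.
move=> lu; have m2 := Lploc_mlocint lu; have mu := lu.1.
apply: mlocint_Lploc => //.
have m1 : mlocint (fun x => cmodulus (u x) ^+ 2 - -1).
  by apply: mlocintB => //; apply: mlocint_cont => x; exact: cvg_cst.
apply: mlocint_le m1 _; first by apply: measurable_funX; exact: measurable_cmodulus.
move=> x; rewrite expr1 ger0_norm; last by rewrite cmodulus_sqrt sqrtr_ge0.
have := sqr_ge0 (cmodulus (u x) - 1); have : 0 <= cmodulus (u x) by rewrite cmodulus_sqrt sqrtr_ge0.
nra.
Qed.

Lemma Lploc1_Re (R : realType) (u : R -> R[i]) : Lploc 1 u ->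
  mlocint (fun x => complex.Re (u x)).
Proof.
move=> lu; apply: mlocint_le (Lploc_mlocint lu) _; first by case: lu => [[]].
by move=> x; rewrite expr1 Re_le_cmodulus.
Qed.

Lemma Lploc1_Im (R : realType) (u : R -> R[i]) : Lploc 1 u ->
  mlocint (fun x => complex.Im (u x)).
Proof.
move=> lu; apply: mlocint_le (Lploc_mlocint lu) _; first by case: lu => [[]].
by move=> x; rewrite expr1 Im_le_cmodulus.
Qed.

Lemma weak_derivativeE (R : realType) (u v : R -> R[i]) : weak_derivative u v <->
  [/\ Lploc 1 v, weak_real (fun x => complex.Re (u x)) (fun x => complex.Re (v x)) &
      weak_real (fun x => complex.Im (u x)) (fun x => complex.Im (v x))].
Proof.
have reM (z : R[i]) (r : R) : complex.Re (z * r%:C) = complex.Re z * r.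
  by case: z => a c /=; rewrite mulr0 subr0.
have imM (z : R[i]) (r : R) : complex.Im (z * r%:C) = complex.Im z * r.
  by case: z => a c /=; rewrite mulr0 add0r.
have ciE (f : R -> R[i]) (g : R -> R) : cintegral setT (fun x => f x * (g x)%:C) =
    (\int[@lebesgue_measure R]_x (complex.Re (f x) * g x)) +i*
    (\int[@lebesgue_measure R]_x (complex.Im (f x) * g x)).
  by rewrite /cintegral; congr (_ +i* _); apply: eq_Rintegral => x _.
split=> [[lv H]|[lv H1 H2]].
  by split => // phi tp; have := H _ tp; rewrite !ciE => -[].
by split => // phi tp; rewrite !ciE H1 // H2.
Qed.

Lemma weak_derivative_unique (R : realType) (u v1 v2 : R -> R[i]) :
  weak_derivative u v1 -> weak_derivative u v2 -> ae_eq_fun v1 v2.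
Proof.
move=> /weak_derivativeE[l1 r1 i1] /weak_derivativeE[l2 r2 i2].
have FF := ae_filter_ringOfSetsType (@lebesgue_measure R).
have h1 := weak_real_unique (Lploc1_Re l1) (Lploc1_Re l2) r1 r2.
have h2 := weak_real_unique (Lploc1_Im l1) (Lploc1_Im l2) i1 i2.
rewrite /ae_eq_fun; move: h1 h2; apply: filterS2 => x.
by case: (v1 x) (v2 x) => [a c] [a' c'] /= -> ->.
Qed.

Lemma wderiv_ae (R : realType) (u v : R -> R[i]) : weak_derivative u v ->
  ae_eq_fun (wderiv u) v.
Proof.
move=> h; apply: (@weak_derivative_unique _ u) => //.
by rewrite /wderiv; apply: (@xgetPex _ (fun=> 0) [set v | weak_derivative u v]); exists v.
Qed.

(** By uniqueness of the measure with prescribed values on half-open intervals. It carries almost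
    everywhere statements along the period shift. *)
Lemma lebesgue_measure_shift (R : realType) (c : R) (A : set R) : measurable A ->
  lebesgue_measure ((fun x : R => x + c) @^-1` A) = lebesgue_measure A.
Proof.
move=> mA; have mf : measurable_fun setT ((fun x : R => x + c) : R -> measurableTypeR R).
  by apply: continuous_measurable_fun => x; apply: cvgD; [exact: cvg_id|exact: cvg_cst].
pose f : {mfun R >-> measurableTypeR R} := @mfun_Sub _ _ R (measurableTypeR R) (fun x : R => x + c) (mem_set mf).
change (pushforward (@lebesgue_measure R) f A = lebesgue_measure A).
apply/esym/lebesgue_measure_unique => //= _ [[a b]] _ <-.
rewrite /pushforward (_ : f @^-1` _ = `](a - c), (b - c)]%classic); last first.
  by apply/seteqP; split=> x /=; rewrite !in_itv /= ltrBlDr lerBrDr.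
rewrite !lebesgue_measure_itv /= !lte_fin ltrD2r; case: ifP => // _.
by rewrite -!EFinD; congr EFin; ring.
Qed.

Lemma ae_shift (R : realType) (c : R) (P : R -> Prop) :
  {ae @lebesgue_measure R, forall x, P x} -> {ae @lebesgue_measure R, forall x, P (x + c)}.
Proof.
move=> [A [mA A0 sA]]; exists ((fun x : R => x + c) @^-1` A); split.
- have mf : measurable_fun setT ((fun x : R => x + c) : R -> measurableTypeR R).
    by apply: continuous_measurable_fun => x; apply: cvgD; [exact: cvg_id|exact: cvg_cst].
  by rewrite -[X in measurable X]setTI; exact: mf.
- by rewrite lebesgue_measure_shift.
- by move=> x /= h; exact: sA.
Qed.

Lemma ae_eq_cont (R : realType) (f g : R -> R) : continuous f -> continuous g ->
  {ae @lebesgue_measure R, forall x, f x = g x} -> f =1 g.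
Proof.
move=> cf cg [A [mA A0 sA]] x; apply/eqP; apply: contraT => fg.
have e0 : 0 < `|f x - g x| / 2 by rewrite divr_gt0 // normr_gt0 subr_eq0.
have [d1 d10 h1] := cont_eps (cf x) e0; have [d2 d20 h2] := cont_eps (cg x) e0.
pose d := Num.min d1 d2; have d0 : 0 < d by rewrite lt_min d10.
have : (lebesgue_measure `]x, (x + d)%R[%classic <= lebesgue_measure A)%E.
  apply: le_measure; rewrite ?inE //=.
  move=> y; rewrite /= in_itv /= => /andP[xy yd].
  apply: sA => /= fgy.
  have hy : `|y - x| < d by rewrite ger0_norm; lra.
  have := hy; rewrite lt_min => /andP[hy1 hy2].
  have := h1 _ hy1; have := h2 _ hy2; rewrite fgy => a1 a2.
  have : `|f x - g x| <= `|g y - f x| + `|g y - g x|.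
    rewrite -[`|g y - f x|]normrN opprB (_ : f x - g x = (f x - g y) + (g y - g x)) ?ler_normD //; ring.
  lra.
rewrite A0 lebesgue_measure_itv /= lte_fin ltrDl d0 -EFinB lee_fin.
lra.
Qed.

Lemma ae_cmodulus_int (R : realType) (p : nat) (u v : R -> R[i]) (a c : R) :
  cmeasurable u -> Lploc p v -> ae_eq_fun u v ->
  (\int[@lebesgue_measure R]_(x in `[a, c]) (cmodulus (u x) ^+ p)%:E =
   (\int[@lebesgue_measure R]_(x in `[a, c]) cmodulus (v x) ^+ p)%:E)%E.
Proof.
move=> mu lv uv; have mv := lv.1.
have FF := ae_filter_ringOfSetsType (@lebesgue_measure R).
have -> : (\int[@lebesgue_measure R]_(x in `[a, c]) (cmodulus (u x) ^+ p)%:E =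
   \int[@lebesgue_measure R]_(x in `[a, c]) (cmodulus (v x) ^+ p)%:E)%E.
  apply: ae_eq_integral => //.
  - by apply/measurable_EFinP/measurable_funX; apply: (measurable_funS measurableT) => //; exact: measurable_cmodulus.
  - by apply/measurable_EFinP/measurable_funX; apply: (measurable_funS measurableT) => //; exact: measurable_cmodulus.
  - by move: uv; apply: filterS => x /= -> _.
rewrite fineK //; apply: integrable_fin_num => //.
exact: (mlocint_integrable a c (Lploc_mlocint lv)).
Qed.

Lemma Rint_ge0 (R : realType) (f : R -> R) (a c : R) : (forall x, 0 <= f x) ->
  0 <= \int[@lebesgue_measure R]_(x in `[a, c]) f x.
Proof. by move=> h; apply: Rintegral_ge0. Qed.

(** Cauchy-Schwarz, from the nonnegative integral of (f - p)^2 + (g - q)^2 with p and q the averages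
    over [x, y]; after expansion the squares of f and g enter only through h. *)
Lemma cauchy_schwarz_prim (R : realType) (f g h : R -> R) :
  mlocint f -> mlocint g -> mlocint h -> (forall x, h x = f x ^+ 2 + g x ^+ 2) ->
  h1curve2 (prim f) (prim g) (prim h).
Proof.
move=> mf mg mh hE x y xy.
rewrite !prim_diff //; [|exact: mh.2|exact: mg.2|exact: mf.2].
have [->|xny] := eqVneq x y.
  by rewrite set_itv1 !Rintegral_set1 expr0n /= addr0 mulr0.
have {xny} xy' : 0 < y - x by rewrite subr_gt0 lt_neqAle xny.
set I := \int[_]_(_ in _) f _; set J := \int[_]_(_ in _) g _; set K := \int[_]_(_ in _) h _.
pose p := I / (y - x); pose q := J / (y - x).
have iE (r : R -> R) (s : R) : mlocint r -> mlocint (fun t => s * r t).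
  move=> mr; rewrite (_ : (fun t => s * r t) = fun t => r t * s).
    by apply: mlocintM => // t; exact: cvg_cst.
  by apply/funext => t; rewrite mulrC.
have mc s : mlocint (fun _ : R => s) by apply: mlocint_cont => t; exact: cvg_cst.
have m1 := iE f (2 * p) mf; have m2 := iE g (2 * q) mg.
have m3 := mlocintB mh m1; have m4 := mlocintB m3 m2.
have m5 := mlocintB m4 (mc (- (p ^+ 2 + q ^+ 2))).
have : 0 <= \int[@lebesgue_measure R]_(t in `[x, y])
    (h t - 2 * p * f t - 2 * q * g t - - (p ^+ 2 + q ^+ 2)).
  apply: Rint_ge0 => t; rewrite hE.
  by have := sqr_ge0 (f t - p); have := sqr_ge0 (g t - q); lra.
have ml r := @mlocint_integrable R r x y.
rewrite !RintegralB //; try exact: (ml).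
rewrite !RintegralZl //; try exact: (ml).
rewrite -/I -/J -/K RintC // => pos.
have eI : I = p * (y - x) by rewrite /p divfK // gt_eqF.
have eJ : J = q * (y - x) by rewrite /q divfK // gt_eqF.
move: pos; rewrite eI eJ => pos.
have : 0 <= (y - x) * (K - 2 * p * (p * (y - x)) - 2 * q * (q * (y - x)) - - (p ^+ 2 + q ^+ 2) * (y - x)).
  by rewrite mulr_ge0 // ltW.
lra.
Qed.

Lemma Re_eta (R : realType) (z : R[i]) : z = complex.Re z +i* complex.Im z.
Proof. by case: z. Qed.

(** The bridge from weak functions to curves: a1 and a2 are the continuous representatives given by
    [weak_real_primitive], and k is a primitive of |u'|^2. Continuity turns almost everywhere
    periodicity into periodicity. *)
Lemma H1loc_rep (R : realType) (b T : R) (u : R -> R[i]) : 0 < T -> H1loc u -> ae_periodic T u ->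
  exists a1 a2 k : R -> R,
  [/\ ae_eq_fun u (fun x => a1 x +i* a2 x), h1curve2 a1 a2 k,
      (forall x, a1 (x + T) = a1 x) /\ (forall x, a2 (x + T) = a2 x),
      mass T u = (2^-1 * \int[@lebesgue_measure R]_(x in `[0, T]) (absf a1 a2 x ^+ 2))%:E &
      energy b T u = ((k T - k 0) / 2 - b / 4 *
         \int[@lebesgue_measure R]_(x in `[0, T]) (absf a1 a2 x ^+ 4))%:E].
Proof.
move=> T0 [lu [v uv lv]] perT.
have FF := ae_filter_ringOfSetsType (@lebesgue_measure R).
have lu1 := Lploc2_Lploc1 lu; have lv1 := Lploc2_Lploc1 lv.
have /weak_derivativeE[_ wr wi] := uv.
have mr := Lploc1_Re lv1; have mi := Lploc1_Im lv1.
have [c1 e1] := weak_real_primitive (Lploc1_Re lu1) mr wr.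
have [c2 e2] := weak_real_primitive (Lploc1_Im lu1) mi wi.
set r1 := fun x => complex.Re (v x) in mr e1; set r2 := fun x => complex.Im (v x) in mi e2.
pose a1 x := c1 + prim r1 x; pose a2 x := c2 + prim r2 x.
pose k := prim (fun x => cmodulus (v x) ^+ 2).
have mk := Lploc_mlocint lv.
have H : h1curve2 a1 a2 k.
  have dE (c p q : R) : c + p - (c + q) = p - q by ring.
  move=> x y xy; rewrite /a1 /a2 !dE.
  apply: (cauchy_schwarz_prim mr mi mk) => // z; exact: cmodulus_sqr.
have H1 : h1curve a1 k by move=> x y xy; apply: le_trans (H _ _ xy); rewrite lerDl sqr_ge0.
have H2 : h1curve a2 k by move=> x y xy; apply: le_trans (H _ _ xy); rewrite lerDr sqr_ge0.
have ca1 := h1curve_cont H1; have ca2 := h1curve_cont H2.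
have ua : ae_eq_fun u (fun x => a1 x +i* a2 x).
  move: e1 e2; apply: filterS2 => x h1 h2; rewrite (Re_eta (u x)); congr (_ +i* _) => //.
have uaT := ae_shift T ua.
have cshift (f : R -> R) : continuous f -> continuous (fun x : R => f (x + T)).
  move=> cf x; apply: (@continuous_comp _ _ _ (fun x : R => x + T) f); last exact: cf.
  by apply: cvgD; [exact: cvg_id|exact: cvg_cst].
have per : {ae @lebesgue_measure R, forall x, a1 (x + T) +i* a2 (x + T) = a1 x +i* a2 x}.
  have h : {ae @lebesgue_measure R, forall x, u x = a1 (x + T) +i* a2 (x + T)}.
    by move: perT uaT; apply: filterS2 => x <-.
  by move: h ua; apply: filterS2 => x <-.
have mua : cmeasurable (fun x => a1 x +i* a2 x).
  by split; apply: continuous_measurable_fun.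
have lua p : Lploc p (fun x => a1 x +i* a2 x).
  apply: mlocint_Lploc => //; apply: mlocint_cont => x.
  have cs := h1curve_cont (h1curve_absf H).
  rewrite (_ : (fun x => _) = fun x => absf a1 a2 x ^+ p); first exact: contX.
  by apply/funext => y; rewrite cmodulus_sqrt.
exists a1, a2, k; split => //.
- by split; apply: (ae_eq_cont _ _ _) => //; try exact: cshift; move: per; apply: filterS => x [].
- rewrite /mass (ae_cmodulus_int _ _ lu.1 (lua 2) ua) EFinM.
  by congr (_ * _%:E)%E; apply: eq_Rintegral => x _; rewrite cmodulus_sqrt.
- have wu := wderiv_ae uv; rewrite /energy.
  have mw : cmeasurable (wderiv u).
    suff : weak_derivative u (wderiv u) by case => -[].
    by rewrite /wderiv; apply: (@xgetPex _ (fun=> 0) [set v | weak_derivative u v]); exists v.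
  rewrite (ae_cmodulus_int _ _ lu.1 (lua 4) ua) (ae_cmodulus_int _ _ mw lv wu).
  rewrite -!EFinM -EFinB /k prim_diff ?(ltW T0) //; last exact: mk.2.
  rewrite [in RHS]mulrC; congr (_ - _ * _)%:E; apply: eq_Rintegral => x _; by rewrite cmodulus_sqrt.
Qed.

(** * C^1 functions as members of H^1_loc *)

Lemma weak_real_C1 (R : realType) (w dw : R -> R) :
  (forall x : R, is_derive x 1 w (dw x)) -> continuous dw -> weak_real w dw.
Proof.
move=> hw cdw phi [sphi [A hA]]; have [dphi hphi sdphi] := smooth_isd sphi.
rewrite (isd_derive1 hphi).
have cphi := isd_all_cont hphi; have cdphi := smooth_cont sdphi; have cw := isd_all_cont hw.
have AB (x : R) : ~~ (- (`|A| + 1) <= x <= `|A| + 1) -> A < `|x|.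
  rewrite -ler_norml -ltNge => h; have := ler_norm A; lra.
have phi0 x : ~~ (- (`|A| + 1) <= x <= `|A| + 1) -> phi x = 0 by move=> /AB; exact: hA.
have dphi0 x : ~~ (- (`|A| + 1) <= x <= `|A| + 1) -> dphi x = 0.
  move=> /AB xA; have e0 : 0 < `|x| - A by rewrite subr_gt0.
  have d0 : is_derive x 1 phi 0.
    apply: (@isd_near R (fun=> 0)).
    exists (`|x| - A) => //= y; rewrite /= => hy; symmetry; apply: hA.
    by have := lerB_dist x y; lra.
  by have := @derive_val _ _ _ _ _ _ _ (hphi x); have := @derive_val _ _ _ _ _ _ _ d0; move=> -> .
rewrite (Rint_supp (a := - (`|A| + 1)) (c := `|A| + 1)); last by move=> x /dphi0 ->; rewrite mulr0.
rewrite (Rint_supp (a := - (`|A| + 1)) (c := `|A| + 1)); last by move=> x /phi0 ->; rewrite mulr0.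
have le : - (`|A| + 1) <= `|A| + 1 by have := normr_ge0 A; lra.
have cM (f g : R -> R) : continuous f -> continuous g -> continuous (fun x : R => f x * g x).
  by move=> cf cg x; apply: cvgM; [exact: cf|exact: cg].
have c1 := cM w dphi cw cdphi; have c2 := cM dw phi cdw cphi.
apply/eqP; rewrite -addr_eq0 -RintD //; apply/eqP.
have hF (x : R) : is_derive x 1 (fun x => w x * phi x) (w x * dphi x + dw x * phi x).
  by apply: isd_eq (isdM (hw x) (hphi x)) _; ring.
have cs : continuous (fun x : R => w x * dphi x + dw x * phi x).
  by move=> x; apply: cvgD; [exact: c1|exact: c2].
rewrite (FTC le cs hF).
have AA : A < `|A| + 1 by have := ler_norm A; lra.
have p1 : 0 <= `|A| + 1 by have := normr_ge0 A; lra.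
rewrite !hA ?mulr0 ?subrr // ?normrN ger0_norm //.
Qed.

Lemma Lploc_cont (R : realType) (p : nat) (a1 a2 : R -> R) : continuous a1 -> continuous a2 ->
  Lploc p (fun x => a1 x +i* a2 x).
Proof.
move=> c1 c2; apply: mlocint_Lploc.
  by split; apply: continuous_measurable_fun.
apply: mlocint_cont; rewrite (_ : (fun x => _) = fun x => Num.sqrt (a1 x ^+ 2 + a2 x ^+ 2) ^+ p).
  apply: contX => x; apply: (@continuous_comp _ _ _ (fun x : R => a1 x ^+ 2 + a2 x ^+ 2) Num.sqrt).
    by apply: cvgD; [exact: (contX c1)|exact: (contX c2)].
  exact: sqrt_continuous.
by apply/funext => y; rewrite cmodulus_sqrt.
Qed.

Lemma Rint_ae (R : realType) (f g : R -> R) (D : set R) : measurable D ->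
  measurable_fun setT f -> measurable_fun setT g ->
  {ae @lebesgue_measure R, forall x, f x = g x} ->
  \int[@lebesgue_measure R]_(x in D) f x = \int[@lebesgue_measure R]_(x in D) g x.
Proof.
move=> mD mf mg fg; rewrite /Rintegral; congr fine; apply: ae_eq_integral => //.
- by apply/measurable_EFinP; exact: (measurable_funS measurableT).
- by apply/measurable_EFinP; exact: (measurable_funS measurableT).
- have FF := ae_filter_ringOfSetsType (@lebesgue_measure R).
  by move: fg; apply: filterS => x -> _.
Qed.

Lemma weak_derivative_C1 (R : realType) (u : R -> R[i]) (a1 a2 d1 d2 : R -> R) :
  cmeasurable u -> ae_eq_fun u (fun x => a1 x +i* a2 x) ->
  (forall x : R, is_derive x 1 a1 (d1 x)) -> (forall x : R, is_derive x 1 a2 (d2 x)) ->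
  continuous d1 -> continuous d2 ->
  weak_derivative u (fun x => d1 x +i* d2 x).
Proof.
move=> mu ua h1 h2 c1 c2; apply/weak_derivativeE; split; first exact: Lploc_cont.
  move=> phi tp; rewrite -(weak_real_C1 h1 c1 tp) /=.
  have mphi : measurable_fun setT (derive1 phi).
    have [dphi hphi sdphi] := smooth_isd tp.1; rewrite (isd_derive1 hphi).
    by apply: continuous_measurable_fun; exact: smooth_cont.
  have FF := ae_filter_ringOfSetsType (@lebesgue_measure R).
  apply: Rint_ae => //.
  - by apply: measurable_funM => //; exact: mu.1.
  - by apply: measurable_funM => //; apply: continuous_measurable_fun; exact: isd_all_cont h1.
  - by move: ua; apply: filterS => x ->.
move=> phi tp; rewrite -(weak_real_C1 h2 c2 tp) /=.
have mphi : measurable_fun setT (derive1 phi).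
  have [dphi hphi sdphi] := smooth_isd tp.1; rewrite (isd_derive1 hphi).
  by apply: continuous_measurable_fun; exact: smooth_cont.
have FF := ae_filter_ringOfSetsType (@lebesgue_measure R).
apply: Rint_ae => //.
- by apply: measurable_funM => //; exact: mu.2.
- by apply: measurable_funM => //; apply: continuous_measurable_fun; exact: isd_all_cont h2.
- by move: ua; apply: filterS => x ->.
Qed.

Lemma real_C1_H1loc (R : realType) (b T : R) (w dw : R -> R) :
  (forall x : R, is_derive x 1 w (dw x)) -> continuous dw -> (forall x, w (x + T) = w x) ->
  let u : R -> R[i] := fun x => (w x)%:C in
  [/\ H1loc u, ae_periodic T u,
      mass T u = (2^-1 * \int[@lebesgue_measure R]_(x in `[0, T]) (w x ^+ 2))%:E &
      energy b T u = (2^-1 * \int[@lebesgue_measure R]_(x in `[0, T]) (dw x ^+ 2) -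
         b / 4 * \int[@lebesgue_measure R]_(x in `[0, T]) (w x ^+ 4))%:E].
Proof.
move=> hw cdw perw u; have cw := isd_all_cont hw.
have c0 : continuous (fun _ : R => 0 : R) by move=> x; exact: cvg_cst.
have h0 (x : R) : is_derive x 1 (fun _ : R => 0 : R) 0 by exact: isd_cst.
have lp p : Lploc p u by exact: Lploc_cont.
have uu (f : R -> R[i]) : ae_eq_fun f f by apply: aeW.
have du : weak_derivative u (fun x => (dw x)%:C).
  by apply: (weak_derivative_C1 (lp 1%N).1 (uu u) hw h0 cdw c0).
have lp' p : Lploc p (fun x => (dw x)%:C) by exact: Lploc_cont.
have H : H1loc u by split => //; exists (fun x => (dw x)%:C).
have cmE (x : R) : cmodulus x%:C = `|x| by rewrite cmodulus_sqrt /= expr0n /= addr0 sqrtr_sqr.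
have e2 (x : R) : `|x| ^+ 2 = x ^+ 2 by rewrite real_normK ?num_real.
split => //.
- by apply: aeW => x; rewrite /u perw.
- rewrite /mass (ae_cmodulus_int _ _ (lp 2%N).1 (lp 2%N) (uu u)) -EFinM.
  by congr (_ * _)%:E; apply: eq_Rintegral => x _; rewrite cmE e2.
- have mw : cmeasurable (wderiv u).
    suff : weak_derivative u (wderiv u) by case => -[].
    by rewrite /wderiv; apply: (@xgetPex _ (fun=> 0) [set v | weak_derivative u v]); exists (fun x => (dw x)%:C).
  rewrite /energy (ae_cmodulus_int _ _ (lp 4%N).1 (lp 4%N) (uu u)).
  rewrite (ae_cmodulus_int _ _ mw (lp' 2%N) (wderiv_ae du)) -!EFinM -EFinB.
  congr (_ * _ - _ * _)%:E; apply: eq_Rintegral => x _; first by rewrite cmE e2.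
  by rewrite cmE -[4%N]/(2 * 2)%N !exprM e2.
Qed.

(** With a constant phase, u times the conjugate of u_x equals w w' almost everywhere, which is
    real. *)
Lemma momentum_real_phase (R : realType) (T t : R) (u : R -> R[i]) (w dw : R -> R) :
  (forall x : R, is_derive x 1 w (dw x)) -> continuous dw -> cmeasurable u ->
  ae_eq_fun u (fun x => (cos t * w x) +i* (sin t * w x)) -> momentum T u = 0.
Proof.
move=> hw cdw mu ua.
have hc (c x : R) : is_derive x 1 (fun x => c * w x) (c * dw x) by exact: isdZ.
have cc (c : R) : continuous (fun x => c * dw x).
  by move=> x; apply: cvgM; [exact: cvg_cst|exact: cdw].
have du := weak_derivative_C1 mu ua (hc (cos t)) (hc (sin t)) (cc _) (cc _).
have mw : cmeasurable (wderiv u).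
  suff : weak_derivative u (wderiv u) by case => -[].
  rewrite /wderiv; apply: (@xgetPex _ (fun=> 0) [set v | weak_derivative u v]).
  by exists (fun x => (cos t * dw x) +i* (sin t * dw x)).
have FF := ae_filter_ringOfSetsType (@lebesgue_measure R).
rewrite /momentum /cintegral /= (@Rint_ae _ _ (fun=> 0)) //.
- by rewrite /Rintegral integral0 mulr0.
- rewrite (_ : (fun x => _) = fun x => complex.Im (u x) * complex.Re (wderiv u x) -
      complex.Re (u x) * complex.Im (wderiv u x)).
    by apply: measurable_funB; apply: measurable_funM; try exact: mu.1; try exact: mu.2; try exact: mw.1; exact: mw.2.
  by apply/funext => x; case: (u x) (wderiv u x) => [a c] [a' c'] /=; ring.
- by move: ua (wderiv_ae du); apply: filterS2 => x -> -> /=; ring.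
Qed.

(** * Ground states *)

(** The constant and the dn wave meet this one specification, from which the claims on minimizers,
    momentum and infima are derived once for both. *)
Definition ground_state (R : realType) (b T m e : R) (w : R -> R) : Prop :=
  [/\ exists2 dw, forall x : R, is_derive x 1 w (dw x) & continuous dw,
      feasibleP T m (fun x => (w x)%:C),
      energy b T (fun x => (w x)%:C) = e%:E,
      forall u, feasibleP T m u -> (e%:E <= energy b T u)%E &
      forall u, feasibleP T m u -> (energy b T u <= e%:E)%E ->
        exists t c, ae_eq_fun u (fun x => (cos t * w (x - c)) +i* (sin t * w (x - c)))].

Section GroundState.
Variables (R : realType) (b T m e : R) (w : R -> R).
Hypothesis gw : ground_state b T m e w.
Let W : R -> R[i] := fun x => (w x)%:C.

Lemma ground_min : minimizerP b T m W.
Proof. by case: gw => _ fW eW lb _; split => // u fu; rewrite eW; exact: lb. Qed.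

Lemma minimizer_shape (u : R -> R[i]) : minimizerP b T m u ->
  exists t c, ae_eq_fun u (fun x => (cos t * w (x - c)) +i* (sin t * w (x - c))).
Proof.
case: gw => _ fW eW lb eq [fu mu]; apply: eq => //.
by rewrite -eW; exact: mu.
Qed.

Lemma minimizer_phase_translation (u : R -> R[i]) : minimizerP b T m u ->
  eq_up_to_phase_translation u W.
Proof.
move=> /minimizer_shape[t [c h]]; exists t, (- c).
rewrite (_ : (fun x => _) = fun x => (cos t * w (x - c)) +i* (sin t * w (x - c))) //.
by apply/funext => x; rewrite /expi /W /=; apply/eqP; rewrite eq_complex /= !mulr0 subr0 add0r !eqxx.
Qed.

Lemma minimizer_momentum (u : R -> R[i]) : minimizerP b T m u -> momentum T u = 0.
Proof.
move=> mu; have [t [c h]] := minimizer_shape mu.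
case: gw => -[dw hw cdw] _ _ _ _; case: mu => -[[lu _] _ _] _.
have hlin (x : R) : is_derive x 1 (fun x : R => x - c) 1.
  by apply: isd_eq (isdB (isd_id x) (isd_cst c x)) _; ring.
apply: (@momentum_real_phase _ _ t _ (fun x => w (x - c)) (fun x => dw (x - c))) => //.
- move=> x; apply: isd_eq (@isd_comp _ w (fun x : R => x - c) _ _ _ (hw (x - c)) (hlin x)) _.
  by rewrite mulr1.
- move=> x; apply: (@continuous_comp _ _ _ (fun x : R => x - c) dw); last exact: cdw.
  exact: isd_all_cont hlin _.
- exact: lu.1.
Qed.

(** Every minimizer of (P) has zero momentum, so the ground state also competes in (P0) and both
    problems have the same minimum. *)
Lemma minimizerP_P0 (u : R -> R[i]) : minimizerP b T m u <-> minimizerP0 b T m u.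
Proof.
have sub v : feasibleP0 T m v -> feasibleP T m v by case.
have W0 := minimizer_momentum ground_min.
case: (gw) => _ fW eW lb _; split => [mu|[fu mu]].
  have u0 := minimizer_momentum mu; case: mu => -[h1 h2 h3] mu.
  by split; [split|move=> v /sub; exact: mu].
split; first exact: sub.
move=> v fv; apply: le_trans (lb v fv); rewrite -eW; apply: mu.
by case: fW => h1 h2 h3; split.
Qed.

Lemma ground_inf : ereal_inf (energy b T @` feasibleP T m) = e%:E /\
  ereal_inf (energy b T @` feasibleP0 T m) = e%:E.
Proof.
have W0 := minimizer_momentum ground_min.
case: (gw) => _ fW eW lb _; split; apply/eqP; rewrite eq_le; apply/andP; split.
- by apply: ereal_inf_lbound; exists W.
- by apply: le_ereal_inf_tmp => _ [u fu <-]; exact: lb.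
- by apply: ereal_inf_lbound; exists W => //; case: fW => h1 h2 h3; split.
- by apply: le_ereal_inf_tmp => _ [u [h1 h2 h3 _] <-]; apply: lb; split.
Qed.

End GroundState.

Lemma sqrtr_const_int (R : realType) (T a : R) (n : nat) : 0 < T ->
  \int[@lebesgue_measure R]_(x in `[0, T]) (a ^+ n) = a ^+ n * T.
Proof. by move=> T0; rewrite RintC ?(ltW T0) // subr0. Qed.

Lemma ground_state_const (R : realType) (b T m : R) : 0 < b -> 0 < T -> 0 < m ->
  m <= pi ^+ 2 / (b * T) -> ground_state b T m (- (b * m ^+ 2 / T)) (fun=> Num.sqrt (2 * m / T)).
Proof.
move=> b0 T0 m0 hm; set a := Num.sqrt (2 * m / T).
have a2 : a ^+ 2 = 2 * m / T by rewrite sqr_sqrtr // divr_ge0 ?mulr_ge0 ?ltW.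
have T1 := lt0r_neq0 T0.
have hd (x : R) : is_derive x 1 (fun _ : R => a) 0 by exact: isd_cst.
have c0 : continuous (fun _ : R => 0 : R) by move=> x; exact: cvg_cst.
have [h1 h2 h3 h4] := real_C1_H1loc b hd c0 (T := T) (fun=> erefl).
have hs : b * m / 2 * T <= pi ^+ 2 / 2.
  by move: hm; rewrite ler_pdivlMr ?mulr_gt0 //; lra.
have rep u : feasibleP T m u -> exists a1 a2 k : R -> R,
   [/\ ae_eq_fun u (fun x => a1 x +i* a2 x), h1curve2 a1 a2 k,
      (forall x, a1 (x + T) = a1 x) /\ (forall x, a2 (x + T) = a2 x),
      \int[@lebesgue_measure R]_(x in `[0, T]) (absf a1 a2 x ^+ 2) = 2 * m &
      energy b T u = ((k T - k 0) / 2 - b / 4 *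
         \int[@lebesgue_measure R]_(x in `[0, T]) (absf a1 a2 x ^+ 4))%:E].
  move=> [hu pu]; have [a1 [a2' [k [r1 r2 r3 -> r5]]]] := H1loc_rep b T0 hu pu.
  by move=> -[hM]; exists a1, a2', k; split => //; rewrite -hM; field.
split.
- by exists (fun=> 0).
- split => //; rewrite h3 sqrtr_const_int // a2; congr _%:E; field; exact: lt0r_neq0.
- rewrite h4 sqrtr_const_int // expr0n /= sqrtr_const_int // (exprM a 2 2) a2.
  by congr _%:E; rewrite mul0r; field.
- move=> u /rep[a1 [a2' [k [r1 r2 [r3 r3'] r4 ->]]]]; rewrite lee_fin.
  by have [] := curve_energy_small b0 m0 T0 r2 r3 r3' r4 hs.
- move=> u /rep[a1 [a2' [k [r1 r2 [r3 r3'] r4 ->]]]]; rewrite lee_fin => hE.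
  have [_ /(_ hE)[t ht]] := curve_energy_small b0 m0 T0 r2 r3 r3' r4 hs.
  exists t, 0; move: r1; rewrite (_ : (fun x => a1 x +i* a2' x) = fun x => (cos t * a) +i* (sin t * a)) //.
  by apply/funext => x; have [-> ->] := ht x.
Qed.

Lemma quarter_pi_sqr (R : realType) (b m T : R) : 0 < b -> 0 < T ->
  (pi ^+ 2 / (b * T) < m) = ((pi / 2) ^+ 2 < b * m * T / 4).
Proof.
move=> b0 T0; rewrite ltr_pdivrMr ?mulr_gt0 //.
by apply/idP/idP => h; lra.
Qed.

Section DnState.
Variables (R : realType) (b m T kap : R).
Hypotheses (b0 : 0 < b) (m0 : 0 < m) (T0 : 0 < T) (k01 : 0 < kap < 1).
Hypothesis hKE : Kc kap * Ec kap = b * m * T / 4.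
Let s := Num.sqrt (b / 2).
(** The critical value is Q = M / E with M = b m / 2: the amplitude is Q / s and, as [dn_wave]
    requires, the scale [bet] is 1 / Q. *)
Let q := b * m / 2 / Ec kap / s.
Let bet := Ec kap / (b * m / 2).

Lemma dn_amplitude_gt0 : 0 < q.
Proof.
have /andP[_ k1] := k01.
by rewrite !divr_gt0 ?Ec_gt0 ?mulr_gt0 // sqrtr_gt0 divr_gt0.
Qed.

Lemma dn_scale_gt0 : 0 < bet.
Proof. by have /andP[_ k1] := k01; rewrite !divr_gt0 ?Ec_gt0 ?mulr_gt0. Qed.

(** For bet = 2 E / (b m), fitting exactly one period into T is the equation 4 K E = b m T. *)
Lemma dn_scale_period : 2 * Kc kap * bet = T.
Proof.
have -> : 2 * Kc kap * bet = 2 * (Kc kap * Ec kap) / (b * m / 2) by rewrite /bet; ring.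
by rewrite hKE; field; rewrite !lt0r_neq0.
Qed.

Lemma ground_state_dn : exists2 e, e < - (b * m ^+ 2 / T) &
  ground_state b T m e (fun x => q * dnf kap (x / bet)).
Proof.
have /andP[k0 k1] := k01; have k01' : 0 <= kap < 1 by rewrite k1 ltW.
have q0 := dn_amplitude_gt0; have bet0 := dn_scale_gt0; have TE := dn_scale_period.
have E0 := Ec_gt0 k1; have b2 : 0 < b / 2 by rewrite divr_gt0.
have s0 : 0 < s by rewrite sqrtr_gt0.
have sE : s ^+ 2 = b / 2 by rewrite sqr_sqrtr // ltW.
have s1 := lt0r_neq0 s0; have E1 := lt0r_neq0 E0; have b1 := lt0r_neq0 b0; have m1 := lt0r_neq0 m0.
have T1 := lt0r_neq0 T0.
have hQ : s * q = b * m / 2 / Ec kap by rewrite /q; field; rewrite s1 E1.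
have betE : bet = (s * q)^-1 by rewrite hQ invf_div.
pose p := q * Num.sqrt (1 - kap).
have W := dn_wave b0 q0 bet0 k01 (esym TE) betE (erefl p).
set w := fun x => q * dnf kap (x / bet) in W *; set dw := fun x => _ in W.
have [hw cdw perw _ _ _ _ _ weq] := W; have cw := isd_all_cont hw.
have [h1 h2 h3 h4] := real_C1_H1loc b hw cdw perw.
pose M := b * m / 2; have M0 : 0 < M by rewrite divr_gt0 // mulr_gt0.
have hKE' : 2 * (Kc kap * Ec kap) = b * m / 2 * T by rewrite hKE; field.
have S2 : \int[@lebesgue_measure R]_(x in `[0, T]) (w x ^+ 2) = 2 * m.
  rewrite -[in LHS]TE int_dn_sqr // betE.
  have -> : q ^+ 2 / (s * q) * (2 * Ec kap) = 2 * (s * q) * Ec kap / s ^+ 2.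
    by field; rewrite s1 lt0r_neq0.
  by rewrite hQ sE; field; rewrite b1 E1.
have D2 : \int[@lebesgue_measure R]_(x in `[0, T]) (dw x ^+ 2) = 2 * (s * q ^+ 3 * jc kap).
  rewrite -[in LHS]TE int_ddn_sqr // betE invrK; ring.
pose e := 2 / b * gfun M T kap (s * q).
have rep u : feasibleP T m u -> exists a1 a2 k : R -> R,
   [/\ ae_eq_fun u (fun x => a1 x +i* a2 x), h1curve2 a1 a2 k,
      (forall x, a1 (x + T) = a1 x) /\ (forall x, a2 (x + T) = a2 x),
      \int[@lebesgue_measure R]_(x in `[0, T]) (absf a1 a2 x ^+ 2) = 2 * m &
      energy b T u = ((k T - k 0) / 2 - b / 4 *
         \int[@lebesgue_measure R]_(x in `[0, T]) (absf a1 a2 x ^+ 4))%:E].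
  move=> [hu pu]; have [a1 [a2' [k [r1 r2 r3 -> r5]]]] := H1loc_rep b T0 hu pu.
  by move=> -[hM]; exists a1, a2', k; split => //; rewrite -hM; field.
exists e.
  rewrite /e hQ; have := gfun_large_lt M0 T0 k01 hKE'.
  rewrite -(@ltr_pM2l _ (2 / b)) ?divr_gt0 // => h; apply: lt_le_trans h _.
  by rewrite /M le_eqVlt; apply/orP; left; apply/eqP; field; rewrite b1 T1.
split.
- by exists dw.
- by split => //; rewrite h3 S2; congr _%:E; field.
- rewrite h4; congr _%:E; apply/eqP; rewrite -subr_eq0; apply/eqP.
  (* Along the wave the first integral identifies the potential term with the kinetic one, and by
     [D2] their half-sum is 2 s q^3 jc, twice the oscillation of [Phif]; the deficit in
     [energy_action] is zero. *)
  have := @energy_action R b m T p q _ (\int[@lebesgue_measure R]_(x in `[0, T]) (w x ^+ 4))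
    (\int[@lebesgue_measure R]_(x in `[0, T]) (dw x ^+ 2)) kap b0 q0 k01' (erefl p) S2.
  have := @int_pot2 R b p q T w (ltW T0) cw.
  have -> : \int[@lebesgue_measure R]_(x in `[0, T]) pot2 b p q (w x) =
      \int[@lebesgue_measure R]_(x in `[0, T]) (dw x ^+ 2).
    by apply: eq_Rintegral => x _; rewrite weq.
  by rewrite /e -/s -/M D2 => {1}-> ; lra.
- move=> u /rep[a1 [a2' [k [r1 r2 [r3 r3'] r4 ->]]]]; rewrite lee_fin.
  by have [] := curve_energy_large b0 m0 T0 r2 r3 r3' r4 k01 hKE' hQ (erefl p) W.
- move=> u /rep[a1 [a2' [k [r1 r2 [r3 r3'] r4 ->]]]]; rewrite lee_fin => hE.
  have [_ /(_ hE)[t [c ht]]] := curve_energy_large b0 m0 T0 r2 r3 r3' r4 k01 hKE' hQ (erefl p) W.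
  exists t, c; move: r1; rewrite (_ : (fun x => a1 x +i* a2' x) = fun x => (cos t * w (x - c)) +i* (sin t * w (x - c))) //.
  by apply/funext => x; have [-> ->] := ht x.
Qed.

End DnState.

(** * Fundamental period and uniqueness of the dn parameters *)

Lemma real_phase_eq (R : realType) (t c : R) (w w' : R -> R) : continuous w -> continuous w' ->
  (forall x, 0 < w x) -> (forall x, 0 < w' x) ->
  ae_eq_fun (fun x => (w' x)%:C) (fun x => (cos t * w (x - c)) +i* (sin t * w (x - c))) ->
  forall x, w' x = w (x - c).
Proof.
move=> cw cw' w0 w'0 h; have FF := ae_filter_ringOfSetsType (@lebesgue_measure R).
have cwc (a : R) : continuous (fun x : R => a * w (x - c)).
  move=> x; apply: cvgM; first exact: cvg_cst.
  apply: (@continuous_comp _ _ _ (fun x : R => x - c) w); last exact: cw.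
  by apply: cvgB; [exact: cvg_id|exact: cvg_cst].
have h1 : w' =1 (fun x => cos t * w (x - c)).
  by apply: ae_eq_cont => //; move: h; apply: filterS => x [].
(* Imaginary parts: positivity of w gives sin t = 0, and positivity of w' then excludes cos t =
   -1. *)
have h2 : (fun _ : R => 0) =1 (fun x => sin t * w (x - c)).
  by apply: ae_eq_cont => //; [move=> x; exact: cvg_cst|move: h; apply: filterS => x []].
have s0 : sin t = 0.
  by have /esym/eqP := h2 0; rewrite mulf_eq0 (gt_eqF (w0 _)) orbF => /eqP.
have ct0 : 0 < cos t by have := w'0 0; rewrite h1 pmulr_lgt0.
have c1 : cos t = 1.
  have := cos2Dsin2 t; rewrite s0 expr0n /= addr0 => /eqP.
  by rewrite sqrf_eq1 => /orP[/eqP //|/eqP e]; move: ct0; rewrite e ltr0N1.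
by move=> x; rewrite h1 c1 mul1r.
Qed.

Lemma dnf_period_ge (R : realType) (k p : R) : 0 < k < 1 -> 0 < p -> dnf k p = 1 ->
  2 * Kc k <= p.
Proof.
move=> k01 p0 h; rewrite leNgt; apply/negP => pK.
have : 0 < p < 2 * Kc k by rewrite p0.
by move=> /(dnf_lt1 k01); rewrite h ltxx.
Qed.

Lemma dn_fundamental_period (R : realType) (q k bet : R) : 0 < q -> 0 < bet -> 0 < k < 1 ->
  fundamental_period (fun x => (q * dnf k (x / bet))%:C) (2 * Kc k * bet).
Proof.
move=> q0 bet0 k01; have /andP[k0 k1] := k01; have k01' : 0 <= k < 1 by rewrite k1 ltW.
have b1 := lt0r_neq0 bet0.
split => [|x|S S0 hS]; first by rewrite !mulr_gt0 // Kc_gt0.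
  by rewrite mulrDl mulfK // dnf_per.
have /= := hS 0; rewrite add0r mul0r dnf0 // => -[/(mulfI (lt0r_neq0 q0)) h].
by rewrite -ler_pdivlMr //; apply: dnf_period_ge => //; rewrite divr_gt0.
Qed.

(** The maximum of the profile gives the amplitude, its minimum then gives k, and the distance
    between consecutive maxima gives the scale. *)
Lemma dn_parameters_unique (R : realType) (q q' bet bet' k k' c : R) :
  0 < q -> 0 < q' -> 0 < bet -> 0 < bet' -> 0 < k < 1 -> 0 < k' < 1 ->
  (forall x, q' * dnf k' (x / bet') = q * dnf k ((x - c) / bet)) ->
  [/\ q' = q, bet' = bet & k' = k].
Proof.
move=> q0 q'0 bet0 bet'0 k01 k'01 h.
have /andP[k0 k1] := k01; have h01 : 0 <= k < 1 by rewrite k1 ltW.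
have /andP[k'0 k'1] := k'01; have h'01 : 0 <= k' < 1 by rewrite k'1 ltW.
have b1 := lt0r_neq0 bet0; have b'1 := lt0r_neq0 bet'0.
have eq : q' = q.
  apply/eqP; rewrite eq_le; apply/andP; split.
    by have := h 0; rewrite mul0r dnf0 // mulr1 => ->; rewrite ger_pMr // dnf_le1.
  by have := h c; rewrite subrr mul0r dnf0 // mulr1 => <-; rewrite ger_pMr // dnf_le1.
have hd x : dnf k' (x / bet') = dnf k ((x - c) / bet).
  by apply: (mulfI (lt0r_neq0 q0)); rewrite -h eq.
have es : Num.sqrt (1 - k') = Num.sqrt (1 - k).
  apply/eqP; rewrite eq_le; apply/andP; split.
    have := hd (Kc k * bet + c); rewrite addrK mulfK // dnfK // => <-; exact: dnf_ge.
  have := hd (Kc k' * bet'); rewrite mulfK // dnfK // => ->; exact: dnf_ge.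
have ek : k' = k.
  have := congr1 (fun x => x ^+ 2) es; rewrite !sqr_sqrtr ?subr_ge0 ?ltW //.
  by move/(addrI 1)/oppr_inj.
split => //; subst k'.
have K0 := Kc_gt0 k1.
have p1 : dnf k (2 * Kc k * bet' / bet) = 1.
  have -> : 2 * Kc k * bet' / bet = ((2 * Kc k * bet' + c) - c) / bet by rewrite addrK.
  rewrite -hd mulrDl mulfK // addrC dnf_per // hd subrr mul0r dnf0 //.
have p2 : dnf k (2 * Kc k * bet / bet') = 1.
  rewrite hd addrC mulrDl mulfK // dnf_per // mulNr.
  by have := hd 0; rewrite mul0r sub0r mulNr dnf0.
have K2 : 0 < 2 * Kc k by rewrite mulr_gt0.
apply/eqP; rewrite eq_le; apply/andP; split.
  have := dnf_period_ge k01 _ p2; rewrite !divr_gt0 ?mulr_gt0 // => /(_ isT).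
  by rewrite ler_pdivlMr // ler_pM2l.
have := dnf_period_ge k01 _ p1; rewrite !divr_gt0 ?mulr_gt0 // => /(_ isT).
by rewrite ler_pdivlMr // ler_pM2l.
Qed.

Lemma dn_rescaledE (R : realType) (q bet k : R) : 0 <= k ->
  dn_rescaled q^-1 bet (Num.sqrt k) = fun x => (q * dnf k (x / bet))%:C.
Proof.
by move=> k0; apply/funext => x; rewrite /dn_rescaled invrK dnE sqr_sqrtr.
Qed.

Lemma sqrt01 (R : realType) (k : R) : 0 < k < 1 -> 0 < Num.sqrt k < 1.
Proof.
move=> /andP[k0 k1]; rewrite sqrtr_gt0 k0 /=.
by rewrite -[ltRHS]sqrtr1 ltr_sqrt.
Qed.

Lemma KE_inj_lt (R : realType) (k l : R) : 0 < k < 1 -> 0 < l < 1 ->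
  Kc k * Ec k < Kc l * Ec l -> k < l.
Proof.
move=> /andP[k0 k1] /andP[l0 l1] h; rewrite ltNge le_eqVlt; apply/negP => /orP[/eqP e|lk].
  by move: h; rewrite e ltxx.
by have := KE_incr (ltW l0) lk k1; rewrite ltNge ltW.
Qed.

Lemma KE_gt (R : realType) (k : R) : 0 < k < 1 -> (pi / 2) ^+ 2 < Kc k * Ec k.
Proof.
by move=> /andP[k0 k1]; have := KE_incr (lexx 0) k0 k1; rewrite Kc0 Ec0 -expr2.
Qed.

Unset Implicit Arguments.
Set Strict Implicit.

Theorem proposition3p2 (R : realType) :
  (forall b T : R, 0 < b -> 0 < T ->
    [/\ (* (i) *)
        forall m : R, 0 < m ->
          (forall u : R -> R[i], minimizerP b T m u <-> minimizerP0 b T m u) /\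
          (exists e : R,
            [/\ e < 0,
                ereal_inf (energy b T @` feasibleP T m) = e%:E &
                ereal_inf (energy b T @` feasibleP0 T m) = e%:E]),
        (* (ii) *)
        forall m : R, 0 < m -> m <= pi ^+ 2 / (b * T) ->
          let umin : R -> R[i] := fun=> (Num.sqrt (2 * m / T))%:C in
          minimizerP b T m umin /\
          (forall u : R -> R[i], minimizerP b T m u -> eq_up_to_phase u umin) &
        (* (iii) *)
        exists alpha beta k : R -> R,
          [/\ forall m : R, pi ^+ 2 / (b * T) < m ->
                let w := dn_rescaled (alpha m) (beta m) (k m) in
                [/\ [/\ 0 < alpha m, 0 < beta m & 0 < k m < 1],
                    minimizerP b T m w,
                    forall u : R -> R[i], minimizerP b T m u ->
                      eq_up_to_phase_translation u w,
                    forall alpha' beta' k' : R,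
                      0 < alpha' -> 0 < beta' -> 0 < k' < 1 ->
                      minimizerP b T m (dn_rescaled alpha' beta' k') ->
                      [/\ alpha' = alpha m, beta' = beta m & k' = k m] &
                    fundamental_period w T],
              set_bij `]pi ^+ 2 / (b * T), +oo[ `]0, 1[ k &
              forall m m' : R, pi ^+ 2 / (b * T) < m -> m < m' -> k m < k m']]) /\
  (* (iv) *)
  (forall k : R, 0 < k < 1 ->
    let T := 2 * ellipticK k in
    let w : R -> R[i] := fun x => (dn x k)%:C in
    [/\ mass T w = (ellipticE k)%:E,
        minimizerP 2 T (ellipticE k) w &
        forall u : R -> R[i], minimizerP 2 T (ellipticE k) u ->
          eq_up_to_phase_translation u w]).
Proof.
split=> [b T b0 T0|k k01 T w]; last first.
  rewrite /w {w} /T {T} ellipticKE ellipticEE.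
  have kk := sqr01 k01; have /andP[kk0 kk1] := kk.
  have E0 := Ec_gt0 kk1; have K0 := Kc_gt0 kk1.
  (* The equation 4 K E = b m T for b = 2, m = E and T = 2 K. *)
  have hKE : Kc (k ^+ 2) * Ec (k ^+ 2) = 2 * Ec (k ^+ 2) * (2 * Kc (k ^+ 2)) / 4 by field.
  have K2 : 0 < 2 * Kc (k ^+ 2) by rewrite mulr_gt0.
  have [e _ gs] := ground_state_dn (ltr0n _ 2) E0 K2 kk hKE.
  (* For these values M / E = 1, so amplitude and scale are both 1. *)
  have wE : (fun x => 2 * Ec (k ^+ 2) / 2 / Ec (k ^+ 2) / Num.sqrt (2 / 2) *
      dnf (k ^+ 2) (x / (Ec (k ^+ 2) / (2 * Ec (k ^+ 2) / 2)))) = (fun x => dn x k).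
    apply/funext => x; rewrite dnE divff ?pnatr_eq0 // sqrtr1 invr1 mulr1.
    rewrite (mulrC 2) mulfK ?pnatr_eq0 // divff ?(lt0r_neq0 E0) //.
    by rewrite invr1 mulr1 mul1r.
  rewrite wE in gs; split.
  - by case: gs => _ [].
  - exact: ground_min gs.
  - by move=> u; exact: minimizer_phase_translation gs u.
have E' m : exists k, pi ^+ 2 / (b * T) < m -> 0 < k < 1 /\ Kc k * Ec k = b * m * T / 4.
  have [h|h] := ltP (pi ^+ 2 / (b * T)) m; last by exists 0.
  by move: h; rewrite quarter_pi_sqr // => /KE_surj[k k1 k2]; exists k.
have /choice[kf hkf] := E'.
have m_gt0 m : pi ^+ 2 / (b * T) < m -> 0 < m.
  by apply: le_lt_trans; rewrite divr_ge0 ?sqr_ge0 // mulr_ge0 // ltW.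
have kf01 m : pi ^+ 2 / (b * T) < m -> 0 < kf m < 1 by move=> /hkf[].
have kfKE m : pi ^+ 2 / (b * T) < m -> Kc (kf m) * Ec (kf m) = b * m * T / 4 by move=> /hkf[].
have kincr m m' : pi ^+ 2 / (b * T) < m -> m < m' -> Num.sqrt (kf m) < Num.sqrt (kf m').
  move=> hm mm'; have hm' := lt_trans hm mm'.
  have /andP[kp _] := kf01 _ hm'.
  rewrite ltr_sqrt //; apply: KE_inj_lt; [exact: kf01|exact: kf01|].
  by rewrite !kfKE // ltr_pM2r ?invr_gt0 // ltr_pM2r // ltr_pM2l.
split.
- move=> m m0.
  have [hm|hm] := leP m (pi ^+ 2 / (b * T)).
    have gs := ground_state_const b0 T0 m0 hm.
    split; first exact: minimizerP_P0 gs.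
    have [i1 i2] := ground_inf gs; exists (- (b * m ^+ 2 / T)); split => //.
    by rewrite oppr_lt0 divr_gt0 // mulr_gt0 // exprn_gt0.
  have [e e0 gs] := ground_state_dn b0 m0 T0 (kf01 _ hm) (kfKE _ hm).
  split; first exact: minimizerP_P0 gs.
  have [i1 i2] := ground_inf gs; exists e; split => //; apply: lt_trans e0 _.
  by rewrite oppr_lt0 divr_gt0 // mulr_gt0 // exprn_gt0.
- move=> m m0 hm umin; have gs := ground_state_const b0 T0 m0 hm.
  split; first exact: ground_min gs.
  (* The translation y has no effect on a constant. *)
  by move=> u /(minimizer_phase_translation gs)[t [y h]]; exists t.
pose q m := b * m / 2 / Ec (kf m) / Num.sqrt (b / 2).
pose bet m := Ec (kf m) / (b * m / 2).
(* [dn_rescaled] divides by alpha and takes the modulus, hence the inverse of the amplitude and the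
   square root of the parameter. *)
exists (fun m => (q m)^-1), bet, (fun m => Num.sqrt (kf m)); split => //.
  move=> m hm w; have m0 := m_gt0 m hm; have k01 := kf01 _ hm; have /andP[k0 k1] := k01.
  have [e _ gs] := ground_state_dn b0 m0 T0 k01 (kfKE _ hm).
  have q0 : 0 < q m := dn_amplitude_gt0 b0 m0 k01.
  have bet0 : 0 < bet m := dn_scale_gt0 b0 m0 k01.
  have wE : w = fun x => (q m * dnf (kf m) (x / bet m))%:C by rewrite /w dn_rescaledE // ltW.
  have cdn (k a c : R) : 0 < k < 1 -> continuous (fun x : R => a * dnf k (x / c)).
    move=> /andP[h0 h1] x; have h01 : 0 <= k < 1 by rewrite h1 ltW.
    apply: cvgM; first exact: cvg_cst.
    apply: (@continuous_comp _ _ _ (fun x : R => x / c) (dnf k)).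
      by apply: cvgM; [exact: cvg_id|exact: cvg_cst].
    exact: (isd_all_cont (fun x => isd_dnf x h01)).
  have dn0 (k a x : R) : 0 < k < 1 -> 0 < a -> 0 < a * dnf k x.
    move=> /andP[h0 h1] a0; have h01 : 0 <= k < 1 by rewrite h1 ltW.
    exact: (mulr_gt0 a0 (dnf_gt0 x h01)).
  rewrite wE; split.
  - split; [by rewrite invr_gt0|exact: bet0|exact: sqrt01 k01].
  - exact: ground_min gs.
  - by move=> u; exact: minimizer_phase_translation gs u.
  - move=> alpha' beta' k' a0 be0 k'01 mu.
    have [t [c h]] := minimizer_shape gs mu.
    have kk := sqr01 k'01.
    have := real_phase_eq (cdn _ (q m) (bet m) k01) (cdn _ alpha'^-1 beta' kk) _ _ h.
    move=> /(_ (fun x => dn0 _ _ _ k01 q0)).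
    have a'0 : 0 < alpha'^-1 by rewrite invr_gt0.
    move=> /(_ (fun x => dn0 _ _ _ kk a'0)) hx.
    have [e1 e2 e3] := dn_parameters_unique q0 a'0 bet0 be0 k01 kk hx.
    split; [by rewrite -e1 invrK|exact: e2|rewrite -e3 sqrtr_sqr gtr0_norm; first exact: erefl].
    by case/andP: k'01.
  - rewrite -(dn_scale_period b0 m0 (kfKE _ hm)).
    exact: (dn_fundamental_period q0 bet0 k01).
split.
- move=> m; rewrite /= !in_itv /= andbT => hm; exact: sqrt01 (kf01 _ hm).
- move=> m m'; rewrite !inE /= !in_itv /= !andbT => hm hm' e.
  by have [h|h|//] := ltgtP m m'; [have := kincr _ _ hm h|have := kincr _ _ hm' h]; rewrite e ltxx.
- move=> k; rewrite /= in_itv /= => k01; have kk := sqr01 k01.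
  (* The mass that solves 4 K E = b m T for the given modulus. *)
  pose m := 4 * (Kc (k ^+ 2) * Ec (k ^+ 2)) / (b * T).
  have mE : b * m * T / 4 = Kc (k ^+ 2) * Ec (k ^+ 2).
    by rewrite /m; field; rewrite !lt0r_neq0.
  have hm : pi ^+ 2 / (b * T) < m by rewrite quarter_pi_sqr // mE KE_gt.
  exists m; first by rewrite /= in_itv /= andbT.
  have e : Kc (kf m) * Ec (kf m) = Kc (k ^+ 2) * Ec (k ^+ 2) by rewrite kfKE // mE.
  have -> : kf m = k ^+ 2.
    have [h|h|//] := ltgtP (kf m) (k ^+ 2).
    + have /andP[f0 _] := kf01 _ hm; have /andP[_ f1] := kk.
      by have := KE_incr (ltW f0) h f1; rewrite e ltxx.
    + have /andP[_ f1] := kf01 _ hm; have /andP[f0 _] := kk.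
      by have := KE_incr (ltW f0) h f1; rewrite e ltxx.
  by rewrite sqrtr_sqr gtr0_norm //; case/andP: k01.
Qed.
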